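(* Consider the following potentials in $\mathbb{C}[x_1,x_2]$: $V^{(\mathrm{A}_{d-1})}=x_1^d+x_2^2$ ($d\ge2$), $V^{(\mathrm{D}_{d+1})}=x_1^d+x_1x_2^2$ ($d\ge3$), $V^{(\mathrm{E}_6)}=x_1^3+x_2^4$, $V^{(\mathrm{E}_7)}=x_1^3+x_1x_2^3$, $V^{(\mathrm{E}_8)}=x_1^3+x_2^5$. Restricted to this set, the orbifold equivalence classes are exactly: $\{V^{(\mathrm{A}_{d-1})}\}$ for $d$ odd; $\{V^{(\mathrm{A}_{d-1})}\}$ for $d\in\{2,4\}$; $\{V^{(\mathrm{A}_{d-1})},V^{(\mathrm{D}_{d/2+1})}\}$ for $d$ even, $d\ge6$, $d\notin\{12,18,30\}$; and $\{V^{(\mathrm{A}_{11})},V^{(\mathrm{D}_7)},V^{(\mathrm{E}_6)}\}$, $\{V^{(\mathrm{A}_{17})},V^{(\mathrm{D}_{10})},V^{(\mathrm{E}_7)}\}$, $\{V^{(\mathrm{A}_{29})},V^{(\mathrm{D}_{16})},V^{(\mathrm{E}_8)}\}$.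
   Context: Work over $k=\mathbb{C}$. Each listed polynomial is a homogeneous potential: the variables carry degrees in $\mathbb{Q}_{>0}$ (uniquely determined) such that the polynomial has degree $2$, i.e. $V(\lambda^{|x_1|}x_1,\lambda^{|x_2|}x_2)=\lambda^2V$. For potentials $V(x)\in\mathbb{C}[x_1,\dots,x_m]$, $W(y)\in\mathbb{C}[y_1,\dots,y_n]$ in disjoint variables, a finite-rank graded matrix factorisation of $W-V$ is a $\mathbb{Z}_2$-graded free module $X=X^0\oplus X^1$ over $\mathbb{C}[x,y]$ of finite rank, with $X^0,X^1$ also $\mathbb{Q}$-graded so that each variable acts with its degree, and an odd $\mathbb{C}[x,y]$-linear map $d_X$ of $\mathbb{Q}$-degree 1 with $d_X^2=(W-V)\cdot1$. Its quantum dimensions are $\dim_{\mathrm{l}}(X)=(-1)^{\binom{m+1}{2}}\operatorname{Res}\big[\operatorname{str}(\partial_{x_1}d_X\cdots\partial_{x_m}d_X\partial_{y_1}d_X\cdots\partial_{y_n}d_X)\,\mathrm{d}y/(\partial_{y_1}W,\dots,\partial_{y_n}W)\big]$ and $\dim_{\mathrm{r}}(X)=(-1)^{\binom{n+1}{2}}\operatorname{Res}\big[\operatorname{str}(\text{same product})\,\mathrm{d}x/(\partial_{x_1}V,\dots,\partial_{x_m}V)\big]$, with entrywise derivatives, supertrace $\operatorname{str}$ and Grothendieck residue. $V$ and $W$ are orbifold equivalent if such an $X$ exists with both quantum dimensions non-zero; this is an equivalence relation. *)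

(* Defs.v *)
From HB Require Import structures.
From mathcomp Require Import all_boot all_algebra.
From mathcomp Require Import reals.
From mathcomp.real_closed Require Import complex.
From mathcomp Require Import mpoly.
From Stdlib Require Import ClassicalEpsilon.

Set Implicit Arguments.
Unset Strict Implicit.
Unset Printing Implicit Defensive.

Import GRing.Theory.
Local Open Scope ring_scope.

Section OrbifoldEquivalence.
Variable K : fieldType.

Definition mono_wdeg n (w : 'I_n -> rat) (m : 'X_{1..n}) : rat :=
  \sum_(i < n) (m i)%:R * w i.

(* p is weighted-homogeneous of degree r (0 is homogeneous of every degree) *)
Definition whomog n (w : 'I_n -> rat) (r : rat) (p : {mpoly K[n]}) : Prop :=
  forall m, m \in msupp p -> mono_wdeg w m = r.

Definition v0 : 'I_2 := @Ordinal 2 0 isT.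
Definition v1 : 'I_2 := @Ordinal 2 1 isT.

Definition in_jac (W g : {mpoly K[2]}) : Prop :=
  exists a b : {mpoly K[2]}, g = a * mderiv v0 W + b * mderiv v1 W.

Definition hess (W : {mpoly K[2]}) : {mpoly K[2]} :=
  mderiv v0 (mderiv v0 W) * mderiv v1 (mderiv v1 W)
  - mderiv v1 (mderiv v0 W) * mderiv v0 (mderiv v1 W).

(* mu = dim_C C[y]/(d_1 W, d_2 W): there is a family of mu polynomials
   whose classes form a basis of the Jacobian algebra *)
Definition milnor_number (W : {mpoly K[2]}) (mu : nat) : Prop :=
  exists b : 'I_mu -> {mpoly K[2]},
    (forall c : 'I_mu -> K, in_jac W (\sum_(i < mu) c i *: b i) ->
       forall i, c i = 0) /\
    (forall g, exists c : 'I_mu -> K, in_jac W (g - \sum_(i < mu) c i *: b i)).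

(* Grothendieck residue  Res[ g dy / (d_1 W, d_2 W) ]  for a           *)
(* quasi-homogeneous W (weights w, degree 2) with isolated singularity. *)
(* It is characterised (local duality) as the unique C-linear map      *)
(* which kills the Jacobian ideal, kills weighted-homogeneous elements *)
(* of degree different from the Hessian degree sum_i (2 - 2 w_i), and  *)
(* sends the Hessian to the Milnor number.                             *)

Definition is_residue (w : 'I_2 -> rat) (W : {mpoly K[2]})
    (res : {mpoly K[2]} -> K) : Prop :=
  [/\ (forall (a b : K) (g h : {mpoly K[2]}),
          res (a *: g + b *: h) = a * res g + b * res h),
      (forall g, in_jac W g -> res g = 0),
      (forall g r, whomog w r g -> r <> \sum_(i < 2) (2 - 2 * w i) ->
          res g = 0)
    & exists2 mu, milnor_number W mu & res (hess W) = mu%:R ].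

Definition residue (w : 'I_2 -> rat) (W : {mpoly K[2]}) : {mpoly K[2]} -> K :=
  epsilon (inhabits (fun _ => 0)) (is_residue w W).

Definition xv (i : 'I_2) : 'I_(2 + 2) := lshift 2 i.
Definition yv (i : 'I_2) : 'I_(2 + 2) := rshift 2 i.

Definition in_x (V : {mpoly K[2]}) : {mpoly K[2 + 2]} :=
  V \mPo (mktuple (fun i : 'I_2 => 'X_(xv i) : {mpoly K[2 + 2]})).
Definition in_y (W : {mpoly K[2]}) : {mpoly K[2 + 2]} :=
  W \mPo (mktuple (fun i : 'I_2 => 'X_(yv i) : {mpoly K[2 + 2]})).

Definition wxy (wV wW : 'I_2 -> rat) (i : 'I_(2 + 2)) : rat :=
  match split i with inl j => wV j | inr j => wW j end.

Definition xmon (m : 'X_{1..2 + 2}) : {mpoly K[2]} :=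
  \prod_(i < 2) 'X_i ^+ m (xv i).
Definition ymon (m : 'X_{1..2 + 2}) : {mpoly K[2]} :=
  \prod_(i < 2) 'X_i ^+ m (yv i).

(* Residues with parameters (C[x]-linear, resp. C[y]-linear extension) *)
Definition res_y (wW : 'I_2 -> rat) (W : {mpoly K[2]}) (S : {mpoly K[2 + 2]})
  : {mpoly K[2]} :=
  \sum_(m <- msupp S) (S@_m * residue wW W (ymon m)) *: xmon m.
Definition res_x (wV : 'I_2 -> rat) (V : {mpoly K[2]}) (S : {mpoly K[2 + 2]})
  : {mpoly K[2]} :=
  \sum_(m <- msupp S) (S@_m * residue wV V (xmon m)) *: ymon m.

(* Finite-rank graded matrix factorisations of W(y) - V(x).            *)
(* X = X^0 (+) X^1 free of ranks n0, n1 with homogeneous basis; the    *)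
(* basis vector a has Q-degree q a; d_X is odd, i.e. of block form     *)
(*      d_X = [ 0  d1 ]     d0 : X^0 -> X^1,  d1 : X^1 -> X^0          *)
(*            [ d0  0 ]                                                *)
(* (matrices act on coordinate column vectors).                        *)

Record mf_data := MFData {
  mf_n0 : nat;
  mf_n1 : nat;
  mf_q : 'I_(mf_n0 + mf_n1) -> rat;
  mf_d0 : 'M[{mpoly K[2 + 2]}]_(mf_n1, mf_n0);
  mf_d1 : 'M[{mpoly K[2 + 2]}]_(mf_n0, mf_n1)
}.

Arguments mf_q : clear implicits.
Arguments mf_d0 : clear implicits.
Arguments mf_d1 : clear implicits.
Arguments mf_n0 : clear implicits.
Arguments mf_n1 : clear implicits.

Definition mf_D (X : mf_data) : 'M[{mpoly K[2 + 2]}]_(mf_n0 X + mf_n1 X) :=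
  block_mx 0 (mf_d1 X) (mf_d0 X) 0.

Arguments mf_D : clear implicits.

Definition is_graded_mf (wV wW : 'I_2 -> rat) (V W : {mpoly K[2]})
    (X : mf_data) : Prop :=
  mf_D X *m mf_D X = (in_y W - in_x V)%:M /\
  (forall a b, whomog (wxy wV wW) (1 + mf_q X b - mf_q X a) (mf_D X a b)).

Definition str n0 n1 (P : 'M[{mpoly K[2 + 2]}]_(n0 + n1)) : {mpoly K[2 + 2]} :=
  \sum_(i < n0) P (lshift n1 i) (lshift n1 i)
  - \sum_(j < n1) P (rshift n0 j) (rshift n0 j).

Definition qd_product (X : mf_data) : 'M[{mpoly K[2 + 2]}]_(mf_n0 X + mf_n1 X) :=
  let dD i := map_mx (mderiv i) (mf_D X) in
  dD (xv v0) *m dD (xv v1) *m dD (yv v0) *m dD (yv v1).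

Arguments qd_product : clear implicits.

(* left and right quantum dimensions (m = n = 2 variables) *)
Definition qdim_l (wW : 'I_2 -> rat) (W : {mpoly K[2]}) (X : mf_data)
  : {mpoly K[2]} :=
  (-1) ^+ 'C(2 + 1, 2) *: res_y wW W (str (qd_product X)).
Definition qdim_r (wV : 'I_2 -> rat) (V : {mpoly K[2]}) (X : mf_data)
  : {mpoly K[2]} :=
  (-1) ^+ 'C(2 + 1, 2) *: res_x wV V (str (qd_product X)).

Definition orbifold_equivalent (wV : 'I_2 -> rat) (V : {mpoly K[2]})
    (wW : 'I_2 -> rat) (W : {mpoly K[2]}) : Prop :=
  exists X : mf_data, is_graded_mf wV wW V W X /\
    qdim_l wW W X != 0 /\ qdim_r wV V X != 0.

Inductive ADE := A of nat | D of nat | E6 | E7 | E8.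

(* A d = V^(A_{d-1}) (d >= 2),  D d = V^(D_{d+1}) (d >= 3) *)
Definition ADE_valid (a : ADE) : Prop :=
  match a with A d => (2 <= d)%N | D d => (3 <= d)%N | _ => True end.

Definition pot (a : ADE) : {mpoly K[2]} :=
  match a with
  | A d => 'X_v0 ^+ d + 'X_v1 ^+ 2
  | D d => 'X_v0 ^+ d + 'X_v0 * 'X_v1 ^+ 2
  | E6 => 'X_v0 ^+ 3 + 'X_v1 ^+ 4
  | E7 => 'X_v0 ^+ 3 + 'X_v0 * 'X_v1 ^+ 3
  | E8 => 'X_v0 ^+ 3 + 'X_v1 ^+ 5
  end.

End OrbifoldEquivalence.

(* the (unique) degrees |x_1|, |x_2| making pot a of degree 2 *)
Definition wts (a : ADE) (i : 'I_2) : rat :=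
  match a with
  | A d => if i == v0 then 2 / d%:R else 1
  | D d => if i == v0 then 2 / d%:R else 1 - 1 / d%:R
  | E6 => if i == v0 then 2 / 3 else 1 / 2
  | E7 => if i == v0 then 2 / 3 else 4 / 9
  | E8 => if i == v0 then 2 / 3 else 2 / 5
  end.

(* Class label: the listed equivalence classes are exactly the fibres of
   this map:  A_{d-1} |-> d,  D_{d'+1} |-> 2d' (so D_{d/2+1} |-> d),
   E6 |-> 12, E7 |-> 18, E8 |-> 30.  Hence the classes are
   {A_{d-1}} for d odd or d in {2,4};  {A_{d-1}, D_{d/2+1}} for d even,
   d >= 6, d not in {12,18,30}; {A11,D7,E6}, {A17,D10,E7}, {A29,D16,E8}. *)
Definition class_key (a : ADE) : nat :=
  match a with
  | A d => d
  | D d => (2 * d)%N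
  | E6 => 12
  | E7 => 18
  | E8 => 30
  end.

(* Main.v *)
(* A weighted-homogeneous potential of degree 2 has a residue that vanishes off
   a single degree, sum (2 - 2 w_i).  The supertrace in the left quantum dimension
   is homogeneous, so that dimension is homogeneous of degree sum wW - sum wV in
   the remaining variables, and the right one of the opposite degree.  Both can be
   non-zero only if the two weight sums agree; the weight sum is 1 + 2 / key.

   For the converse, Koszul factorisations handle a potential against itself and
   A against D.  For E against A and D one needs a matrix square root of
   W(y) - x^2m, with W the E potential; it comes from a rational curve on the
   surface W(y) = z^2 + x^2m, whose coefficients are algebraic numbers.  Split into
   parts Ne and x No, even and odd in x, it satisfies  Ne^2 + U No^2 = W(y) - U^m
   and  Ne No + No Ne = 0  with U = x^2.  The factorisation N -/+ z of
   W(y) - x^2m - z^2 then gives A; its push-forward along the Z_2-quotient, in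
   which multiplication by x becomes the matrix (0 U; 1 0), gives D. *)
Require Import Defs.
From HB Require Import structures.
From mathcomp Require Import all_boot all_order all_algebra.
From mathcomp Require Import reals.
From mathcomp.real_closed Require Import complex.
From mathcomp Require Import mpoly.
From Stdlib Require Import ClassicalEpsilon.
From mathcomp Require Import ring lra zify.
Set Implicit Arguments.
Unset Strict Implicit.
Unset Printing Implicit Defensive.

Import Order.TTheory GRing.Theory Num.Theory.
Local Open Scope ring_scope.

(** Since [residue] is an epsilon choice, nothing is known about it until one functional with the
    four defining properties is exhibited. This is done on monomial bases of the Jacobian algebras,
    and afterwards only those properties are used. A quantum dimension is shown to be non-zero
    through its constant term, which is the residue of the supertrace at x = 0 (left) or y = 0
    (right). Only values and first derivatives of the matrix entries at these points matter, and the
    result has to be a non-zero multiple of a monomial spanning the socle of the Jacobian algebra. A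
    curve y = p(x,t), z = q(x,t) on W(y,t) = z^2 + x^2m gives W(y,t) - x^2m = q^2 + (W(y,t) -
    W(p,t)). For E6 and E7 the last difference is divisible by y - p, so q and the two factors are
    the entries of a square root of rank 2. With p, q weighted homogeneous, the condition on the
    curve is a finite polynomial system in the coefficients. It is solved up to the scaling x -> r x
    over a small number field; a root extraction then makes the coefficient of x^2m right. Each pair
    A-D, A-E, D-E gets its own factorisation, and symmetry supplies the mirrored pairs. *)

(** * Polynomial substitution and the chain rule *)

Section Substitution.
Variables (K : fieldType) (n k : nat).
Implicit Types (p q : {mpoly K[n]}) (f : 'I_n -> {mpoly K[k]}).

Lemma mpoly_alg_ind (P : {mpoly K[n]} -> Prop) :
  (forall c, P c%:MP) -> (forall i, P 'X_i) ->
  (forall p q, P p -> P q -> P (p + q)) ->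
  (forall p q, P p -> P q -> P (p * q)) -> forall p, P p.
Proof.
move=> PC PX PD PM p; elim/mpolyind: p => [|c m p _ _ Pp]; first by rewrite -mpolyC0.
apply: (PD) => //; rewrite -mul_mpolyC; apply: (PM) => //.
rewrite mpolyXE_id; elim/big_ind: _ => [|p1 p2|i _]; [by rewrite -mpolyC1|exact: PM|].
elim: (m i) => [|e IHe]; first by rewrite expr0 -mpolyC1.
by rewrite exprS; apply: PM.
Qed.

Lemma mderiv_exp i p e : (p ^+ e)^`M(i) = e%:R * p ^+ e.-1 * p^`M(i).
Proof.
elim: e => [|e IHe]; first by rewrite expr0 -mpolyC1 mderivC mul0r mul0r.
rewrite exprS mderivM IHe /=; case: e {IHe} => [|e] /=; first by ring.
by rewrite [e.+2%:R]mulrS exprS; ring.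
Qed.

Lemma mderivXU i j : ('X_j : {mpoly K[n]})^`M(i) = (j == i)%:R.
Proof.
rewrite mderivX mnm1E; case: eqP => [->|_]; last by rewrite scale0r.
have -> : (U_(i) - U_(i) = 0)%MM by apply/mnmP => l; rewrite mnmBE subnn mnm0E.
by rewrite scale1r mpolyX0.
Qed.

Lemma comp_mktupleX f i : 'X_i \mPo mktuple f = f i.
Proof. by rewrite comp_mpolyXU -tnth_nth tnth_mktuple. Qed.

Lemma mderiv_comp f p j :
  (p \mPo mktuple f)^`M(j) = \sum_i (p^`M(i) \mPo mktuple f) * (f i)^`M(j).
Proof.
elim/mpoly_alg_ind: p => [c|i|p q IHp IHq|p q IHp IHq].
- rewrite comp_mpolyC mderivC big1 // => i _.
  by rewrite mderivC comp_mpoly0 mul0r.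
- rewrite comp_mktupleX (bigD1 i) //= mderivXU eqxx rmorph1 mul1r big1 ?addr0 //.
  by move=> l ne_li; rewrite mderivXU eq_sym (negPf ne_li) rmorph0 mul0r.
- rewrite rmorphD /= !mderivD IHp IHq -big_split /=; apply: eq_bigr => i _.
  by rewrite mderivD rmorphD mulrDl.
rewrite rmorphM /= mderivM IHp IHq mulr_suml mulr_sumr -big_split /=.
by apply: eq_bigr => i _; rewrite mderivM rmorphD !rmorphM /=; ring.
Qed.

End Substitution.

Lemma comp_comp_mpoly (K : fieldType) (n k l : nat) (f : 'I_n -> {mpoly K[k]})
    (g : 'I_k -> {mpoly K[l]}) p :
  (p \mPo mktuple f) \mPo mktuple g = p \mPo mktuple (fun i => f i \mPo mktuple g).
Proof.
elim/mpoly_alg_ind: p => [c|i|p q IHp IHq|p q IHp IHq].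
- by rewrite !comp_mpolyC.
- by rewrite !comp_mktupleX.
- by rewrite !rmorphD /= IHp IHq.
by rewrite !rmorphM /= IHp IHq.
Qed.

(** * Weighted homogeneous polynomials *)

Section WeightedHomogeneity.
Variable K : fieldType.
Implicit Types r : rat.

Lemma whomog0 n w r : whomog w r (0 : {mpoly K[n]}).
Proof. by move=> m; rewrite msupp0. Qed.

Lemma whomogD n w r r' (p q : {mpoly K[n]}) :
  whomog w r p -> whomog w r' q -> r = r' -> whomog w r (p + q).
Proof.
move=> hp hq eq_r m /msuppD_le; rewrite mem_cat => /orP[/hp //|/hq ->].
by rewrite eq_r.
Qed.

Lemma whomogN n w r (p : {mpoly K[n]}) : whomog w r p -> whomog w r (- p).
Proof. by move=> hp m; rewrite (perm_mem (msuppN p)); apply: hp. Qed.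

Lemma whomogB n w r r' (p q : {mpoly K[n]}) :
  whomog w r p -> whomog w r' q -> r = r' -> whomog w r (p - q).
Proof. by move=> hp /whomogN; apply: whomogD. Qed.

Lemma mono_wdegD n (w : 'I_n -> rat) m1 m2 :
  mono_wdeg w (m1 + m2) = mono_wdeg w m1 + mono_wdeg w m2.
Proof.
by rewrite -big_split; apply: eq_bigr => i _; rewrite mnmDE natrD mulrDl.
Qed.

Lemma whomogM n w r r' (p q : {mpoly K[n]}) :
  whomog w r p -> whomog w r' q -> whomog w (r + r') (p * q).
Proof.
move=> hp hq m /msuppM_le /allpairsP[[m1 m2] /= [/hp <- /hq <- ->]].
exact: mono_wdegD.
Qed.

Lemma whomogC n w c : whomog w 0 (c%:MP : {mpoly K[n]}).
Proof.
move=> m; rewrite msuppC; case: eqP => // _; rewrite inE => /eqP ->.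
by rewrite /mono_wdeg big1 // => i _; rewrite mnm0E mul0r.
Qed.

Lemma whomog1 n w : whomog w 0 (1 : {mpoly K[n]}).
Proof. by rewrite -mpolyC1; apply: whomogC. Qed.

Lemma whomogX n w i : whomog w (w i) ('X_i : {mpoly K[n]}).
Proof.
move=> m; rewrite msuppX inE => /eqP ->.
rewrite /mono_wdeg (bigD1 i) //= mnm1E eqxx mul1r big1 ?addr0 // => j ne_ji.
by rewrite mnm1E eq_sym (negPf ne_ji) mul0r.
Qed.

Lemma whomogE n w r (p : {mpoly K[n]}) e :
  whomog w r p -> whomog w (e%:R * r) (p ^+ e).
Proof.
move=> hp; elim: e => [|e IHe]; first by rewrite mul0r; apply: whomog1.
by rewrite exprS mulrS mulrDl mul1r; apply: whomogM.
Qed.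

Lemma whomogZ n w r c (p : {mpoly K[n]}) : whomog w r p -> whomog w r (c *: p).
Proof. by move=> hp m /msuppZ_le; apply: hp. Qed.

Lemma whomog_sum n w r (I : Type) (s : seq I) (P : pred I)
    (F : I -> {mpoly K[n]}) :
  (forall i, P i -> whomog w r (F i)) -> whomog w r (\sum_(i <- s | P i) F i).
Proof.
move=> hF; elim/big_ind: _ => // [|p q hp hq]; first exact: whomog0.
exact: (whomogD hp hq).
Qed.

Lemma whomog_eq n w r r' (p : {mpoly K[n]}) :
  whomog w r p -> r = r' -> whomog w r' p.
Proof. by move=> hp <-. Qed.

Lemma whomog_mderiv n (w : 'I_n -> rat) r i (p : {mpoly K[n]}) :
  whomog w r p -> whomog w (r - w i) p^`M(i).
Proof.
move=> hp m; rewrite mcoeff_msupp mcoeff_mderiv => nz.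
have /hp <- : (m + U_(i))%MM \in msupp p.
  by rewrite mcoeff_msupp; apply: contraNneq nz => ->; rewrite mul0rn.
have <- : mono_wdeg w U_(i) = w i.
  by apply: (@whomogX n w i); rewrite msuppX inE.
by rewrite mono_wdegD addrK.
Qed.

Lemma whomog_comp n k (w : 'I_n -> rat) (w' : 'I_k -> rat)
    (f : 'I_n -> {mpoly K[k]}) r p :
  (forall i, whomog w' (w i) (f i)) -> whomog w r p ->
  whomog w' r (p \mPo mktuple f).
Proof.
move=> hf hp; rewrite comp_mpolyE big_seq; apply: whomog_sum => m /hp <-.
apply: whomogZ; rewrite /mono_wdeg.
elim: (index_enum 'I_n) => [|i s IHs]; first by rewrite !big_nil; apply: whomog1.
by rewrite !big_cons; apply: whomogM IHs; rewrite tnth_mktuple; apply: whomogE.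
Qed.

End WeightedHomogeneity.

(** * Two variables: monomials, Jacobian ideals, linear forms *)

Lemma big_ord2 (R : Type) (idx : R) (op : Monoid.law idx) (F : 'I_2 -> R) :
  \big[op/idx]_(i < 2) F i = op (F v0) (F v1).
Proof.
rewrite big_ord_recl big_ord1; congr (op (F _) (F _)); exact: val_inj.
Qed.

Lemma ord2P (P : 'I_2 -> Prop) : P v0 -> P v1 -> forall i, P i.
Proof.
move=> P0 P1 [[|[|//]] ltm].
  by rewrite (_ : Ordinal ltm = v0) //; apply: val_inj.
by rewrite (_ : Ordinal ltm = v1) //; apply: val_inj.
Qed.

Section TwoVariables.
Variable K : numFieldType.
Implicit Types (p g : {mpoly K[2]}).
Local Notation X0 := ('X_v0 : {mpoly K[2]}).
Local Notation X1 := ('X_v1 : {mpoly K[2]}).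

Definition mnm2 (i j : nat) : 'X_{1..2} := (U_(v0) *+ i + U_(v1) *+ j)%MM.

Lemma mnm2_v0 i j : mnm2 i j v0 = i.
Proof. by rewrite mnmDE !mulmnE !mnm1E mul1n mul0n addn0. Qed.

Lemma mnm2_v1 i j : mnm2 i j v1 = j.
Proof. by rewrite mnmDE !mulmnE !mnm1E mul1n mul0n add0n. Qed.

Lemma eq_mnm2 i j k l : (mnm2 i j == mnm2 k l) = (i == k) && (j == l).
Proof.
apply/eqP/andP => [eq_m|[/eqP -> /eqP ->] //].
have := congr1 (fun m : 'X_{1..2} => (m v0, m v1)) eq_m.
by rewrite /= !mnm2_v0 !mnm2_v1 => -[-> ->].
Qed.

Lemma mpolyX2E (m : 'X_{1..2}) : 'X_[m] = X0 ^+ m v0 * X1 ^+ m v1.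
Proof. by rewrite mpolyXE_id big_ord2. Qed.

Lemma mcoeff_mnm2 i j k l :
  (X0 ^+ k * X1 ^+ l)@_(mnm2 i j) = ((k == i) && (l == j))%:R.
Proof.
have -> : X0 ^+ k * X1 ^+ l = 'X_[mnm2 k l] by rewrite (mpolyX2E (mnm2 k l)) mnm2_v0 mnm2_v1.
by rewrite mcoeffX eq_mnm2.
Qed.

Lemma mono_wdeg_mnm2 w i j : mono_wdeg w (mnm2 i j) = i%:R * w v0 + j%:R * w v1.
Proof. by rewrite /mono_wdeg big_ord2 mnm2_v0 mnm2_v1. Qed.

Lemma mpoly2_ind (P : {mpoly K[2]} -> Prop) : P 0 ->
  (forall c i j p, P p -> P (c *: (X0 ^+ i * X1 ^+ j) + p)) -> forall p, P p.
Proof.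
move=> P_0 PD p; elim/mpolyind: p => [//|c m p _ _ Pp]; rewrite (mpolyX2E m); exact: PD.
Qed.

Lemma in_jac0 (W : {mpoly K[2]}) : in_jac W 0.
Proof. by exists 0, 0; rewrite !mul0r addr0. Qed.

Lemma in_jacD (W : {mpoly K[2]}) p g : in_jac W p -> in_jac W g -> in_jac W (p + g).
Proof.
by move=> [a1 [b1 ->]] [a2 [b2 ->]]; exists (a1 + a2), (b1 + b2); ring.
Qed.

Lemma in_jacM (W : {mpoly K[2]}) p g : in_jac W g -> in_jac W (p * g).
Proof. by move=> [a [b ->]]; exists (p * a), (p * b); ring. Qed.

Lemma in_jacZ (W : {mpoly K[2]}) c g : in_jac W g -> in_jac W (c *: g).
Proof. by rewrite -mul_mpolyC; apply: in_jacM. Qed.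

Lemma in_jacB (W : {mpoly K[2]}) p g : in_jac W p -> in_jac W g -> in_jac W (p - g).
Proof. by move=> hp hg; apply: in_jacD => //; rewrite -mulN1r; apply: in_jacM. Qed.

Lemma in_jac_d0 (W : {mpoly K[2]}) p : in_jac W (p * W^`M(v0)).
Proof. by exists p, 0; rewrite mul0r addr0. Qed.

Lemma in_jac_d1 (W : {mpoly K[2]}) p : in_jac W (p * W^`M(v1)).
Proof. by exists 0, p; rewrite mul0r add0r. Qed.

Definition linear_form (f : {mpoly K[2]} -> K) :=
  forall a b g h, f (a *: g + b *: h) = a * f g + b * f h.

Section LinearForm.
Variable f : {mpoly K[2]} -> K.
Hypothesis f_lin : linear_form f.

Lemma linear_form0 : f 0 = 0.
Proof. by have := f_lin 0 0 0 0; rewrite !scale0r !mul0r !addr0. Qed.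

Lemma linear_formZ c g : f (c *: g) = c * f g.
Proof. by have := f_lin c 0 g 0; rewrite scale0r mul0r !addr0. Qed.

Lemma linear_formD g h : f (g + h) = f g + f h.
Proof. by have := f_lin 1 1 g h; rewrite !scale1r !mul1r. Qed.

Lemma linear_formB g h : f (g - h) = f g - f h.
Proof. by rewrite linear_formD -scaleN1r linear_formZ mulN1r. Qed.

Lemma linear_form_sum (I : Type) (s : seq I) (F : I -> {mpoly K[2]}) :
  f (\sum_(i <- s) F i) = \sum_(i <- s) f (F i).
Proof.
elim: s => [|i s IHs]; first by rewrite !big_nil linear_form0.
by rewrite !big_cons linear_formD IHs.
Qed.

Lemma linear_form_jac (W : {mpoly K[2]}) :
  (forall i j, f (X0 ^+ i * X1 ^+ j * W^`M(v0)) = 0) ->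
  (forall i j, f (X0 ^+ i * X1 ^+ j * W^`M(v1)) = 0) ->
  forall g, in_jac W g -> f g = 0.
Proof.
move=> f0 f1 _ [a [b ->]]; rewrite linear_formD.
have kill q : (forall i j, f (X0 ^+ i * X1 ^+ j * q) = 0) -> forall p, f (p * q) = 0.
  move=> fq; elim/mpoly2_ind => [|c i j p IHp]; first by rewrite mul0r linear_form0.
  by rewrite mulrDl -scalerAl linear_formD linear_formZ fq IHp mulr0 addr0.
by rewrite !kill // addr0.
Qed.

End LinearForm.

(** Independence comes from forms that kill the Jacobian ideal and are dual to the [b i]. Each
    monomial is a multiple of a single [b i] modulo the ideal, so its coefficient is forced to be
    the value of the form; spanning then follows by induction over monomials with the values [l i g]
    as coefficients. *)
Lemma milnor_dual_basis (W : {mpoly K[2]}) (I : finType) (b : I -> {mpoly K[2]})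
    (l : I -> {mpoly K[2]} -> K) :
  (forall i, linear_form (l i)) ->
  (forall i g, in_jac W g -> l i g = 0) ->
  (forall i j, l i (b j) = (i == j)%:R) ->
  (forall k e, exists c i, in_jac W (X0 ^+ k * X1 ^+ e - c *: b i)) ->
  milnor_number W #|I|.
Proof.
move=> l_lin l_jac l_b span; exists (b \o enum_val); split=> [c hc i|g].
  have := l_jac (enum_val i) _ hc; rewrite (linear_form_sum (l_lin _)) /=.
  rewrite (bigD1 i) //= linear_formZ // l_b eqxx mulr1 big1 ?addr0 // => j ne_ji.
  by rewrite linear_formZ // l_b (inj_eq enum_val_inj) eq_sym (negPf ne_ji) mulr0.
exists (fun i => l (enum_val i) g).
rewrite /= -(big_enum_val (fun i => l i g *: b i)).
elim/mpoly2_ind: g => [|c k e p IHp].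
  rewrite big1 ?subr0; first exact: in_jac0.
  by move=> i _; rewrite linear_form0 // scale0r.
have [c' [i0 hi0]] := span k e.
have l_mono i : l i (X0 ^+ k * X1 ^+ e) = c' * (i == i0)%:R.
  apply/subr0_eq; rewrite -l_b -linear_formZ // -linear_formB //.
  exact: l_jac.
have -> : \sum_(i in I) l i (c *: (X0 ^+ k * X1 ^+ e) + p) *: b i
        = c *: (c' *: b i0) + \sum_(i in I) l i p *: b i.
  under eq_bigr => i _ do rewrite linear_formD // linear_formZ // scalerDl l_mono.
  rewrite big_split /=; congr (_ + _).
  rewrite (bigD1 i0) //= eqxx mulr1 big1 ?addr0 ?scalerA // => i ne_i.
  by rewrite (negPf ne_i) !mulr0 scale0r.
have -> : forall u v s : {mpoly K[2]},
    c *: u + p - (c *: v + s) = c *: (u - v) + (p - s).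
  by move=> u v s; rewrite -!mul_mpolyC; ring.
by apply: in_jacD => //; apply: in_jacZ.
Qed.

End TwoVariables.

(** * Residues of x^m + y^n and x^m + x y^n *)

Section ResidueExistence.
Variable K : numFieldType.
Local Notation X0 := ('X_v0 : {mpoly K[2]}).
Local Notation X1 := ('X_v1 : {mpoly K[2]}).

Definition fermat (m n : nat) : {mpoly K[2]} := X0 ^+ m + X1 ^+ n.
Definition chain (m n : nat) : {mpoly K[2]} := X0 ^+ m + X0 * X1 ^+ n.

Lemma linear_form_mcoeff m : linear_form (mcoeff m : {mpoly K[2]} -> K).
Proof. by move=> a b g h; rewrite mcoeffD !mcoeffZ. Qed.

Lemma monoM i j k l : X0 ^+ i * X1 ^+ j * (X0 ^+ k * X1 ^+ l)
  = X0 ^+ (i + k) * X1 ^+ (j + l).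
Proof. by rewrite !exprD; ring. Qed.

Let v01 : (v0 == v1) = false. Proof. by []. Qed.
Let v10 : (v1 == v0) = false. Proof. by []. Qed.

Lemma fermat_d0 m n : (fermat m.+1 n)^`M(v0) = m.+1%:R *: (X0 ^+ m * X1 ^+ 0).
Proof.
rewrite mderivD !mderiv_exp !mderivXU eqxx v10 /= -mul_mpolyC mpolyC_nat.
by rewrite expr0; ring.
Qed.

Lemma fermat_d1 m n : (fermat m n.+1)^`M(v1) = n.+1%:R *: (X0 ^+ 0 * X1 ^+ n).
Proof.
rewrite mderivD !mderiv_exp !mderivXU eqxx v01 /= -mul_mpolyC mpolyC_nat.
by rewrite expr0; ring.
Qed.

Lemma chain_d0 m n : (chain m.+1 n)^`M(v0)
  = m.+1%:R *: (X0 ^+ m * X1 ^+ 0) + X0 ^+ 0 * X1 ^+ n.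
Proof.
rewrite mderivD mderivM !mderiv_exp !mderivXU eqxx v10 /= -mul_mpolyC mpolyC_nat.
by rewrite !expr0; ring.
Qed.

Lemma chain_d1 m n : (chain m n.+1)^`M(v1) = n.+1%:R *: (X0 ^+ 1 * X1 ^+ n).
Proof.
rewrite mderivD mderivM !mderiv_exp !mderivXU eqxx v01 /= -mul_mpolyC mpolyC_nat.
by ring.
Qed.

Lemma natr1_neq0 n : n.+1%:R != 0 :> K.
Proof. by rewrite pnatr_eq0. Qed.

Lemma fermat_jac0 m n k l : (m < k)%N -> in_jac (fermat m.+2 n.+2) (X0 ^+ k * X1 ^+ l).
Proof.
move=> lt_mk; have := in_jac_d0 (fermat m.+2 n.+2) (X0 ^+ (k - m.+1) * X1 ^+ l).
rewrite fermat_d0 -scalerAr monoM subnK // addn0 => /(in_jacZ m.+2%:R^-1).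
by rewrite scalerA mulVf ?natr1_neq0 // scale1r.
Qed.

Lemma fermat_jac1 m n k l : (n < l)%N -> in_jac (fermat m.+2 n.+2) (X0 ^+ k * X1 ^+ l).
Proof.
move=> lt_nl; have := in_jac_d1 (fermat m.+2 n.+2) (X0 ^+ k * X1 ^+ (l - n.+1)).
rewrite fermat_d1 -scalerAr monoM subnK // addn0 => /(in_jacZ n.+2%:R^-1).
by rewrite scalerA mulVf ?natr1_neq0 // scale1r.
Qed.

Lemma fermat_mcoeff m n i j g : (i <= m)%N -> (j <= n)%N ->
  in_jac (fermat m.+2 n.+2) g -> g@_(mnm2 i j) = 0.
Proof.
move=> le_im le_jn; apply: (linear_form_jac (linear_form_mcoeff _)) => k l.
  rewrite fermat_d0 -scalerAr monoM mcoeffZ mcoeff_mnm2.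
  by rewrite (_ : (_ == i) = false) ?mulr0 //; lia.
rewrite fermat_d1 -scalerAr monoM mcoeffZ mcoeff_mnm2.
by rewrite (_ : (_ == j) = false) ?andbF ?mulr0 //; lia.
Qed.

Lemma fermat_milnor m n : milnor_number (fermat m.+2 n.+2) (m.+1 * n.+1).
Proof.
have := @milnor_dual_basis K (fermat m.+2 n.+2) ('I_m.+1 * 'I_n.+1)%type
  (fun ij => X0 ^+ ij.1 * X1 ^+ ij.2) (fun ij => mcoeff (mnm2 ij.1 ij.2)).
rewrite card_prod !card_ord; apply.
- by move=> ij; apply: linear_form_mcoeff.
- by move=> [i j] g; apply: fermat_mcoeff; rewrite -ltnS.
- move=> [i j] [k l]; rewrite mcoeff_mnm2 /= xpair_eqE.
  by rewrite [k == i :> nat]eq_sym [l == j :> nat]eq_sym.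
move=> k l; have [lt_mk|le_km] := ltnP m k.
  by exists 0, (ord0, ord0); rewrite scale0r subr0; apply: fermat_jac0.
have [lt_nl|le_ln] := ltnP n l.
  by exists 0, (ord0, ord0); rewrite scale0r subr0; apply: fermat_jac1.
exists 1, (inord k, inord l); rewrite /= !inordK // scale1r subrr.
exact: in_jac0.
Qed.

Lemma fermat_hess m n : hess (fermat m.+2 n.+2)
  = (m.+2 * m.+1 * n.+2 * n.+1)%:R *: (X0 ^+ m * X1 ^+ n).
Proof.
rewrite /hess fermat_d0 fermat_d1 !mderivZ !mderivM !mderiv_exp !mderivXU !eqxx.
by rewrite v01 v10 /= -!mul_mpolyC !mpolyC_nat !natrM; ring.
Qed.

Let natr_sub2 k : k%:R = k.+2%:R - 2 :> rat.
Proof. by rewrite -addn2 natrD addrK. Qed.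

Let nz k : k.+2%:R != 0 :> rat.
Proof. by rewrite pnatr_eq0. Qed.

(** The functional is the coefficient of the socle monomial [X0^m X1^n] over (m+2)(n+2). This
    normalises it, because the Hessian has coefficient (m+2)(m+1)(n+2)(n+1) there and the Milnor
    number is (m+1)(n+1). *)
Lemma residueP_fermat m n w : w v0 = 2 / m.+2%:R -> w v1 = 2 / n.+2%:R ->
  is_residue w (fermat m.+2 n.+2) (residue w (fermat m.+2 n.+2)).
Proof.
move=> w0 w1; apply: epsilon_spec.
exists (fun g => (m.+2%:R * n.+2%:R)^-1 * g@_(mnm2 m n)); split.
- by move=> a b g h; rewrite linear_form_mcoeff; ring.
- by move=> g /fermat_mcoeff ->; rewrite ?mulr0.
- move=> g r hg ne_r; case: (eqVneq (g@_(mnm2 m n)) 0) => [->|]; rewrite ?mulr0 //.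
  rewrite -mcoeff_msupp => /hg def_r; case: ne_r; rewrite -def_r mono_wdeg_mnm2.
  rewrite big_ord2 /= w0 w1 [m%:R]natr_sub2 [n%:R]natr_sub2.
  by move: m.+2%:R n.+2%:R (nz m) (nz n) => a b nza nzb; field; rewrite nza nzb.
exists (m.+1 * n.+1)%N; first exact: fermat_milnor.
rewrite fermat_hess mcoeffZ mcoeff_mnm2 !eqxx mulr1 !natrM.
move: (natr1_neq0 m.+1) (natr1_neq0 n.+1).
by move: m.+2%:R n.+2%:R m.+1%:R n.+1%:R => a b a' b' nza nzb; field; rewrite nza nzb.
Qed.

Lemma chain_jac1 m n k l : (0 < k)%N -> (n < l)%N ->
  in_jac (chain m.+2 n.+2) (X0 ^+ k * X1 ^+ l).
Proof.
move=> lt_0k lt_nl.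
have := in_jac_d1 (chain m.+2 n.+2) (X0 ^+ (k - 1) * X1 ^+ (l - n.+1)).
rewrite chain_d1 -scalerAr monoM !subnK // => /(in_jacZ n.+2%:R^-1).
by rewrite scalerA mulVf ?natr1_neq0 // scale1r.
Qed.

Lemma chain_jac0 m n l : in_jac (chain m.+2 n.+2)
  (X0 ^+ 0 * X1 ^+ (l + n.+2) + m.+2%:R *: (X0 ^+ m.+1 * X1 ^+ l)).
Proof.
have := in_jac_d0 (chain m.+2 n.+2) (X0 ^+ 0 * X1 ^+ l).
by rewrite chain_d0 mulrDr -scalerAr !monoM !add0n !addn0 addrC.
Qed.

(** The monomial multiple of the first partial contains, besides the wanted monomial, only one
    divisible by [X0 X1^(n+1)], and that one is a multiple of the second partial. *)
Lemma chain_jac0' m n k l : (m.+1 < k)%N -> in_jac (chain m.+2 n.+2) (X0 ^+ k * X1 ^+ l).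
Proof.
move=> lt_mk.
have := in_jac_d0 (chain m.+2 n.+2) (X0 ^+ (k - m.+1) * X1 ^+ l).
rewrite chain_d0 mulrDr -scalerAr !monoM subnK 1?ltnW // !addn0.
have: in_jac (chain m.+2 n.+2) (X0 ^+ (k - m.+1) * X1 ^+ (l + n.+2)).
  by apply: chain_jac1; lia.
move=> h1 h2; have := in_jacZ (m.+2%:R^-1) (in_jacB h2 h1).
by rewrite addrK scalerA mulVf ?natr1_neq0 // scale1r.
Qed.

(* [X0^(m+1) X1^j] and [X1^(n+2+j)] are proportional modulo the Jacobian ideal. *)
Definition chain_form (m n i j : nat) (g : {mpoly K[2]}) : K :=
  g@_(mnm2 i j) - (i == m.+1)%:R * m.+2%:R * g@_(mnm2 0 (j + n.+2)).

Lemma linear_form_chain m n i j : linear_form (chain_form m n i j).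
Proof.
by move=> a b g h; rewrite /chain_form !mcoeffD !mcoeffZ; ring.
Qed.

Lemma chain_form_jac m n i j g : (i <= m.+1)%N -> (j <= n)%N ->
  in_jac (chain m.+2 n.+2) g -> chain_form m n i j g = 0.
Proof.
move=> le_im le_jn; apply: (linear_form_jac (linear_form_chain _ _ _ _)) => k l.
  rewrite chain_d0 mulrDr -scalerAr !monoM /chain_form !mcoeffD !mcoeffZ !mcoeff_mnm2.
  rewrite !addn0 (_ : (k + m.+1 == 0)%N = false) ?mulr0 ?add0r; last lia.
  rewrite eqn_add2r (_ : (l + n.+2 == j)%N = false) ?andbF ?addr0; last lia.
  have -> : (k + m.+1 == i)%N && (l == j) = (i == m.+1) && ((k == 0) && (l == j)) by lia.
  by case: (i == m.+1); rewrite /= ?mul0r ?mulr0 ?mul1r ?subr0 ?subrr.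
rewrite chain_d1 -scalerAr monoM /chain_form !mcoeffZ !mcoeff_mnm2.
rewrite (_ : (l + n.+1 == j)%N = false) ?andbF; last lia.
by rewrite (_ : (k + 1 == 0)%N = false) ?mulr0 ?subrr //; lia.
Qed.

(** Pure powers of [X1] enter the ideal only through multiples of the first partial, hence with
    exponent at least n+2. So [X1^(n+1)] survives as a basis element outside the rectangle of the
    other monomials; [None] indexes it below. *)
Lemma chain_None_jac m n g :
  in_jac (chain m.+2 n.+2) g -> g@_(mnm2 0 n.+1) = 0.
Proof.
apply: (linear_form_jac (linear_form_mcoeff _)) => k l.
  rewrite chain_d0 mulrDr -scalerAr !monoM mcoeffD !mcoeffZ !mcoeff_mnm2.
  rewrite (_ : (k + m.+1 == 0)%N = false) ?mulr0 ?add0r; last lia.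
  by rewrite (_ : (l + n.+2 == n.+1)%N = false) ?andbF //; lia.
rewrite chain_d1 -scalerAr monoM mcoeffZ !mcoeff_mnm2.
by rewrite (_ : (k + 1 == 0)%N = false) ?mulr0 //; lia.
Qed.

Lemma chain_milnor m n : milnor_number (chain m.+2 n.+2) (m.+2 * n.+1).+1.
Proof.
have := @milnor_dual_basis K (chain m.+2 n.+2) (option ('I_m.+2 * 'I_n.+1))%type
  (fun o => if o is Some ij then X0 ^+ ij.1 * X1 ^+ ij.2 else X0 ^+ 0 * X1 ^+ n.+1)
  (fun o => if o is Some ij then chain_form m n ij.1 ij.2 else mcoeff (mnm2 0 n.+1)).
rewrite card_option card_prod !card_ord; apply.
- by move=> [ij|]; [apply: linear_form_chain|apply: linear_form_mcoeff].
- move=> [[i j]|] g; last exact: chain_None_jac.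
  by apply: chain_form_jac; rewrite -ltnS /=.
- move=> [[i j]|] [[k l]|]; rewrite /chain_form ?mcoeff_mnm2 //=.
  + rewrite (_ : ((l : nat) == (j + n.+2)%N) = false) ?andbF ?mulr0 ?subr0.
      rewrite (_ : (Some (i, j) == Some (k, l)) = ((i, j) == (k, l))) //.
      by rewrite xpair_eqE [k == i :> nat]eq_sym [l == j :> nat]eq_sym.
    by have := ltn_ord l; lia.
  + rewrite (_ : (n.+1 == (j : nat)) = false) ?andbF.
      by rewrite (_ : (n.+1 == (j + n.+2)%N) = false) ?mulr0 ?subr0 //; lia.
    by have := ltn_ord j; lia.
  + rewrite (_ : ((l : nat) == n.+1) = false) ?andbF //.
    by have := ltn_ord l; lia.
  + by rewrite eqxx.
move=> k l; have [lt_mk|le_km] := ltnP m.+1 k.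
  by exists 0, None; rewrite scale0r subr0; apply: chain_jac0'.
have [lt_nl|le_ln] := ltnP n l; last first.
  exists 1, (Some (inord k, inord l)); rewrite /= !inordK // scale1r subrr.
  exact: in_jac0.
have [-> {k le_km}|lt_0k] := posnP k; last first.
  by exists 0, None; rewrite scale0r subr0; apply: chain_jac1.
have [->|ne_l] := eqVneq l n.+1.
  by exists 1, None; rewrite scale1r subrr; apply: in_jac0.
(* A pure power [X1^l] with l at least n+2 is traded by the first partial for
   [-(m+2) X0^(m+1) X1^(l-n-2)], which is a multiple of a basis element or, for large l, in the
   ideal. *)
have [e def_l] : exists e, l = (e + n.+2)%N by exists (l - n.+2)%N; lia.
have := chain_jac0 m n e; rewrite -def_l.
have [lt_ne|le_en] := ltnP n e => he.
  exists 0, None; rewrite scale0r subr0.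
  have := in_jacB he (in_jacZ m.+2%:R (chain_jac1 m (k := m.+1) (ltn0Sn _) lt_ne)).
  by rewrite addrK.
exists (- m.+2%:R), (Some (ord_max, inord e)).
by rewrite /= !inordK // scaleNr opprK.
Qed.

Lemma chain_hess m n : hess (chain m.+2 n.+2)
  = (m.+2 * m.+1 * n.+2 * n.+1)%:R *: (X0 ^+ m.+1 * X1 ^+ n)
    - (n.+2 * n.+2)%:R *: (X0 ^+ 0 * X1 ^+ (n + n.+2)).
Proof.
rewrite /hess chain_d0 chain_d1 !mderivD !mderivZ !(mderiv_exp, mderivM) !mderivXU !eqxx.
rewrite v01 v10 !succnK -!mul_mpolyC !mpolyC_nat !natrM exprD.
rewrite !(exprS X1 n.+1) !(exprS X1 n) !(exprS X0 m) !expr0 ?expr1.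
rewrite /nat_of_bool ?mulr1n ?mulr0n ?mulr0 ?mul0r ?add0r ?addr0 ?mulr1 ?mul1r. by ring.
Qed.

(** Both monomials of the Hessian are multiples of the socle, and [chain_form] adds their
    contributions: (m+2)(n+2) times (m+1)(n+1) + (n+2). The second factor is (m+2)(n+1) + 1, the
    Milnor number. *)
Lemma residueP_chain m n w :
  w v0 = 2 / m.+2%:R -> w v1 = (2 - 2 / m.+2%:R) / n.+2%:R ->
  is_residue w (chain m.+2 n.+2) (residue w (chain m.+2 n.+2)).
Proof.
move=> w0 w1; apply: epsilon_spec.
exists (fun g => (m.+2%:R * n.+2%:R)^-1 * chain_form m n m.+1 n g); split.
- by move=> a b g h; rewrite linear_form_chain; ring.
- by move=> g /chain_form_jac ->; rewrite ?mulr0.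
- move=> g r hg ne_r; rewrite /chain_form.
  have coef0 i j : i%:R * w v0 + j%:R * w v1 = \sum_(i < 2) (2 - 2 * w i) ->
    g@_(mnm2 i j) = 0.
    move=> def_r; apply: contra_not_eq ne_r; rewrite -mcoeff_msupp => /hg <-.
    by rewrite mono_wdeg_mnm2.
  have -> : g@_(mnm2 m.+1 n) = 0.
    apply: coef0; rewrite big_ord2 /= w0 w1 [n%:R]natr_sub2 -[m.+1%:R](addrK 1) natr1.
    by move: m.+2%:R n.+2%:R (nz m) (nz n) => a b nza nzb; field; rewrite nza nzb.
  have -> : g@_(mnm2 0 (n + n.+2)) = 0.
    apply: coef0; rewrite big_ord2 /= w0 w1 natrD [n%:R]natr_sub2.
    by move: m.+2%:R n.+2%:R (nz m) (nz n) => a b nza nzb; field; rewrite nza nzb.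
  by rewrite mulr0 subrr mulr0.
exists (m.+2 * n.+1).+1%N; first exact: chain_milnor.
rewrite chain_hess /chain_form eqxx !mcoeffB !mcoeffZ !mcoeff_mnm2 !eqxx /=.
rewrite -[(m.+2 * n.+1).+1%:R]natr1 !natrM.
have pred k : k.+1%:R = k.+2%:R - 1 :> K by rewrite -[k.+2%:R]natr1 addrK.
rewrite [m.+1%:R]pred [n.+1%:R]pred; move: (natr1_neq0 m.+1) (natr1_neq0 n.+1).
by move: m.+2%:R n.+2%:R => a b nza nzb; field; rewrite nza nzb.
Qed.

End ResidueExistence.

(** * Constant terms and degrees of quantum dimensions *)

Section QuantumDimension.
Variable K : numFieldType.
Local Notation R4 := {mpoly K[2 + 2]}.
Local Notation R2 := {mpoly K[2]}.
Implicit Types (S : R4) (V W : R2) (w : 'I_2 -> rat).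

(* [at_x0] sets x = 0 and [at_y0] sets y = 0. *)
Definition at_x0 : R4 -> R2 :=
  comp_mpoly (mktuple (fun i => match split i with inl _ => 0 | inr j => 'X_j end)).
Definition at_y0 : R4 -> R2 :=
  comp_mpoly (mktuple (fun i => match split i with inl j => 'X_j | inr _ => 0 end)).

HB.instance Definition _ := GRing.RMorphism.on at_x0.
HB.instance Definition _ := GRing.RMorphism.on at_y0.

Lemma split_xv j : split (xv j) = inl j.
Proof. exact: (unsplitK (inl j)). Qed.

Lemma split_yv j : split (yv j) = inr j.
Proof. exact: (unsplitK (inr j)). Qed.

Lemma at_x0_xv j : at_x0 'X_(xv j) = 0.
Proof. by rewrite /at_x0 comp_mktupleX split_xv. Qed.

Lemma at_x0_yv j : at_x0 'X_(yv j) = 'X_j.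
Proof. by rewrite /at_x0 comp_mktupleX split_yv. Qed.

Lemma at_y0_xv j : at_y0 'X_(xv j) = 'X_j.
Proof. by rewrite /at_y0 comp_mktupleX split_xv. Qed.

Lemma at_y0_yv j : at_y0 'X_(yv j) = 0.
Proof. by rewrite /at_y0 comp_mktupleX split_yv. Qed.

Lemma at_x0C c : at_x0 c%:MP = c%:MP.
Proof. exact: comp_mpolyC. Qed.

Lemma at_y0C c : at_y0 c%:MP = c%:MP.
Proof. exact: comp_mpolyC. Qed.

Lemma mcoeff0_mon (e : 'I_2 -> nat) :
  (\prod_(i < 2) 'X_i ^+ e i : R2)@_0 = \prod_(i < 2) 0 ^+ e i.
Proof.
rewrite rmorph_prod; apply: eq_bigr => i _; rewrite rmorphXn /=; congr (_ ^+ _).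
by rewrite mcoeffX; case: eqP => // /(congr1 (fun m : 'X_{1..2} => m i)); rewrite mnm1E eqxx mnm0E.
Qed.

Lemma at_x0X m : at_x0 'X_[m] = (xmon K m)@_0 *: ymon K m.
Proof.
rewrite /at_x0 comp_mpolyX big_split_ord /xmon mcoeff0_mon -mul_mpolyC; congr (_ * _).
  rewrite !big_ord2 /= !tnth_mktuple !split_xv mpolyCM.
  by congr (_ * _); case: (m _) => [|e]; rewrite ?expr0 ?exprS ?mul0r ?mpolyC0.
by apply: eq_bigr => i _; rewrite tnth_mktuple split_yv.
Qed.

Lemma at_y0X m : at_y0 'X_[m] = (ymon K m)@_0 *: xmon K m.
Proof.
rewrite /at_y0 comp_mpolyX big_split_ord /ymon mcoeff0_mon -mul_mpolyC [RHS]mulrC.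
congr (_ * _).
  by apply: eq_bigr => i _; rewrite tnth_mktuple split_xv.
rewrite !big_ord2 /= !tnth_mktuple !split_yv mpolyCM.
by congr (_ * _); case: (m _) => [|e]; rewrite ?expr0 ?exprS ?mul0r ?mpolyC0.
Qed.

(** Only the monomials of [S] free of x reach the constant term, and these are exactly what [at_x0]
    keeps. *)
Lemma res_y_coef0 w W S : linear_form (residue w W) ->
  (res_y w W S)@_0 = residue w W (at_x0 S).
Proof.
move=> lin; rewrite /res_y raddf_sum /=.
rewrite {3}[S]mpolyE rmorph_sum /= (linear_form_sum lin); apply: eq_bigr => m _.
rewrite [at_x0 _]comp_mpolyZ -/(at_x0 _) at_x0X mcoeffZ !(linear_formZ lin).
by rewrite -mulrA [_ * _@_0]mulrC.
Qed.

Lemma res_x_coef0 w V S : linear_form (residue w V) ->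
  (res_x w V S)@_0 = residue w V (at_y0 S).
Proof.
move=> lin; rewrite /res_x raddf_sum /=.
rewrite {3}[S]mpolyE rmorph_sum /= (linear_form_sum lin); apply: eq_bigr => m _.
rewrite [at_y0 _]comp_mpolyZ -/(at_y0 _) at_y0X mcoeffZ !(linear_formZ lin).
by rewrite -mulrA [_ * _@_0]mulrC.
Qed.

Lemma orbifold_equivalent_of wV V wW W (X : mf_data K) :
  linear_form (residue wV V) -> linear_form (residue wW W) ->
  is_graded_mf wV wW V W X ->
  residue wW W (at_x0 (str (qd_product X))) != 0 ->
  residue wV V (at_y0 (str (qd_product X))) != 0 ->
  orbifold_equivalent wV V wW W.
Proof.
move=> linV linW grX nzl nzr; exists X; split=> //; split.
  apply: contraNneq nzl; rewrite /qdim_l => /eqP.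
  rewrite scaler_eq0 expf_eq0 oppr_eq0 oner_eq0 andbF /= => /eqP S0.
  by rewrite -res_y_coef0 // S0 mcoeff0.
apply: contraNneq nzr; rewrite /qdim_r => /eqP.
rewrite scaler_eq0 expf_eq0 oppr_eq0 oner_eq0 andbF /= => /eqP S0.
by rewrite -res_x_coef0 // S0 mcoeff0.
Qed.

Section Grading.
Variables (n : nat) (w : 'I_(2 + 2) -> rat) (q : 'I_n -> rat).

Definition graded (r : rat) (M : 'M[R4]_n) :=
  forall a b, whomog w (r + q b - q a) (M a b).

Lemma gradedM r s M N : graded r M -> graded s N -> graded (r + s) (M *m N).
Proof.
move=> hM hN a b; rewrite mxE; apply: whomog_sum => c _.
apply: (whomog_eq (whomogM (hM a c) (hN c b))). by ring.
Qed.

Lemma graded_mderiv r M i : graded r M -> graded (r - w i) (map_mx (mderiv i) M).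
Proof.
move=> hM a b; rewrite mxE; apply: (whomog_eq (whomog_mderiv (hM a b))); ring.
Qed.

End Grading.

Lemma wxy_xv wV wW j : wxy wV wW (xv j) = wV j.
Proof. by rewrite /wxy split_xv. Qed.

Lemma wxy_yv wV wW j : wxy wV wW (yv j) = wW j.
Proof. by rewrite /wxy split_yv. Qed.

(** Each of the four factors has degree 1 minus the weight of the variable of its derivative; the
    basis degrees [mf_q] cancel on the diagonal. *)
Lemma str_whomog wV wW V W X : is_graded_mf wV wW V W X ->
  whomog (wxy wV wW) (4 - (wV v0 + wV v1) - (wW v0 + wW v1)) (str (qd_product X)).
Proof.
move=> [_ grD]; have {}grD : graded (wxy wV wW) (@mf_q K X) 1 (mf_D X) by [].
have grP := gradedM (gradedM (gradedM (graded_mderiv (i := xv v0) grD)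
  (graded_mderiv (i := xv v1) grD)) (graded_mderiv (i := yv v0) grD)) (graded_mderiv (i := yv v1) grD).
rewrite !wxy_xv !wxy_yv in grP.
apply: whomogB (erefl _); apply: whomog_sum => i _;
  by apply: whomog_eq (grP _ _) _; ring.
Qed.

Lemma wdeg_mon w (e : 'I_2 -> nat) :
  whomog w (\sum_(i < 2) (e i)%:R * w i) (\prod_(i < 2) 'X_i ^+ e i : R2).
Proof.
rewrite !big_ord2 /=; apply: whomogM; apply: whomogE; exact: whomogX.
Qed.

Lemma wdeg_split wV wW m : mono_wdeg (wxy wV wW) m
  = \sum_(i < 2) (m (xv i))%:R * wV i + \sum_(i < 2) (m (yv i))%:R * wW i.
Proof.
rewrite /mono_wdeg big_split_ord; congr (_ + _); apply: eq_bigr => i _.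
  by rewrite wxy_xv.
by rewrite wxy_yv.
Qed.

(** A monomial not killed by the residue has y-degree 4 minus twice the sum of the [wW]. What is
    left for its x-part is the sum of the [wW] minus the sum of the [wV], and this is non-negative
    because the x-weights are. *)
Lemma qdim_l_neq0 (wV wW : 'I_2 -> rat) V W X : (forall i, 0 <= wV i) ->
  is_residue wW W (residue wW W) -> is_graded_mf wV wW V W X ->
  qdim_l wW W X != 0 -> wV v0 + wV v1 <= wW v0 + wW v1.
Proof.
move=> wV_ge0 [_ _ deg _] grX; rewrite /qdim_l scaler_eq0 negb_or => /andP[_].
apply: contraNT; rewrite -ltNge => lt_w; rewrite /res_y big_seq big1 // => m hm.
rewrite (deg _ _ (@wdeg_mon _ _)) ?mulr0 ?scale0r // => eq_deg.
have := str_whomog grX hm; rewrite wdeg_split eq_deg !big_ord2 /=.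
move/eqP; apply/negP; rewrite gt_eqF //.
have := wV_ge0 v0; have := wV_ge0 v1.
move: (ler0n rat (m (xv v0))) (ler0n rat (m (xv v1))) lt_w.
by move=> h1 h2 h3 h4 h5; nra.
Qed.

Lemma qdim_r_neq0 (wV wW : 'I_2 -> rat) V W X : (forall i, 0 <= wW i) ->
  is_residue wV V (residue wV V) -> is_graded_mf wV wW V W X ->
  qdim_r wV V X != 0 -> wW v0 + wW v1 <= wV v0 + wV v1.
Proof.
move=> wW_ge0 [_ _ deg _] grX; rewrite /qdim_r scaler_eq0 negb_or => /andP[_].
apply: contraNT; rewrite -ltNge => lt_w; rewrite /res_x big_seq big1 // => m hm.
rewrite (deg _ _ (@wdeg_mon _ _)) ?mulr0 ?scale0r // => eq_deg.
have := str_whomog grX hm; rewrite wdeg_split eq_deg !big_ord2 /=.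
move/eqP; apply/negP; rewrite gt_eqF //.
have := wW_ge0 v0; have := wW_ge0 v1.
move: (ler0n rat (m (yv v0))) (ler0n rat (m (yv v1))) lt_w.
by move=> h1 h2 h3 h4 h5; nra.
Qed.

End QuantumDimension.

(** * Orbifold equivalent potentials have the same class key *)

Section Forward.
Variable K : numFieldType.

Lemma residueP_ADE a : ADE_valid a ->
  is_residue (wts a) (pot K a) (residue (wts a) (pot K a)).
Proof.
case: a => [[|[|d]]|[|[|[|d]]]| | |] // _.
- by apply: (@residueP_fermat K d 0 (wts (A d.+2))); rewrite /wts //= divff.
- apply: (@residueP_chain K d.+1 0 (wts (D d.+3))) => //; rewrite /wts /=.
  by rewrite mulrBl [2 / _ / 2]mulrAC divff.
- exact: (@residueP_fermat K 1 2 (wts E6)).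
- exact: (@residueP_chain K 1 1 (wts E7)).
- exact: (@residueP_fermat K 1 3 (wts E8)).
Qed.

Lemma wts_ge0 a i : ADE_valid a -> 0 <= wts a i.
Proof.
case: a => [d|d| | |] hd; rewrite /wts; case: (i == v0);
  rewrite ?subr_ge0 ?divr_ge0 ?ler0n ?ler01 //.
by rewrite ler_pdivrMr ?mul1r ?ler1n ?ltr0n; case: d hd.
Qed.

Lemma wts_sum a : ADE_valid a -> wts a v0 + wts a v1 = 1 + 2 / (class_key a)%:R.
Proof.
have v10 : (v1 == v0) = false by [].
case: a => [d|d| | |] hd; rewrite /wts /class_key !eqxx v10.
- by rewrite addrC.
- rewrite natrM; have: d%:R != 0 :> rat by rewrite pnatr_eq0; case: d hd.
  by move: d%:R => x nzx; field.
- by field.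
- by field.
- by field.
Qed.

Lemma class_key_gt0 a : ADE_valid a -> (0 < class_key a)%N.
Proof. by case: a => [d|d| | |] //=; lia. Qed.

Lemma orbifold_equivalent_class_key a b : ADE_valid a -> ADE_valid b ->
  orbifold_equivalent (wts a) (pot K a) (wts b) (pot K b) ->
  class_key a = class_key b.
Proof.
move=> va vb [X [grX [nzl nzr]]].
have := qdim_l_neq0 (fun i => wts_ge0 i va) (residueP_ADE vb) grX nzl.
have := qdim_r_neq0 (fun i => wts_ge0 i vb) (residueP_ADE va) grX nzr.
rewrite !wts_sum // => le_ba le_ab; have := le_anti (introT andP (conj le_ba le_ab)).
have := class_key_gt0 va; have := class_key_gt0 vb.
move: (class_key a) (class_key b) => k l l_gt0 k_gt0 /addrI eq_kl.
have {}eq_kl : 2^-1 * (2 / l%:R) = 2^-1 * (2 / k%:R) :> rat by rewrite eq_kl.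
move: eq_kl; rewrite !mulKf // => /invr_inj /eqP.
by rewrite eqr_nat => /eqP.
Qed.

End Forward.

(** * Symmetry of the relation *)

Section Symmetry.
Variable K : numClosedFieldType.
Local Notation R4 := {mpoly K[2 + 2]}.
Local Notation R2 := {mpoly K[2]}.
Implicit Types (V W : R2).

(** The factors are grouped into an x-pair and a y-pair: exchanging the two sets of variables then
    exchanges the pairs, which the trace does not see. *)
Lemma str_qd_product (X : mf_data K) :
  str (qd_product X)
  = \tr (map_mx (mderiv (xv v0)) (mf_d1 X) *m map_mx (mderiv (xv v1)) (mf_d0 X)
          *m (map_mx (mderiv (yv v0)) (mf_d1 X) *m map_mx (mderiv (yv v1)) (mf_d0 X)))
    - \tr (map_mx (mderiv (xv v0)) (mf_d0 X) *m map_mx (mderiv (xv v1)) (mf_d1 X)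
          *m (map_mx (mderiv (yv v0)) (mf_d0 X) *m map_mx (mderiv (yv v1)) (mf_d1 X))).
Proof.
rewrite /qd_product /mf_D !map_block_mx !map_mx0 -mulmxA.
have blockM n0 n1 (A : 'M[R4]_(n0, n1)) B C E :
    block_mx 0 A B 0 *m block_mx 0 C E 0 = block_mx (A *m E) 0 0 (B *m C).
  by rewrite mulmx_block !mul0mx !mulmx0 !addr0 !add0r.
rewrite !blockM mulmx_block !mul0mx !mulmx0 !addr0 !add0r /str.
by congr (_ - _); apply: eq_bigr => i _; rewrite (block_mxEul, block_mxEdr).
Qed.

(* Orbifold equivalence witnessed by the constant terms of the quantum
   dimensions. *)
Definition strongly_equivalent wV V wW W := exists X : mf_data K,
  [/\ is_graded_mf wV wW V W X,
      residue wW W (at_x0 (str (qd_product X))) != 0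
    & residue wV V (at_y0 (str (qd_product X))) != 0].

Definition swap_xy : R4 -> R4 := comp_mpoly (mktuple (fun i =>
  match split i with inl j => 'X_(yv j) | inr j => 'X_(xv j) end)).

HB.instance Definition _ := GRing.RMorphism.on swap_xy.

Lemma eq_xv j k : (xv j == xv k) = (j == k).
Proof. exact: eq_lshift. Qed.

Lemma eq_yv j k : (yv j == yv k) = (j == k).
Proof. exact: eq_rshift. Qed.

Lemma eq_xv_yv j k : (xv j == yv k) = false.
Proof. exact: eq_lrshift. Qed.

Lemma eq_yv_xv j k : (yv j == xv k) = false.
Proof. exact: eq_rlshift. Qed.

Lemma mderiv_swap_xv j p : (swap_xy p)^`M(xv j) = swap_xy p^`M(yv j).
Proof.
rewrite /swap_xy mderiv_comp (bigD1 (yv j)) //= split_yv mderivXU eqxx mulr1.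
rewrite big1 ?addr0 // => i; case: (split_ordP i) => k -> ne_kj; last first.
  by rewrite mderivXU eq_xv -eq_yv (negPf ne_kj) mulr0.
by rewrite mderivXU eq_yv_xv mulr0.
Qed.

Lemma mderiv_swap_yv j p : (swap_xy p)^`M(yv j) = swap_xy p^`M(xv j).
Proof.
rewrite /swap_xy mderiv_comp (bigD1 (xv j)) //= split_xv mderivXU eqxx mulr1.
rewrite big1 ?addr0 // => i; case: (split_ordP i) => k -> ne_kj.
  by rewrite mderivXU eq_yv -eq_xv (negPf ne_kj) mulr0.
by rewrite mderivXU eq_xv_yv mulr0.
Qed.

Lemma swap_in_x V : swap_xy (in_x V) = in_y V.
Proof.
rewrite /swap_xy /in_x /in_y comp_comp_mpoly; congr (_ \mPo _).
by apply: eq_from_tnth => i; rewrite !tnth_mktuple comp_mktupleX split_xv.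
Qed.

Lemma swap_in_y V : swap_xy (in_y V) = in_x V.
Proof.
rewrite /swap_xy /in_x /in_y comp_comp_mpoly; congr (_ \mPo _).
by apply: eq_from_tnth => i; rewrite !tnth_mktuple comp_mktupleX split_yv.
Qed.

Lemma at_x0_swap p : at_x0 (swap_xy p) = at_y0 p.
Proof.
rewrite /swap_xy /at_x0 /at_y0 comp_comp_mpoly; congr (_ \mPo _).
apply: eq_from_tnth => i; rewrite !tnth_mktuple.
by case: (split i) => j; rewrite comp_mktupleX ?split_xv ?split_yv.
Qed.

Lemma at_y0_swap p : at_y0 (swap_xy p) = at_x0 p.
Proof.
rewrite /swap_xy /at_x0 /at_y0 comp_comp_mpoly; congr (_ \mPo _).
apply: eq_from_tnth => i; rewrite !tnth_mktuple.
by case: (split i) => j; rewrite comp_mktupleX ?split_xv ?split_yv.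
Qed.

Lemma whomog_swap wV wW r p :
  whomog (wxy wV wW) r p -> whomog (wxy wW wV) r (swap_xy p).
Proof.
apply: whomog_comp => i; rewrite /wxy.
case: (split i) => j.
  by have := @whomogX K _ (wxy wW wV) (yv j); rewrite wxy_yv.
by have := @whomogX K _ (wxy wW wV) (xv j); rewrite wxy_xv.
Qed.

Lemma trace_swap_mulC m n (A : 'M[R4]_(m, n)) (B : 'M[R4]_(n, m)) :
  \tr (map_mx swap_xy (A *m B)) = swap_xy (\tr (B *m A)).
Proof. by rewrite trace_map_mx mxtrace_mulC. Qed.

Lemma graded_twist wV wW n (q : 'I_n -> rat) (M : 'M[R4]_n) :
  graded (wxy wV wW) q 1 M ->
  graded (wxy wW wV) q 1 (('i%:MP : R4) *: map_mx swap_xy M).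
Proof.
move=> grM a b; rewrite mxE mxE.
apply: whomog_eq (add0r _); apply: whomogM; first exact: whomogC.
exact: whomog_swap.
Qed.

(* Multiplying the swapped differential by i turns W(x) - V(y) into
   V(y) - W(x). *)
Lemma strongly_equivalent_sym wV V wW W :
  strongly_equivalent wV V wW W -> strongly_equivalent wW W wV V.
Proof.
move=> [X [[sqD grD] nzl nzr]].
pose tw m n (M : 'M[R4]_(m, n)) := ('i%:MP : R4) *: map_mx swap_xy M.
pose X' := MFData (@mf_q K X) (tw _ _ (mf_d0 X)) (tw _ _ (mf_d1 X)).
have twM m n p (M : 'M[R4]_(m, n)) (N : 'M_(n, p)) :
    tw _ _ M *m tw _ _ N = - map_mx swap_xy (M *m N).
  rewrite /tw -scalemxAl -scalemxAr scalerA -mpolyCM -expr2 sqrCi map_mxM.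
  by rewrite mpolyCN scaleN1r.
have D' : mf_D X' = tw _ _ (mf_D X).
  by rewrite /mf_D /tw map_block_mx scale_block_mx !map_mx0 !scaler0.
have dx m n (M : 'M[R4]_(m, n)) j :
    map_mx (mderiv (xv j)) (tw _ _ M) = tw _ _ (map_mx (mderiv (yv j)) M).
  by apply/matrixP => a b; rewrite !mxE mderiv_mulC mderiv_swap_xv.
have dy m n (M : 'M[R4]_(m, n)) j :
    map_mx (mderiv (yv j)) (tw _ _ M) = tw _ _ (map_mx (mderiv (xv j)) M).
  by apply/matrixP => a b; rewrite !mxE mderiv_mulC mderiv_swap_yv.
(* Each pair of derivatives contributes the sign ['i^2 = -1], and the two signs cancel. The swap
   puts the y-pair in front of the x-pair; cyclicity of the trace restores the order. *)
have str' : str (qd_product X') = swap_xy (str (qd_product X)).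
  have e0 : mf_d0 X' = tw _ _ (mf_d0 X) by [].
  have e1 : mf_d1 X' = tw _ _ (mf_d1 X) by [].
  rewrite [LHS]str_qd_product [in RHS]str_qd_product e0 e1.
  rewrite (dx _ _ (mf_d0 X) v0) (dx _ _ (mf_d1 X) v0).
  rewrite (dx _ _ (mf_d0 X) v1) (dx _ _ (mf_d1 X) v1).
  rewrite (dy _ _ (mf_d0 X) v0) (dy _ _ (mf_d1 X) v0).
  rewrite (dy _ _ (mf_d0 X) v1) (dy _ _ (mf_d1 X) v1).
  move: (@twM) => {}twM; move: (@tw) twM => tw' twM'.
  rewrite !twM' !mulNmx !mulmxN !opprK -!map_mxM.
  rewrite !trace_swap_mulC; exact: (esym (rmorphB swap_xy _ _)).
exists X'; split; last 2 first.
- by rewrite str' at_x0_swap.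
- by rewrite str' at_y0_swap.
split; last first.
  rewrite D'; exact: (graded_twist grD).
rewrite D' twM sqD map_scalar_mx rmorphB /= swap_in_x swap_in_y.
by move: (in_x _) (in_y _) => p r; rewrite -scaleN1r scale_scalar_mx mulN1r opprB.
Qed.

Lemma strong_orbifold_equivalent wV V wW W :
  is_residue wV V (residue wV V) -> is_residue wW W (residue wW W) ->
  strongly_equivalent wV V wW W -> orbifold_equivalent wV V wW W.
Proof.
move=> [linV _ _ _] [linW _ _ _] [X [grX nzl nzr]].
exact (orbifold_equivalent_of linV linW grX nzl nzr).
Qed.

End Symmetry.

(** * The residue does not vanish on the socle *)

Section ResidueNonvanishing.
Variable K : numFieldType.
Local Notation X0 := ('X_v0 : {mpoly K[2]}).
Local Notation X1 := ('X_v1 : {mpoly K[2]}).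

Lemma milnor0_jac (W g : {mpoly K[2]}) : milnor_number W 0 -> in_jac W g.
Proof. by move=> [b [_ /(_ g) [c]]]; rewrite big_ord0 subr0. Qed.

(** If the socle monomial had residue 0, so would the Hessian, and the Milnor number supplied by
    [is_residue] would be 0. Then every polynomial would lie in the Jacobian ideal, which is false
    for the socle monomial. *)
Lemma residue_fermat_neq0 w m n f : is_residue w (fermat K m.+2 n.+2) f ->
  f (X0 ^+ m * X1 ^+ n) != 0.
Proof.
move=> [lin _ _ [[|mu] hmu eq_hess]].
  have /(@fermat_mcoeff _ _ _ m n _ (leqnn _) (leqnn _)) := milnor0_jac (X0 ^+ m * X1 ^+ n) hmu.
  by rewrite mcoeff_mnm2 !eqxx => /eqP; rewrite oner_eq0.
apply: contra_eq_neq eq_hess => f0.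
by rewrite fermat_hess (linear_formZ lin) f0 mulr0 eq_sym pnatr_eq0.
Qed.

Lemma residue_chain_neq0 w m n f : is_residue w (chain K m.+2 n.+2) f ->
  f (X0 ^+ m.+1 * X1 ^+ n) != 0.
Proof.
move=> [lin jac _ [[|mu] hmu eq_hess]].
  have /(@chain_form_jac _ _ _ m.+1 n _ (leqnn _) (leqnn _)) :=
    milnor0_jac (X0 ^+ m.+1 * X1 ^+ n) hmu.
  by rewrite /chain_form !mcoeff_mnm2 !eqxx mulr0 subr0 => /eqP; rewrite oner_eq0.
apply: contra_eq_neq eq_hess => f0.
have := jac _ (chain_jac0 K m n n); rewrite (linear_formD lin) (linear_formZ lin) f0.
rewrite mulr0 addr0 chain_hess (linear_formB lin) !(linear_formZ lin) f0 => ->.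
by rewrite !mulr0 subrr eq_sym pnatr_eq0.
Qed.

(** Modulo the Jacobian ideal [X1^(2n+2)] equals [-(m+2) X0^(m+1) X1^n], so it spans the socle as
    well. *)
Lemma residue_chain_neq0' w m n f : is_residue w (chain K m.+2 n.+2) f ->
  f (X0 ^+ 0 * X1 ^+ (n + n.+2)) != 0.
Proof.
move=> res; have := residue_chain_neq0 res; apply: contraNneq => f0.
have [lin jac _ _] := res; have := jac _ (chain_jac0 K m n n).
rewrite (linear_formD lin) f0 add0r (linear_formZ lin) => /eqP.
by rewrite mulf_eq0 pnatr_eq0.
Qed.

End ResidueNonvanishing.

(** * Two by two matrices and Koszul factorisations *)

Section Matrices2.
Variable R : comNzRingType.

Definition mx2 (a b c d : R) : 'M[R]_2 :=
  \matrix_(i, j) (nth [::] [:: [:: a; b]; [:: c; d]] i)`_j.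

Lemma matrix2P (A B : 'M[R]_2) : A v0 v0 = B v0 v0 -> A v0 v1 = B v0 v1 ->
  A v1 v0 = B v1 v0 -> A v1 v1 = B v1 v1 -> A = B.
Proof. by move=> *; apply/matrixP; apply: ord2P; apply: ord2P. Qed.

Lemma mul_mx2 a b c d a' b' c' d' : mx2 a b c d *m mx2 a' b' c' d'
  = mx2 (a * a' + b * c') (a * b' + b * d') (c * a' + d * c') (c * b' + d * d').
Proof. by apply: matrix2P; rewrite !mxE big_ord2 !mxE. Qed.

Lemma add_mx2 a b c d a' b' c' d' : mx2 a b c d + mx2 a' b' c' d'
  = mx2 (a + a') (b + b') (c + c') (d + d').
Proof. by apply: matrix2P; rewrite !mxE. Qed.

Lemma scale_mx2 k a b c d : k *: mx2 a b c d = mx2 (k * a) (k * b) (k * c) (k * d).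
Proof. by apply: matrix2P; rewrite !mxE. Qed.

Lemma scalar_mx2 a : a%:M = mx2 a 0 0 a.
Proof. by apply: matrix2P; rewrite !mxE. Qed.

Lemma trace_mx2 a b c d : \tr (mx2 a b c d) = a + d.
Proof. by rewrite /mxtrace big_ord2 !mxE. Qed.

(* The 4 x 4 determinant of four rows, expanded along the first two. *)
Definition det4 (p1 p2 q1 q2 : R * R * R * R) : R :=
  let: (a1, a2, a3, a4) := p1 in let: (b1, b2, b3, b4) := p2 in
  let: (c1, c2, c3, c4) := q1 in let: (e1, e2, e3, e4) := q2 in
  (a1 * b2 - a2 * b1) * (c3 * e4 - c4 * e3) - (a1 * b3 - a3 * b1) * (c2 * e4 - c4 * e2)
  + (a1 * b4 - a4 * b1) * (c2 * e3 - c3 * e2) + (a2 * b3 - a3 * b2) * (c1 * e4 - c4 * e1)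
  - (a2 * b4 - a4 * b2) * (c1 * e3 - c3 * e1) + (a3 * b4 - a4 * b3) * (c1 * e2 - c2 * e1).

End Matrices2.

Lemma map_mx2 (R S : comNzRingType) (f : R -> S) a b c d :
  map_mx f (mx2 a b c d) = mx2 (f a) (f b) (f c) (f d).
Proof. by apply: matrix2P; rewrite !mxE. Qed.

Lemma rmorph_det4 (R S : comNzRingType) (f : {rmorphism R -> S})
    a1 a2 a3 a4 b1 b2 b3 b4 c1 c2 c3 c4 e1 e2 e3 e4 :
  f (det4 (a1, a2, a3, a4) (b1, b2, b3, b4) (c1, c2, c3, c4) (e1, e2, e3, e4))
  = det4 (f a1, f a2, f a3, f a4) (f b1, f b2, f b3, f b4) (f c1, f c2, f c3, f c4)
      (f e1, f e2, f e3, f e4).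
Proof. by rewrite /det4 !(rmorphD, rmorphB, rmorphM, rmorphN). Qed.

Section Koszul.
Variable K : numClosedFieldType.
Local Notation R4 := {mpoly K[2 + 2]}.
Local Notation R2 := {mpoly K[2]}.
Variables (wV wW : 'I_2 -> rat) (V W : R2).
Variables (p1 p2 q1 q2 : R4) (r1 r2 : rat).

(** The basis is 1, theta1 theta2 (even) and theta1, theta2 (odd) of an exterior algebra. With 1 in
    degree 0 the other degrees are forced, since every entry of the differential must have degree
    1. *)
Definition koszul_q (a : 'I_(2 + 2)) : rat :=
  match split a with
  | inl i => if i == v0 then 0 else r1 + r2 - 2
  | inr j => if j == v0 then r1 - 1 else r2 - 1
  end.

Definition drow (S : Type) (ev : R4 -> S) (p : R4) :=
  (ev p^`M(xv v0), ev p^`M(xv v1), ev p^`M(yv v0), ev p^`M(yv v1)).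

Definition koszul_mf : mf_data K :=
  @MFData K 2 2 koszul_q (mx2 q1 (- p2) q2 p1) (mx2 p1 p2 (- q2) q1).

(** Up to sign the supertrace is the Jacobian determinant of (p1, p2, q1, q2) in the four variables,
    so the quantum dimensions of a Koszul factorisation are residues of a Jacobian. *)
Lemma koszul_str : str (qd_product koszul_mf)
  = - det4 (drow id p1) (drow id p2) (drow id q1) (drow id q2).
Proof.
rewrite str_qd_product /koszul_mf /mf_d0 /mf_d1 !map_mx2 !mul_mx2 !trace_mx2 /det4 /= !mderivN.
by ring.
Qed.

Hypothesis eq_pq : p1 * q1 + p2 * q2 = in_y W - in_x V.
Hypothesis hom_p1 : whomog (wxy wV wW) r1 p1.
Hypothesis hom_p2 : whomog (wxy wV wW) r2 p2.
Hypothesis hom_q1 : whomog (wxy wV wW) (2 - r1) q1.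
Hypothesis hom_q2 : whomog (wxy wV wW) (2 - r2) q2.

Lemma koszul_graded : is_graded_mf wV wW V W koszul_mf.
Proof.
split.
  rewrite /mf_D /= mulmx_block !mul0mx !mulmx0 !addr0 !add0r !mul_mx2.
  rewrite -eq_pq [RHS]scalar_mx_block !scalar_mx2; congr block_mx;
  by congr mx2; ring.
move=> a b; rewrite /mf_D /mf_d0 /mf_d1 /mf_q /koszul_mf /koszul_q.
case: (split_ordP a) => i ->; case: (split_ordP b) => j ->.
- by rewrite block_mxEul mxE; apply: whomog0.
- rewrite block_mxEur; move: i j; apply: ord2P; apply: ord2P; rewrite mxE /=.
  + by apply: (whomog_eq hom_p1); ring.
  + by apply: (whomog_eq hom_p2); ring.
  + by apply: (whomog_eq (whomogN hom_q2)); ring.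
  + by apply: (whomog_eq hom_q1); ring.
- rewrite block_mxEdl; move: i j; apply: ord2P; apply: ord2P; rewrite mxE /=.
  + by apply: (whomog_eq hom_q1); ring.
  + by apply: (whomog_eq (whomogN hom_p2)); ring.
  + by apply: (whomog_eq hom_q2); ring.
  + by apply: (whomog_eq hom_p1); ring.
by rewrite block_mxEdr mxE; apply: whomog0.
Qed.

Lemma koszul_equivalent P1 P2 Q1 Q2 P1' P2' Q1' Q2' :
  linear_form (residue wV V) -> linear_form (residue wW W) ->
  drow (@at_x0 K) p1 = P1 -> drow (@at_x0 K) p2 = P2 ->
  drow (@at_x0 K) q1 = Q1 -> drow (@at_x0 K) q2 = Q2 ->
  drow (@at_y0 K) p1 = P1' -> drow (@at_y0 K) p2 = P2' ->
  drow (@at_y0 K) q1 = Q1' -> drow (@at_y0 K) q2 = Q2' ->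
  residue wW W (det4 P1 P2 Q1 Q2) != 0 -> residue wV V (det4 P1' P2' Q1' Q2') != 0 ->
  strongly_equivalent wV V wW W.
Proof.
move=> linV linW <- <- <- <- <- <- <- <- nzl nzr.
exists koszul_mf; split; first exact: koszul_graded.
- rewrite koszul_str; apply: contraNneq nzl => /eqP.
  rewrite rmorphN -scaleN1r (linear_formZ linW) mulf_eq0 oppr_eq0 oner_eq0 /=.
  by rewrite (rmorph_det4 (@at_x0 K)).
rewrite koszul_str; apply: contraNneq nzr => /eqP.
rewrite rmorphN -scaleN1r (linear_formZ linV) mulf_eq0 oppr_eq0 oner_eq0 /=.
by rewrite (rmorph_det4 (@at_y0 K)).
Qed.

End Koszul.

(** * Difference quotients and their derivatives on the coordinate planes *)

Section DifferenceQuotient.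
Variable K : numClosedFieldType.
Local Notation R4 := {mpoly K[2 + 2]}.
Local Notation R2 := {mpoly K[2]}.

(* [(y ^ n - x ^ n) / (y - x)] *)
Definition hsum (R : comNzRingType) (n : nat) (x y : R) : R :=
  \sum_(i < n) y ^+ (n.-1 - i) * x ^+ i.

Lemma hsumE (R : comNzRingType) n (x y : R) : (y - x) * hsum n x y = y ^+ n - x ^+ n.
Proof. by rewrite subrXX. Qed.

Lemma whomog_hsum n w r (x y : R4) : whomog w r x -> whomog w r y ->
  whomog w (n%:R * r) (hsum n.+1 x y).
Proof.
move=> hx hy; apply: whomog_sum => i _.
apply: (whomog_eq (whomogM (whomogE (e := n - i) hy) (whomogE (e := i) hx))).
by rewrite -mulrDl -natrD subnK // -ltnS.
Qed.

Section Evaluation.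
Variables (R : comNzRingType) (S : idomainType) (ev : {rmorphism R -> S}) (x y : R).

Lemma hsum_x0 n : ev x = 0 -> ev y != 0 -> ev (hsum n.+1 x y) = ev y ^+ n.
Proof.
move=> x0 nzy; have /(congr1 ev) := hsumE n.+1 x y.
rewrite rmorphM !rmorphB !rmorphXn /= x0 subr0 expr0n /= subr0 exprS.
exact: mulfI.
Qed.

Lemma hsum_y0 n : ev y = 0 -> ev x != 0 -> ev (hsum n.+1 x y) = ev x ^+ n.
Proof.
move=> y0 nzx; have /(congr1 ev) := hsumE n.+1 x y.
rewrite rmorphM !rmorphB !rmorphXn /= y0 !sub0r expr0n /= sub0r exprS mulNr.
by move/oppr_inj; apply: mulfI.
Qed.

End Evaluation.

(** Differentiating [hsumE] gives the derivative up to the factor y - x. Once x or y is set to 0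
    this factor is cancelled in a domain, so the sum is never expanded. *)
Lemma mderiv_hsum n l (x y : R4) : (y - x) * (hsum n x y)^`M(l)
  = n%:R * y ^+ n.-1 * y^`M(l) - n%:R * x ^+ n.-1 * x^`M(l)
    - (y^`M(l) - x^`M(l)) * hsum n x y.
Proof.
have := congr1 (mderiv l) (hsumE n x y).
rewrite mderivM !mderivB !mderiv_exp => <-; ring.
Qed.

Section AtPoint.
Variables (ev : {rmorphism R4 -> R2}) (x y : R4).

Lemma mderiv_hsum_x0 n l : ev x = 0 -> ev y != 0 ->
  ev (hsum n.+2 x y)^`M(l) = ev y ^+ n * (n.+1%:R * ev y^`M(l) + ev x^`M(l)).
Proof.
move=> x0 nzy; have /(congr1 ev) := mderiv_hsum n.+2 l x y.
rewrite !(rmorphM, rmorphB, rmorphXn, rmorph_nat) /=.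
rewrite hsum_x0 // x0 subr0 expr0n /= => eqH; apply: (mulfI nzy); rewrite eqH.
by rewrite exprS -[n.+2%:R]natr1; ring.
Qed.

Lemma mderiv_hsum_y0 n l : ev y = 0 -> ev x != 0 ->
  ev (hsum n.+2 x y)^`M(l) = ev x ^+ n * (n.+1%:R * ev x^`M(l) + ev y^`M(l)).
Proof.
move=> y0 nzx; have /(congr1 ev) := mderiv_hsum n.+2 l x y.
rewrite !(rmorphM, rmorphB, rmorphXn, rmorph_nat) /=.
rewrite hsum_y0 // y0 sub0r expr0n /= mulNr => eqH.
apply: (mulfI nzx); apply: oppr_inj; rewrite eqH.
by rewrite exprS -[n.+2%:R]natr1; ring.
Qed.

End AtPoint.

Lemma mpolyX_neq0 n (i : 'I_n) : ('X_i : {mpoly K[n]}) != 0.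
Proof.
have := msizeX K U_(i)%MM; apply: contra_eq_neq => ->.
by rewrite msize0.
Qed.

End DifferenceQuotient.

Lemma trueR (R : pzSemiRingType) : true%:R = 1 :> R. Proof. by []. Qed.
Lemma falseR (R : pzSemiRingType) : false%:R = 0 :> R. Proof. by []. Qed.

(** * Koszul factorisations: a potential against itself, and A against D *)

Section DiagonalAndAD.
Variable K : numClosedFieldType.
Local Notation R4 := {mpoly K[2 + 2]}.
Local Notation R2 := {mpoly K[2]}.
Local Notation X0 := ('X_v0 : R2).
Local Notation X1 := ('X_v1 : R2).
Local Notation x0 := ('X_(xv v0) : R4).
Local Notation x1 := ('X_(xv v1) : R4).
Local Notation y0 := ('X_(yv v0) : R4).
Local Notation y1 := ('X_(yv v1) : R4).

Lemma dxx i j : ('X_(xv i) : R4)^`M(xv j) = (i == j)%:R.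
Proof. by rewrite mderivXU eq_xv. Qed.

Lemma dxy i j : ('X_(xv i) : R4)^`M(yv j) = 0.
Proof. by rewrite mderivXU eq_xv_yv. Qed.

Lemma dyx i j : ('X_(yv i) : R4)^`M(xv j) = 0.
Proof. by rewrite mderivXU eq_yv_xv. Qed.

Lemma dyy i j : ('X_(yv i) : R4)^`M(yv j) = (i == j)%:R.
Proof. by rewrite mderivXU eq_yv. Qed.

Lemma v01 : (v0 == v1) = false. Proof. by []. Qed.
Lemma v10 : (v1 == v0) = false. Proof. by []. Qed.

Definition dvarE := (dxx, dxy, dyx, dyy, eqxx, v01, v10).

Lemma whomog_xv wV wW i : whomog (wxy wV wW) (wV i) ('X_(xv i) : R4).
Proof. by have := @whomogX K _ (wxy wV wW) (xv i); rewrite wxy_xv. Qed.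

Lemma whomog_yv wV wW i : whomog (wxy wV wW) (wW i) ('X_(yv i) : R4).
Proof. by have := @whomogX K _ (wxy wV wW) (yv i); rewrite wxy_yv. Qed.

Lemma linear_form_scale_neq0 (f : R2 -> K) c p : linear_form f ->
  c != 0 -> f p != 0 -> f (c%:MP * p) != 0.
Proof. by move=> lin nzc nzp; rewrite mul_mpolyC (linear_formZ lin) mulf_neq0. Qed.

Lemma in_xfermat m n : in_x (fermat K m n) = x0 ^+ m + x1 ^+ n.
Proof. by rewrite /in_x /fermat rmorphD !rmorphXn /= !comp_mktupleX. Qed.

Lemma in_yfermat m n : in_y (fermat K m n) = y0 ^+ m + y1 ^+ n.
Proof. by rewrite /in_y /fermat rmorphD !rmorphXn /= !comp_mktupleX. Qed.

Lemma in_xchain m n : in_x (chain K m n) = x0 ^+ m + x0 * x1 ^+ n.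
Proof. by rewrite /in_x /chain rmorphD rmorphM !rmorphXn /= !comp_mktupleX. Qed.

Lemma in_ychain m n : in_y (chain K m n) = y0 ^+ m + y0 * y1 ^+ n.
Proof. by rewrite /in_y /chain rmorphD rmorphM !rmorphXn /= !comp_mktupleX. Qed.

Section Rows.
Variable j : 'I_2.
Let ex : 'I_2 -> R2 := fun i => (j == i)%:R.

Lemma drow_diff_x0 : drow (@at_x0 K) ('X_(yv j) - 'X_(xv j))
  = (- ex v0, - ex v1, ex v0, ex v1).
Proof. by rewrite /drow !mderivB !dvarE !rmorphB !rmorph0 !rmorph_nat !sub0r !subr0. Qed.

Lemma drow_diff_y0 : drow (@at_y0 K) ('X_(yv j) - 'X_(xv j))
  = (- ex v0, - ex v1, ex v0, ex v1).
Proof. by rewrite /drow !mderivB !dvarE !rmorphB !rmorph0 !rmorph_nat !sub0r !subr0. Qed.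

Lemma drow_hsum_x0 n : drow (@at_x0 K) (hsum n.+2 'X_(xv j) 'X_(yv j))
  = ('X_j ^+ n * ex v0, 'X_j ^+ n * ex v1, n.+1%:R * 'X_j ^+ n * ex v0,
     n.+1%:R * 'X_j ^+ n * ex v1).
Proof.
have nz : at_x0 ('X_(yv j) : R4) != 0 by rewrite at_x0_yv mpolyX_neq0.
rewrite /drow !(mderiv_hsum_x0 (ev := @at_x0 K) _ _ (at_x0_xv K j) nz) /= !dvarE at_x0_yv.
by rewrite !rmorph0 !rmorph_nat !mulr0 !add0r !addr0 ![_ * (n.+1%:R * _)]mulrCA !mulrA.
Qed.

Lemma drow_hsum_y0 n : drow (@at_y0 K) (hsum n.+2 'X_(xv j) 'X_(yv j))
  = (n.+1%:R * 'X_j ^+ n * ex v0, n.+1%:R * 'X_j ^+ n * ex v1, 'X_j ^+ n * ex v0,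
     'X_j ^+ n * ex v1).
Proof.
have nz : at_y0 ('X_(xv j) : R4) != 0 by rewrite at_y0_xv mpolyX_neq0.
rewrite /drow !(mderiv_hsum_y0 (ev := @at_y0 K) _ _ (at_y0_yv K j) nz) /= !dvarE at_y0_xv.
by rewrite !rmorph0 !rmorph_nat !mulr0 !add0r !addr0 ![_ * (n.+1%:R * _)]mulrCA !mulrA.
Qed.

End Rows.

(** Each variable contributes [y - x] times its difference quotient. The Jacobian is
    [(m+2)(n+2) X0^m X1^n] at x = 0 and at y = 0, a multiple of the socle monomial. *)
Lemma fermat_self m n (w : 'I_2 -> rat) :
  w v0 = 2 / m.+2%:R -> w v1 = 2 / n.+2%:R ->
  strongly_equivalent w (fermat K m.+2 n.+2) w (fermat K m.+2 n.+2).
Proof.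
move=> w0 w1; have res := residueP_fermat K w0 w1; have [lin _ _ _] := res.
have nzres := residue_fermat_neq0 res.
have degE k : k.+1%:R * (2 / k.+2%:R) = 2 - 2 / k.+2%:R :> rat.
  have nzk : k.+2%:R != 0 :> rat by rewrite pnatr_eq0.
  rewrite -[k.+1%:R](addrK 1) natr1; move: k.+2%:R nzk => a nza.
  by field.
have nzc : (m.+2 * n.+2)%:R != 0 :> K by rewrite pnatr_eq0.
apply: (koszul_equivalent (p1 := y0 - x0) (p2 := y1 - x1) (q1 := hsum m.+2 x0 y0)
  (q2 := hsum n.+2 x1 y1) (r1 := w v0) (r2 := w v1) _ _ _ _ _ lin lin
  (drow_diff_x0 _) (drow_diff_x0 _) (drow_hsum_x0 _ _) (drow_hsum_x0 _ _)
  (drow_diff_y0 _) (drow_diff_y0 _) (drow_hsum_y0 _ _) (drow_hsum_y0 _ _)).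
- rewrite (hsumE m.+2 x0 y0) (hsumE n.+2 x1 y1) (in_yfermat m.+2 n.+2).
  rewrite (in_xfermat m.+2 n.+2).
  by move: (y0 ^+ _) (y1 ^+ _) (x0 ^+ _) (x1 ^+ _) => a b c d; ring.
- by apply: whomogB (erefl _); [apply: whomog_yv|apply: whomog_xv].
- by apply: whomogB (erefl _); [apply: whomog_yv|apply: whomog_xv].
- rewrite (_ : 2 - w v0 = m.+1%:R * w v0); last by rewrite w0 degE.
  by apply: whomog_hsum; [exact: whomog_xv|exact: whomog_yv].
- rewrite (_ : 2 - w v1 = n.+1%:R * w v1); last by rewrite w1 degE.
  by apply: whomog_hsum; [exact: whomog_xv|exact: whomog_yv].
- have := linear_form_scale_neq0 lin nzc nzres; congr (residue _ _ _ != 0).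
  rewrite /det4 !eqxx v01 v10 !trueR !falseR mpolyC_nat natrM -[m.+2%:R]natr1 -[n.+2%:R]natr1.
  by move: (X0 ^+ m) (X1 ^+ n) => a b; ring.
have := linear_form_scale_neq0 lin nzc nzres; congr (residue _ _ _ != 0).
rewrite /det4 !eqxx v01 v10 !trueR !falseR mpolyC_nat natrM -[m.+2%:R]natr1 -[n.+2%:R]natr1.
by move: (X0 ^+ m) (X1 ^+ n) => a b; ring.
Qed.

End DiagonalAndAD.

Ltac ring_units := rewrite ?(trueR, falseR, mulr0, mul0r, mulr1, mul1r, addr0,
  add0r, subr0, sub0r, oppr0, expr1).

Section ChainAndAD.
Variable K : numClosedFieldType.
Local Notation R4 := {mpoly K[2 + 2]}.
Local Notation R2 := {mpoly K[2]}.
Local Notation X0 := ('X_v0 : R2).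
Local Notation X1 := ('X_v1 : R2).
Local Notation x0 := ('X_(xv v0) : R4).
Local Notation x1 := ('X_(xv v1) : R4).
Local Notation y0 := ('X_(yv v0) : R4).
Local Notation y1 := ('X_(yv v1) : R4).

(** W(y) - W(x) is telescoped: x0 is replaced by y0 while the second variable is y1, then x1 by y1
    while the first is x0. The order breaks the symmetry, so the two Jacobians are different socle
    elements: [-(n+2) X1^(2n+2)] at x = 0 and [(m+2)(n+2) X0^(m+1) X1^n] at y = 0. *)
Lemma chain_self m n (w : 'I_2 -> rat) :
  w v0 = 2 / m.+2%:R -> w v1 = (2 - 2 / m.+2%:R) / n.+2%:R ->
  strongly_equivalent w (chain K m.+2 n.+2) w (chain K m.+2 n.+2).
Proof.
move=> w0 w1; have res := residueP_chain K w0 w1; have [lin _ _ _] := res.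
have nzres := residue_chain_neq0 res; have nzres' := residue_chain_neq0' res.
have nzr k : k.+2%:R != 0 :> rat by rewrite pnatr_eq0.
have deg1 : n.+2%:R * w v1 = 2 - w v0.
  by rewrite w1 w0; move: n.+2%:R (nzr n) => a nza; rewrite mulrC divfK.
have deg0 : m.+1%:R * w v0 = 2 - w v0.
  rewrite w0 -[m.+1%:R](addrK 1) natr1; move: m.+2%:R (nzr m) => a nza.
  by field.
have nzc : (m.+2 * n.+2)%:R != 0 :> K by rewrite pnatr_eq0.
have nzc' : - n.+2%:R != 0 :> K by rewrite oppr_eq0 pnatr_eq0.
have [a1 a2 a3 a4] := drow_hsum_x0 K v0 m.
have [b1 b2 b3 b4] := drow_hsum_x0 K v1 n.
have [c1 c2 c3 c4] := drow_hsum_y0 K v0 m.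
have [e1 e2 e3 e4] := drow_hsum_y0 K v1 n.
have b5 : at_x0 (hsum n.+2 x1 y1) = X1 ^+ n.+1.
  rewrite (hsum_x0 (ev := @at_x0 K)) ?at_x0_xv //; first by rewrite /= at_x0_yv.
    exact: at_x0_xv.
  by rewrite /= at_x0_yv mpolyX_neq0.
have e5 : at_y0 (hsum n.+2 x1 y1) = X1 ^+ n.+1.
  rewrite (hsum_y0 (ev := @at_y0 K)) ?at_y0_yv //; first by rewrite /= at_y0_xv.
    exact: at_y0_yv.
  by rewrite /= at_y0_xv mpolyX_neq0.
have row_q1 : drow (@at_x0 K) (hsum m.+2 x0 y0 + y1 ^+ n.+2)
    = (X0 ^+ m, 0, m.+1%:R * X0 ^+ m, n.+2%:R * X1 ^+ n.+1).
  rewrite /drow !mderivD !mderiv_exp !dvarE !rmorphD /= a1 a2 a3 a4 !rmorphM /=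
    !rmorphXn !rmorph_nat !rmorph0 /= at_x0_yv.
  by move: X0 X1 => a b; ring_units.
have row_q2 : drow (@at_x0 K) (x0 * hsum n.+2 x1 y1) = (X1 ^+ n.+1, 0, 0, 0).
  rewrite /drow !mderivM !dvarE !rmorphD !rmorphM /= at_x0_xv b5 !rmorph_nat !rmorph0.
  by ring_units.
have row_q1' : drow (@at_y0 K) (hsum m.+2 x0 y0 + y1 ^+ n.+2)
    = (m.+1%:R * X0 ^+ m, 0, X0 ^+ m, 0).
  rewrite /drow !mderivD !mderiv_exp !dvarE !rmorphD /= c1 c2 c3 c4 !rmorphM /=
    !rmorphXn !rmorph_nat !rmorph0 /= at_y0_yv expr0n /=.
  by ring_units.
have row_q2' : drow (@at_y0 K) (x0 * hsum n.+2 x1 y1)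
    = (X1 ^+ n.+1, X0 * (n.+1%:R * X1 ^+ n), 0, X0 * X1 ^+ n).
  rewrite /drow !mderivM !dvarE !rmorphD !rmorphM /= at_y0_xv e5 e1 e2 e3 e4 !rmorph_nat
    !rmorph0.
  by ring_units.
apply: (koszul_equivalent (r1 := w v0) (r2 := w v1) _ _ _ _ _ lin lin
  (drow_diff_x0 K v0) (drow_diff_x0 K v1) row_q1 row_q2
  (drow_diff_y0 K v0) (drow_diff_y0 K v1) row_q1' row_q2').
- rewrite [(y0 - x0) * (_ + _)]mulrDr [(y1 - x1) * (_ * _)]mulrCA (hsumE m.+2 x0 y0) (hsumE n.+2 x1 y1).
  rewrite (in_ychain K m.+2 n.+2) (in_xchain K m.+2 n.+2).
  by move: y0 x0 (y0 ^+ _) (y1 ^+ _) (x0 ^+ _) (x1 ^+ _) => y x a b c d; ring.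
- by apply: whomogB (erefl _); [apply: whomog_yv|apply: whomog_xv].
- by apply: whomogB (erefl _); [apply: whomog_yv|apply: whomog_xv].
- apply: (whomogD (r' := n.+2%:R * w v1)); last by rewrite deg1.
    by rewrite -deg0; apply: whomog_hsum; [apply: whomog_xv|apply: whomog_yv].
  by apply: whomogE; apply: whomog_yv.
- apply: (whomog_eq (r := w v0 + n.+1%:R * w v1)).
    apply: whomogM; first exact: whomog_xv.
    by apply: whomog_hsum; [apply: whomog_xv|apply: whomog_yv].
  rewrite -[w v0](opprK) -[- w v0](addrK 2) [- w v0 + 2]addrC -deg1 -[n.+2%:R]natr1.
  by ring.
- have := linear_form_scale_neq0 lin nzc' nzres'; congr (residue _ _ _ != 0).
  rewrite /det4 !eqxx v01 v10 !trueR !falseR mpolyCN mpolyC_nat expr0 exprD.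
  rewrite !(exprS X1 n.+1) !(exprS X1 n).
  by move: (X0 ^+ m) (X1 ^+ n) X1 => a b c; ring.
have := linear_form_scale_neq0 lin nzc nzres; congr (residue _ _ _ != 0).
rewrite /det4 !eqxx v01 v10 !trueR !falseR mpolyC_nat natrM.
rewrite -[m.+2%:R]natr1 -[n.+2%:R]natr1 [X0 ^+ m.+1]exprS.
by move: (X0 ^+ m) X0 (X1 ^+ n) (X1 ^+ n.+1) => a a' b c; ring.
Qed.

(** The substitution y0 = x0^2, x1 = x0 y1 identifies the two potentials: D becomes A on the double
    cover. Hence W(y) - V(x) lies in the ideal of [y0 - x0^2] and [x0 y1 - x1], the first entries of
    the Koszul factorisation. The Jacobian is [-4 X1^2] at x = 0 and [4(m+2) X0^(2m+2)] at y = 0. *)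
Lemma A_D_equivalent m (wV wW : 'I_2 -> rat) :
  wV v0 = 2 / (m + m).+4%:R -> wV v1 = 1 ->
  wW v0 = 2 / m.+2%:R -> wW v1 = 1 - 1 / m.+2%:R ->
  strongly_equivalent wV (fermat K (m + m).+4 2) wW (chain K m.+2 2).
Proof.
move=> wV0 wV1 wW0 wW1.
have nzr : m.+2%:R != 0 :> rat by rewrite pnatr_eq0.
have wV0' : wV v0 = 1 / m.+2%:R.
  rewrite wV0 (_ : (m + m).+4 = (m.+2 * 2)%N); last lia.
  by rewrite natrM; move: m.+2%:R nzr => a nza; field.
have resV : is_residue wV (fermat K (m + m).+4 2) (residue wV (fermat K (m + m).+4 2)).
  by apply: (@residueP_fermat K (m + m).+2 0) => //; rewrite wV1 divff.
have resW : is_residue wW (chain K m.+2 2) (residue wW (chain K m.+2 2)).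
  apply: (@residueP_chain K m 0) => //; rewrite wW1.
  by move: m.+2%:R nzr => a nza; field.
have [linV _ _ _] := resV; have [linW _ _ _] := resW.
have nzV := @residue_fermat_neq0 K wV (m + m).+2 0 _ resV.
have nzW := @residue_chain_neq0' K wW m 0 _ resW.
have nz4 : - 4%:R != 0 :> K by rewrite oppr_eq0 pnatr_eq0.
have nz4' : (4 * m.+2)%:R != 0 :> K by rewrite pnatr_eq0.
have x0_0 : at_x0 (x0 ^+ 2) = 0 :> R2 by rewrite rmorphXn /= at_x0_xv expr2 mul0r.
have nzy : at_x0 y0 != 0 by rewrite /= at_x0_yv mpolyX_neq0.
have nzx : at_y0 (x0 ^+ 2) != 0 :> R2.
  by rewrite rmorphXn /= at_y0_xv expf_neq0 // mpolyX_neq0.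
have row_p1 : drow (@at_x0 K) (y0 - x0 ^+ 2) = (0, 0, 1, 0).
  rewrite /drow !mderivB !mderiv_exp !dvarE !rmorphB !rmorphM !rmorphXn /= at_x0_xv
    !rmorph_nat !rmorph0.
  by ring_units.
have row_p2 : drow (@at_x0 K) (x0 * y1 - x1) = (X1, -1, 0, 0).
  rewrite /drow !mderivB !mderivM !dvarE !rmorphB !rmorphD !rmorphM /= at_x0_xv /=
    at_x0_yv !rmorph_nat !rmorph0.
  by ring_units.
have row_q1 : drow (@at_x0 K) (hsum m.+2 (x0 ^+ 2) y0 + y1 ^+ 2)
    = (0, 0, m.+1%:R * X0 ^+ m, 2 * X1).
  rewrite /drow !mderivD !rmorphD /= !(mderiv_hsum_x0 (ev := @at_x0 K) _ _ x0_0 nzy) /=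
    !mderiv_exp !dvarE !rmorphM !rmorphXn /= at_x0_xv /= !at_x0_yv !rmorph_nat !rmorph0.
  by ring_units; rewrite [_ * m.+1%:R]mulrC.
have row_q2 : drow (@at_x0 K) (x0 * y1 + x1) = (X1, 1, 0, 0).
  rewrite /drow !mderivD !mderivM !dvarE !rmorphD !rmorphM /= at_x0_xv /= at_x0_yv
    !rmorph_nat !rmorph0.
  by ring_units.
have row_p1' : drow (@at_y0 K) (y0 - x0 ^+ 2) = (- (2 * X0), 0, 1, 0).
  rewrite /drow !mderivB !mderiv_exp !dvarE !rmorphB !rmorphM !rmorphXn /= at_y0_xv
    !rmorph_nat !rmorph0.
  by ring_units.
have row_p2' : drow (@at_y0 K) (x0 * y1 - x1) = (0, -1, 0, X0).
  rewrite /drow !mderivB !mderivM !dvarE !rmorphB !rmorphD !rmorphM /= at_y0_xv /=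
    at_y0_yv !rmorph_nat !rmorph0.
  by ring_units.
have row_q1' : drow (@at_y0 K) (hsum m.+2 (x0 ^+ 2) y0 + y1 ^+ 2)
    = ((X0 ^+ 2) ^+ m * (m.+1%:R * (2 * X0)), 0, (X0 ^+ 2) ^+ m, 0).
  rewrite /drow !mderivD !rmorphD /= !(mderiv_hsum_y0 (ev := @at_y0 K) _ _ (at_y0_yv K
    v0) nzx) /= !mderiv_exp !dvarE !rmorphM !rmorphXn /= at_y0_xv /= !at_y0_yv
    !rmorph_nat !rmorph0.
  by ring_units.
have row_q2' : drow (@at_y0 K) (x0 * y1 + x1) = (0, 1, 0, X0).
  rewrite /drow !mderivD !mderivM !dvarE !rmorphD !rmorphM /= at_y0_xv /= at_y0_yv
    !rmorph_nat !rmorph0.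
  by ring_units.
have degx : whomog (wxy wV wW) (wW v0) (x0 ^+ 2 : R4).
  apply: (whomog_eq (whomogE (e := 2) (@whomog_xv K wV wW v0))).
  by rewrite wV0' wW0 mul1r.
apply: (koszul_equivalent (r1 := wW v0) (r2 := 1) _ _ _ _ _ linV linW
  row_p1 row_p2 row_q1 row_q2 row_p1' row_p2' row_q1' row_q2').
- rewrite [(y0 - _) * (_ + _)]mulrDr (hsumE m.+2 (x0 ^+ 2) y0) (in_ychain K m.+2 2).
  rewrite (in_xfermat K (m + m).+4 2) -exprM (_ : (2 * m.+2)%N = (m + m).+4); last lia.
  by move: x0 x1 y0 y1 (y0 ^+ m.+2) (x0 ^+ (m + m).+4) => *; ring.
- by apply: (whomogB (@whomog_yv K _ _ _) degx).
- apply: (whomogB (r' := 1)) => //; last by rewrite -wV1; apply: whomog_xv.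
  apply: (whomog_eq (whomogM (@whomog_xv K wV wW v0) (@whomog_yv K wV wW v1))).
  rewrite wV0' wW1; move: m.+2%:R => a; ring.
- apply: (whomogD (r' := 2%:R * wW v1)).
  + apply: (whomog_eq (whomog_hsum (n := m.+1) degx (@whomog_yv K wV wW v0))).
    rewrite wW0 -[m.+1%:R](addrK 1) natr1; move: m.+2%:R nzr => a nza.
    by field.
  + by apply: whomogE; apply: whomog_yv.
  + by rewrite wW0 wW1; move: m.+2%:R => a; ring.
- apply: (whomog_eq (r := 1)); last by ring.
  apply: (whomogD (r' := 1)) => //; last by rewrite -wV1; apply: whomog_xv.
  apply: (whomog_eq (whomogM (@whomog_xv K wV wW v0) (@whomog_yv K wV wW v1))).
  by rewrite wV0' wW1; move: m.+2%:R => a; ring.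
- have := linear_form_scale_neq0 linW nz4 nzW; congr (residue _ _ _ != 0).
  rewrite /det4 mpolyCN mpolyC_nat expr0 add0n.
  by move: (X0 ^+ m) X1 => a b; ring.
have := linear_form_scale_neq0 linV nz4' nzV; congr (residue _ _ _ != 0).
rewrite /det4 mpolyC_nat natrM -[m.+2%:R]natr1 expr0 mulr1.
rewrite (_ : (m + m).+2 = (2 + 2 * m)%N); last lia.
rewrite exprD exprM.
by move: ((X0 ^+ 2) ^+ m) X0 => a b; ring.
Qed.

End ChainAndAD.

(** * Traces of derivatives of a matrix split into parts even and odd in x *)

Section MatrixDerivation.
Variable K : fieldType.
Variable l : nat.
Local Notation P := {mpoly K[l]}.

Lemma dmxD i m n (A B : 'M[P]_(m, n)) :
  map_mx (mderiv i) (A + B) = map_mx (mderiv i) A + map_mx (mderiv i) B.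
Proof. exact: raddfD. Qed.

Lemma dmxB i m n (A B : 'M[P]_(m, n)) :
  map_mx (mderiv i) (A - B) = map_mx (mderiv i) A - map_mx (mderiv i) B.
Proof. exact: raddfB. Qed.

Lemma dmxZ i m n c (A : 'M[P]_(m, n)) :
  map_mx (mderiv i) (c *: A) = c^`M(i) *: A + c *: map_mx (mderiv i) A.
Proof. by apply/matrixP => a b; rewrite mxE mxE mderivM !mxE. Qed.

Lemma dmx_scalar i n c : map_mx (mderiv i) (c%:M : 'M[P]_n) = (c^`M(i))%:M.
Proof.
apply/matrixP => a b; rewrite mxE mxE [RHS]mxE.
by case: (a == b); rewrite ?mulr1n ?mulr0n ?mderiv0.
Qed.

End MatrixDerivation.

Section Traces.
Variables (R : comNzRingType) (n : nat).
Variables (E0 O O0 E2 O2 E3 O3 : 'M[R]_n) (x : R).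

(** Here [O] is the odd part and [E0, O0, E2, O2, E3, O3] are derivatives of the even and the odd
    part. For N = Ne(x^2) + x No(x^2) the trace of the product of the derivatives of N in x, y0, y1
    is [even_trace + x odd_trace], both taken at U = x^2. *)
Definition even_trace (E0 O O0 E2 O2 E3 O3 : 'M[R]_n) (x : R) : R :=
  \tr ((O + (2 * x) *: O0) *m (E2 *m E3 + x *: (O2 *m O3)))
  + (2 * x) * \tr (E0 *m (E2 *m O3 + O2 *m E3)).

Definition odd_trace (E0 O O0 E2 O2 E3 O3 : 'M[R]_n) (x : R) : R :=
  \tr ((O + (2 * x) *: O0) *m (E2 *m O3 + O2 *m E3))
  + 2 * \tr (E0 *m (E2 *m E3 + x *: (O2 *m O3))).

(** The push-forward sees only the part of the trace that is even in x, so A and D can share one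
    computation. The block matrix in second place plays the role of x, with the scalar [x] of this
    statement standing for U. *)
Lemma push_trace :
  \tr (block_mx E0 (O + x *: O0) O0 E0 *m block_mx 0 x%:M 1%:M 0
    *m (block_mx E2 (x *: O2) O2 E2 *m block_mx E3 (x *: O3) O3 E3))
  = even_trace E0 O O0 E2 O2 E3 O3 x.
Proof.
rewrite /even_trace; set P := E2 *m E3 + _; set Q := E2 *m O3 + _.
have -> : block_mx E2 (x *: O2) O2 E2 *m block_mx E3 (x *: O3) O3 E3
    = block_mx P (x *: Q) Q P.
  rewrite mulmx_block -!scalemxAl -!scalemxAr -scalerDr.
  by congr block_mx; rewrite addrC.
rewrite !mulmx_block !mulmx0 !mulmx1 !add0r !addr0 !mul_mx_scalar mxtrace_block.
rewrite !mulmxDl -!scalemxAl -!scalemxAr !mxtraceD !mxtraceZ.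
have key (a b c : R) : a + x * b + x * c + (x * c + x * b) = a + 2 * x * b + 2 * x * c.
  by ring.
exact: key.
Qed.

Lemma square_trace :
  \tr (((2 * x) *: E0 + (O + x *: ((2 * x) *: O0)))
    *m ((E2 + x *: O2) *m (E3 + x *: O3)))
  = even_trace E0 O O0 E2 O2 E3 O3 (x ^+ 2)
    + x * odd_trace E0 O O0 E2 O2 E3 O3 (x ^+ 2).
Proof.
rewrite /even_trace /odd_trace; set P := E2 *m E3 + _; set Q := E2 *m O3 + _.
have -> : (E2 + x *: O2) *m (E3 + x *: O3) = P + x *: Q.
  rewrite mulmxDl !mulmxDr -!scalemxAl -!scalemxAr scalerA -expr2 scalerDr.
  by rewrite [x *: (O2 *m E3) + _]addrC addrACA.
clearbody P Q.
rewrite scalerA !mulmxDl !mulmxDr -!scalemxAl -!scalemxAr !mxtraceD !mxtraceZ.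
have key (a b c e f g : R) :
    2 * x * e + 2 * x * (x * f) + (a + x * b + (x * (2 * x) * c + x * (2 * x) * (x * g)))
    = a + 2 * x ^+ 2 * c + 2 * x ^+ 2 * f + x * (b + 2 * x ^+ 2 * g + 2 * e).
  by ring.
exact: key.
Qed.

(** Only [O E2 E3] comes without a factor x; this one trace decides the left quantum dimension for A
    and for D. *)
Lemma even_trace_mod_x : exists t,
  even_trace E0 O O0 E2 O2 E3 O3 x = \tr (O *m (E2 *m E3)) + x * t.
Proof.
rewrite /even_trace; set P := E2 *m E3; set S := O2 *m O3; set Q := E2 *m O3 + _.
clearbody P Q S.
exists (\tr (O *m S) + 2 * \tr (O0 *m P) + 2 * x * \tr (O0 *m S) + 2 * \tr (E0 *m Q)).
rewrite !mulmxDl !mulmxDr -!scalemxAl -!scalemxAr !mxtraceD !mxtraceZ.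
have key (a b c d e : R) : a + x * b + (2 * x * c + 2 * x * (x * d)) + 2 * x * e
    = a + x * (b + 2 * c + 2 * x * d + 2 * e) by ring.
exact: key.
Qed.

End Traces.

Lemma rmorph_even_trace (R S : comNzRingType) (f : {rmorphism R -> S}) n
    (E0 O O0 E2 O2 E3 O3 : 'M[R]_n) x :
  f (even_trace E0 O O0 E2 O2 E3 O3 x)
  = even_trace (map_mx f E0) (map_mx f O) (map_mx f O0) (map_mx f E2) (map_mx f O2)
      (map_mx f E3) (map_mx f O3) (f x).
Proof.
rewrite /even_trace rmorphD rmorphM -!trace_map_mx !map_mxM !map_mxD !map_mxZ.
by rewrite !map_mxM rmorphM rmorph_nat.
Qed.

Lemma rmorph_odd_trace (R S : comNzRingType) (f : {rmorphism R -> S}) n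
    (E0 O O0 E2 O2 E3 O3 : 'M[R]_n) x :
  f (odd_trace E0 O O0 E2 O2 E3 O3 x)
  = odd_trace (map_mx f E0) (map_mx f O) (map_mx f O0) (map_mx f E2) (map_mx f O2)
      (map_mx f E3) (map_mx f O3) (f x).
Proof.
rewrite /odd_trace rmorphD rmorphM -!trace_map_mx !map_mxM !map_mxD !map_mxZ.
by rewrite !map_mxM rmorphM rmorph_nat.
Qed.

Section PushForward.
Variables (R : comNzRingType) (n : nat) (E O : 'M[R]_n) (x z f : R).
Local Notation N := (block_mx E (x *: O) O E).
Local Notation J := (block_mx 0 x%:M 1%:M 0 : 'M[R]_(n + n)).

(** N is diag(E,E) + diag(O,O) J, where J has square x and commutes with both block diagonal
    matrices; the cross terms then cancel by anticommutation. *)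
Lemma push_square : E *m E + x *: (O *m O) = f%:M -> E *m O + O *m E = 0 ->
  N *m N - z *: (J *m J) = (f - z * x)%:M.
Proof.
move=> sq anti; have anti' : O *m E + E *m O = 0 by rewrite addrC.
have -> : N *m N = f%:M.
  rewrite mulmx_block -!scalemxAl -!scalemxAr -scalerDr anti anti' scaler0.
  by rewrite [x *: _ + _]addrC sq -scalar_mx_block.
have -> : J *m J = x%:M.
  rewrite mulmx_block !mulmx0 !mul0mx !mulmx1 !mul1mx !add0r !addr0.
  by rewrite -scalar_mx_block.
by rewrite scale_scalar_mx raddfB.
Qed.

Lemma push_commute : N *m J = J *m N.
Proof.
rewrite !mulmx_block !mulmx0 !mul0mx !mulmx1 !mul1mx !add0r !addr0.
by rewrite !mul_mx_scalar !mul_scalar_mx.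
Qed.

Lemma square_square : E *m E + x ^+ 2 *: (O *m O) = f%:M -> E *m O + O *m E = 0 ->
  (E + x *: O) *m (E + x *: O) - z *: (1%:M *m 1%:M) = (f - z)%:M.
Proof.
move=> sq anti.
have -> : (E + x *: O) *m (E + x *: O)
    = E *m E + x ^+ 2 *: (O *m O) + x *: (E *m O + O *m E).
  rewrite mulmxDl !mulmxDr -!scalemxAl -!scalemxAr scalerA -expr2 scalerDr.
  by rewrite [x *: (O *m E) + _]addrC addrACA.
by rewrite sq anti scaler0 addr0 mulmx1 scale_scalar_mx mulr1 raddfB.
Qed.

End PushForward.

(** * From a matrix square root to factorisations against A and D *)

Section SquareRoot.
Variable K : numClosedFieldType.
Local Notation R4 := {mpoly K[2 + 2]}.
Local Notation R2 := {mpoly K[2]}.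
Local Notation x0 := ('X_(xv v0) : R4).
Local Notation x1 := ('X_(xv v1) : R4).

Section General.
Variables (wV wW : 'I_2 -> rat) (V W : R2) (n : nat) (q : 'I_n -> rat).
Variables (N J : 'M[R4]_n).

Definition sqrt_q (a : 'I_(n + n)) : rat :=
  match split a with inl i => q i | inr i => q i end.

(** For commuting N and J the two blocks multiply to [N^2 - x1^2 J^2]. Taking J = 1 produces the
    term x1^2 of A, and J with square x0 the term x0 x1^2 of D. *)
Definition sqrt_mf : mf_data K := @MFData K n n sqrt_q (N + x1 *: J) (N - x1 *: J).

Hypothesis NJ : N *m J = J *m N.
Hypothesis sqN : N *m N - x1 ^+ 2 *: (J *m J) = (in_y W - in_x V)%:M.
Hypothesis grN : graded (wxy wV wW) q 1 N.
Hypothesis grJ : graded (wxy wV wW) q (1 - wV v1) J.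
Hypothesis dN : map_mx (mderiv (xv v1)) N = 0.
Hypothesis dJ : map_mx (mderiv (xv v1)) J = 0.
Hypothesis dJ0 : map_mx (mderiv (yv v0)) J = 0.
Hypothesis dJ1 : map_mx (mderiv (yv v1)) J = 0.

(** The derivative in x1 is J in one block and -J in the other, so the two traces of the supertrace
    add up. J may depend on x0, but the terms with [x1] times its derivative carry opposite signs
    and cancel. *)
Lemma sqrt_str : str (qd_product sqrt_mf) = 2 * \tr (map_mx (mderiv (xv v0)) N *m J
  *m (map_mx (mderiv (yv v0)) N *m map_mx (mderiv (yv v1)) N)).
Proof.
rewrite str_qd_product /sqrt_mf /mf_d0 /mf_d1 !dmxB !dmxD !dmxZ dN dJ dJ0 dJ1.
rewrite !dvarE trueR falseR !scaler0 !scale0r !addr0 !add0r !subr0 ?sub0r !scale1r.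
set E := map_mx _ N; set F := x1 *: map_mx _ J.
rewrite mulmxN mulNmx raddfN opprK -raddfD /= -!mulmxDl.
by rewrite addrACA addNr addr0 !mulmxDl raddfD /= mulr_natl mulr2n.
Qed.

Lemma sqrt_graded : is_graded_mf wV wW V W sqrt_mf.
Proof.
have grZ : graded (wxy wV wW) q 1 (x1 *: J).
  move=> a b; rewrite mxE.
  by apply: (whomog_eq (whomogM (@whomog_xv K wV wW v1) (@grJ a b))); ring.
have entB i j : (N - x1 *: J) i j = N i j - (x1 *: J) i j.
  by move: (x1 *: J) => Z; rewrite mxE mxE.
have entD i j : (N + x1 *: J) i j = N i j + (x1 *: J) i j.
  by move: (x1 *: J) => Z; rewrite mxE.
split.
  rewrite /mf_D /= mulmx_block !mul0mx !mulmx0 !addr0 !add0r [RHS]scalar_mx_block.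
  have sqZ : (x1 *: J) *m (x1 *: J) = x1 ^+ 2 *: (J *m J).
    by rewrite -scalemxAl -scalemxAr scalerA.
  have comZ : N *m (x1 *: J) = (x1 *: J) *m N by rewrite -scalemxAl -scalemxAr NJ.
  rewrite -sqN; congr block_mx.
    by rewrite mulmxDr !mulmxBl sqZ comZ addrA subrK.
  by rewrite mulmxBr !mulmxDl sqZ comZ opprD addrA addrK.
move=> a b; rewrite /mf_D /mf_d0 /mf_d1 /mf_q /sqrt_mf /sqrt_q.
case: (split_ordP a) => i ->; case: (split_ordP b) => j ->.
- by rewrite block_mxEul mxE; apply: whomog0.
- rewrite block_mxEur entB.
  by apply: whomogB (erefl _); [exact: grN|exact: grZ].
- rewrite block_mxEdl entD.
  by apply: whomogD (erefl _); [exact: grN|exact: grZ].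
by rewrite block_mxEdr mxE; apply: whomog0.
Qed.

Lemma sqrt_equivalent :
  let S := \tr (map_mx (mderiv (xv v0)) N *m J
    *m (map_mx (mderiv (yv v0)) N *m map_mx (mderiv (yv v1)) N)) in
  linear_form (residue wV V) -> linear_form (residue wW W) ->
  residue wW W (at_x0 S) != 0 -> residue wV V (at_y0 S) != 0 ->
  strongly_equivalent wV V wW W.
Proof.
move=> S linV linW nzl nzr.
have nz2 : 2%:R != 0 :> K by rewrite pnatr_eq0.
exists sqrt_mf; rewrite sqrt_str; split; first exact: sqrt_graded.
- have := linear_form_scale_neq0 linW nz2 nzl; congr (residue _ _ _ != 0).
  by rewrite mpolyC_nat [RHS]rmorphM rmorph_nat.
have := linear_form_scale_neq0 linV nz2 nzr; congr (residue _ _ _ != 0).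
by rewrite mpolyC_nat [RHS]rmorphM rmorph_nat.
Qed.

End General.

Section Families.
Variables (wW : 'I_2 -> rat) (W : R2) (n : nat) (q : 'I_n -> rat) (m : nat).
Variables (Ne No : 'M[R4]_n) (wD wA : 'I_2 -> rat) (c : K).
Hypothesis wD0 : wD v0 = 2 / m.+2%:R.
Hypothesis wD1 : wD v1 = 1 - 1 / m.+2%:R.
Hypothesis wA0 : wA v0 = 2 / (m + m).+4%:R.
Hypothesis wA1 : wA v1 = 1.
Hypothesis linW : linear_form (residue wW W).
Hypothesis sqN : Ne *m Ne + x0 *: (No *m No) = (in_y W - x0 ^+ m.+2)%:M.
Hypothesis anti : Ne *m No + No *m Ne = 0.
Hypothesis grNe : graded (wxy wD wW) q 1 Ne.
Hypothesis grNo : graded (wxy wD wW) q (1 - 1 / m.+2%:R) No.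
Hypothesis dNe : map_mx (mderiv (xv v1)) Ne = 0.
Hypothesis dNo : map_mx (mderiv (xv v1)) No = 0.

Local Notation E0 := (map_mx (mderiv (xv v0)) Ne).
Local Notation O0 := (map_mx (mderiv (xv v0)) No).
Local Notation E2 := (map_mx (mderiv (yv v0)) Ne).
Local Notation O2 := (map_mx (mderiv (yv v0)) No).
Local Notation E3 := (map_mx (mderiv (yv v1)) Ne).
Local Notation O3 := (map_mx (mderiv (yv v1)) No).

Definition sqrt_tr_even : R4 := even_trace E0 No O0 E2 O2 E3 O3 x0.
Definition sqrt_tr_odd : R4 := odd_trace E0 No O0 E2 O2 E3 O3 x0.

Hypothesis nz_left : residue wW W (at_x0 (\tr (No *m (E2 *m E3)))) != 0.
Hypothesis nz_c : c != 0.
Hypothesis eq_right : at_y0 sqrt_tr_even = c%:MP * 'X_v0 ^+ m.+1.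
Hypothesis odd_right : at_y0 sqrt_tr_odd = 0.

Lemma at_x0_tr_even : at_x0 sqrt_tr_even = at_x0 (\tr (No *m (E2 *m E3))).
Proof.
have [t eq_t] := even_trace_mod_x E0 No O0 E2 O2 E3 O3 x0.
rewrite /sqrt_tr_even eq_t; move: (\tr _) => a.
by rewrite rmorphD rmorphM /= at_x0_xv mul0r addr0.
Qed.

Definition pushN : 'M[R4]_(n + n) := block_mx Ne (x0 *: No) No Ne.
Definition pushJ : 'M[R4]_(n + n) := block_mx 0 x0%:M 1%:M 0.
(** The second copy is the first one multiplied by x, whose degree is half that of [x0]. *)
Definition push_q (a : 'I_(n + n)) : rat :=
  match split a with inl i => q i | inr i => q i + 1 / m.+2%:R end.

Lemma D_equivalent_sqrt : strongly_equivalent wD (chain K m.+2 2) wW W.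
Proof.
have nzm : m.+2%:R != 0 :> rat by rewrite pnatr_eq0.
have resD : is_residue wD (chain K m.+2 2) (residue wD (chain K m.+2 2)).
  apply: (@residueP_chain K m 0) => //; rewrite wD1.
  by move: m.+2%:R nzm => a nza; field.
have [linD _ _ _] := resD.
have nzD := @residue_chain_neq0 K wD m 0 _ resD.
have sq_push : pushN *m pushN - x1 ^+ 2 *: (pushJ *m pushJ)
    = (in_y W - in_x (chain K m.+2 2))%:M.
  rewrite /pushN /pushJ (push_square _ sqN anti) (in_xchain K m.+2 2).
  by congr (_%:M); move: x0 (in_y W) (x0 ^+ m.+2) (x1 ^+ 2) => *; ring.
have com : pushN *m pushJ = pushJ *m pushN by exact: push_commute.
have degx : whomog (wxy wD wW) (2 / m.+2%:R) x0.
  by rewrite -wD0; apply: whomog_xv.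
have gr_pushN : graded (wxy wD wW) push_q 1 pushN.
  move=> a b; rewrite /pushN /push_q.
  case: (split_ordP a) => i ->; case: (split_ordP b) => j ->.
  - by rewrite block_mxEul; apply: grNe.
  - rewrite block_mxEur; have -> : (x0 *: No) i j = x0 * No i j by rewrite mxE.
    apply: (whomog_eq (whomogM degx (@grNo i j))).
    by move: m.+2%:R (q i) (q j) => *; ring.
  - rewrite block_mxEdl; apply: (whomog_eq (@grNo i j)).
    by move: m.+2%:R (q i) (q j) => *; ring.
  - rewrite block_mxEdr; apply: (whomog_eq (@grNe i j)).
    by move: m.+2%:R (q i) (q j) => *; ring.
have gr_pushJ : graded (wxy wD wW) push_q (1 - wD v1) pushJ.
  move=> a b; rewrite /pushJ /push_q wD1.
  case: (split_ordP a) => i ->; case: (split_ordP b) => j ->.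
  - by rewrite block_mxEul mxE; apply: whomog0.
  - rewrite block_mxEur; have -> : (x0%:M : 'M_n) i j = x0 *+ (i == j) by rewrite mxE.
    have [->|_] := eqVneq i j; last by rewrite mulr0n; apply: whomog0.
    rewrite mulr1n; apply: (whomog_eq degx).
    by move: m.+2%:R (q j) => *; ring.
  - rewrite block_mxEdl; have -> : (1%:M : 'M[R4]_n) i j = 1 *+ (i == j) by rewrite mxE.
    have [->|_] := eqVneq i j; last by rewrite mulr0n; apply: whomog0.
    rewrite mulr1n; apply: (whomog_eq (@whomog1 K _ _)).
    by move: m.+2%:R (q j) => *; ring.
  - by rewrite block_mxEdr mxE; apply: whomog0.
have d1 : (1 : R4) = 1%:MP by rewrite mpolyC1.
have dN : map_mx (mderiv (xv v1)) pushN = 0.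
  by rewrite /pushN map_block_mx !dmxZ dNe dNo !dvarE falseR !scale0r !scaler0 !addr0 block_mx0.
have dJ : map_mx (mderiv (xv v1)) pushJ = 0.
  rewrite /pushJ map_block_mx !map_mx0 !dmx_scalar d1 mderivC !dvarE falseR.
  by rewrite raddf0 block_mx0.
have dJ' i : map_mx (mderiv (yv i)) pushJ = 0.
  rewrite /pushJ map_block_mx !map_mx0 !dmx_scalar d1 mderivC !dvarE.
  by rewrite raddf0 block_mx0.
have tr_push : \tr (map_mx (mderiv (xv v0)) pushN *m pushJ
    *m (map_mx (mderiv (yv v0)) pushN *m map_mx (mderiv (yv v1)) pushN)) = sqrt_tr_even.
  rewrite /pushN /pushJ !map_block_mx !dmxZ !dvarE trueR !scale0r !add0r scale1r.
  exact: push_trace.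
apply: (sqrt_equivalent com sq_push gr_pushN gr_pushJ dN dJ (dJ' _) (dJ' _) linD linW).
  by rewrite tr_push at_x0_tr_even.
(* [X0^(m+1)] spans the socle for [X0^(m+2) + X0 X1^2]. *)
rewrite tr_push eq_right; have := linear_form_scale_neq0 linD nz_c nzD.
by rewrite expr0 mulr1.
Qed.

(** The substitution U = x^2. The variable [x1] goes to 0 because it has different weights in A and
    D; as 0 is homogeneous of every degree, the substitution respects the gradings. *)
Definition sq_x0 : R4 -> R4 := comp_mpoly (mktuple (fun i =>
  if i == xv v0 then x0 ^+ 2 else if i == xv v1 then 0 else 'X_i)).

HB.instance Definition _ := GRing.RMorphism.on sq_x0.

Lemma sq_x0_x0 : sq_x0 x0 = x0 ^+ 2.
Proof. by rewrite /sq_x0 comp_mktupleX eqxx. Qed.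

Lemma sum_xy (F : 'I_(2 + 2) -> R4) :
  \sum_i F i = F (xv v0) + F (xv v1) + (F (yv v0) + F (yv v1)).
Proof. by rewrite big_split_ord !big_ord2. Qed.

Lemma mderiv_sq_x0_x0 p : (sq_x0 p)^`M(xv v0) = 2 * x0 * sq_x0 p^`M(xv v0).
Proof.
rewrite /sq_x0 mderiv_comp sum_xy !eqxx !eq_xv !eq_yv_xv v10 mderiv0 mderiv_exp !dvarE.
by rewrite trueR !mulr0 !addr0 mulr1 expr1 mulrC.
Qed.

Lemma mderiv_sq_x0_x1 p : (sq_x0 p)^`M(xv v1) = 0.
Proof.
rewrite /sq_x0 mderiv_comp sum_xy !eqxx !eq_xv !eq_yv_xv v10 mderiv0 mderiv_exp !dvarE.
by rewrite falseR !mulr0 !addr0.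
Qed.

Lemma mderiv_sq_x0_yv i p : (sq_x0 p)^`M(yv i) = sq_x0 p^`M(yv i).
Proof.
rewrite /sq_x0 mderiv_comp sum_xy !eqxx !eq_xv !eq_yv_xv v10 mderiv0 mderiv_exp !dvarE.
move: i; apply: ord2P; rewrite !dvarE trueR falseR !mulr0 !add0r ?addr0 mulr1 //.
Qed.

Lemma sq_x0_in_y : sq_x0 (in_y W) = in_y W.
Proof.
rewrite /sq_x0 /in_y comp_comp_mpoly; congr (_ \mPo _).
by apply: eq_from_tnth => i; rewrite !tnth_mktuple comp_mktupleX !eq_yv_xv.
Qed.

Lemma whomog_sq_x0 r p : whomog (wxy wD wW) r p -> whomog (wxy wA wW) r (sq_x0 p).
Proof.
apply: whomog_comp => i; case: (split_ordP i) => j ->; last first.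
  by rewrite wxy_yv !eq_yv_xv; apply: whomog_yv.
rewrite wxy_xv !eq_xv; move: j; apply: ord2P; rewrite ?eqxx ?v10; last exact: whomog0.
apply: (whomog_eq (whomogE (e := 2) (@whomog_xv K wA wW v0))).
rewrite wA0 wD0 (_ : (m + m).+4 = (m.+2 * 2)%N); last lia.
have: m.+2%:R != 0 :> rat by rewrite pnatr_eq0.
by rewrite natrM; move: m.+2%:R => a nza; field.
Qed.

Definition sq_X0 : R2 -> R2 := comp_mpoly (mktuple (fun i =>
  if i == v0 then 'X_v0 ^+ 2 else 0)).

HB.instance Definition _ := GRing.RMorphism.on sq_X0.

Lemma at_y0_sq p : at_y0 (sq_x0 p) = sq_X0 (at_y0 p).
Proof.
rewrite /at_y0 /sq_x0 /sq_X0 !comp_comp_mpoly; congr (_ \mPo _).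
apply: eq_from_tnth => i; rewrite !tnth_mktuple.
case: (split_ordP i) => j ->; last first.
  by rewrite !eq_yv_xv comp_mktupleX split_yv comp_mpoly0.
rewrite !eq_xv comp_mktupleX; move: j; apply: ord2P; rewrite ?eqxx ?v10.
  by rewrite rmorphXn /= comp_mktupleX split_xv.
by rewrite comp_mpoly0.
Qed.

Lemma at_x0_sq p : at_x0 (sq_x0 p) = at_x0 p.
Proof.
rewrite /at_x0 /sq_x0 !comp_comp_mpoly; congr (_ \mPo _).
apply: eq_from_tnth => i; rewrite !tnth_mktuple.
case: (split_ordP i) => j ->; last first.
  by rewrite !eq_yv_xv comp_mktupleX split_yv.
rewrite !eq_xv; move: j; apply: ord2P; rewrite ?eqxx ?v10.
  by rewrite rmorphXn /= comp_mktupleX split_xv expr2 mul0r.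
by rewrite comp_mpoly0.
Qed.

Local Notation sigma := (map_mx sq_x0).

Lemma A_equivalent_sqrt : strongly_equivalent wA (fermat K (m + m).+4 2) wW W.
Proof.
have nzm : m.+2%:R != 0 :> rat by rewrite pnatr_eq0.
have resA : is_residue wA (fermat K (m + m).+4 2) (residue wA (fermat K (m + m).+4 2)).
  by apply: (@residueP_fermat K (m + m).+2 0) => //; rewrite wA1 divff.
have [linA _ _ _] := resA.
have nzA := @residue_fermat_neq0 K wA (m + m).+2 0 _ resA.
pose N := sigma Ne + x0 *: sigma No.
have sq_N : N *m N - x1 ^+ 2 *: (1%:M *m 1%:M)
    = (in_y W - in_x (fermat K (m + m).+4 2))%:M.
  have sqN' : sigma Ne *m sigma Ne + x0 ^+ 2 *: (sigma No *m sigma No)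
      = (in_y W - x0 ^+ (m + m).+4)%:M.
    have := congr1 (map_mx sq_x0) sqN.
    rewrite map_mxD map_mxZ !map_mxM map_scalar_mx /= rmorphB rmorphXn /=.
    by rewrite sq_x0_in_y sq_x0_x0 -exprM (_ : (2 * m.+2)%N = (m + m).+4) //; lia.
  have anti' : sigma Ne *m sigma No + sigma No *m sigma Ne = 0.
    by rewrite -!map_mxM -map_mxD anti map_mx0.
  rewrite /N (square_square _ sqN' anti') (in_xfermat K (m + m).+4 2).
  by congr (_%:M); move: (in_y W) (x0 ^+ _) (x1 ^+ 2) => *; ring.
have gr_N : graded (wxy wA wW) q 1 N.
  move=> a b; have -> : N a b = sq_x0 (Ne a b) + x0 * sq_x0 (No a b).
    by rewrite /N; move: Ne No => A B; rewrite !mxE.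
  apply: (whomogD (whomog_sq_x0 (@grNe a b)) (whomogM (@whomog_xv K wA wW v0)
    (whomog_sq_x0 (@grNo a b)))).
  rewrite wA0 (_ : (m + m).+4 = (m.+2 * 2)%N); last lia.
  by rewrite natrM; move: m.+2%:R (q a) (q b) nzm => x y z nzx; field.
have gr_J : graded (wxy wA wW) q (1 - wA v1) (1%:M : 'M[R4]_n).
  move=> a b; have -> : (1%:M : 'M[R4]_n) a b = 1 *+ (a == b) by rewrite mxE.
  have [->|_] := eqVneq a b; last by rewrite mulr0n; apply: whomog0.
  by rewrite mulr1n; apply: (whomog_eq (@whomog1 K _ _)); rewrite wA1; ring.
have dsx (A : 'M[R4]_n) : map_mx (mderiv (xv v0)) (sigma A)
    = (2 * x0) *: sigma (map_mx (mderiv (xv v0)) A).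
  by apply/matrixP => a b; rewrite !mxE mderiv_sq_x0_x0.
have dsx1 (A : 'M[R4]_n) : map_mx (mderiv (xv v1)) (sigma A) = 0.
  by apply/matrixP => a b; rewrite !mxE mderiv_sq_x0_x1.
have dsy i (A : 'M[R4]_n) : map_mx (mderiv (yv i)) (sigma A)
    = sigma (map_mx (mderiv (yv i)) A).
  by apply/matrixP => a b; rewrite !mxE mderiv_sq_x0_yv.
have d1 i : map_mx (mderiv i) (1%:M : 'M[R4]_n) = 0.
  by rewrite dmx_scalar -mpolyC1 mderivC raddf0.
have dN1 : map_mx (mderiv (xv v1)) N = 0.
  by rewrite /N dmxD dmxZ !dsx1 !dvarE falseR scale0r scaler0 !addr0.
have tr_N : \tr (map_mx (mderiv (xv v0)) N *m 1%:M
    *m (map_mx (mderiv (yv v0)) N *m map_mx (mderiv (yv v1)) N))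
    = sq_x0 sqrt_tr_even + x0 * sq_x0 sqrt_tr_odd.
  have n0 : map_mx (mderiv (xv v0)) N
      = (2 * x0) *: sigma E0 + (sigma No + x0 *: ((2 * x0) *: sigma O0)).
    by rewrite /N dmxD dmxZ mderivXU eqxx trueR scale1r !dsx.
  have ny i : map_mx (mderiv (yv i)) N
      = sigma (map_mx (mderiv (yv i)) Ne) + x0 *: sigma (map_mx (mderiv (yv i)) No).
    by rewrite /N dmxD dmxZ dxy scale0r add0r !dsy.
  have e1 : sq_x0 sqrt_tr_even = even_trace (sigma E0) (sigma No) (sigma O0) (sigma E2)
      (sigma O2) (sigma E3) (sigma O3) (x0 ^+ 2).
    by rewrite -sq_x0_x0; exact: (rmorph_even_trace sq_x0).
  have e2 : sq_x0 sqrt_tr_odd = odd_trace (sigma E0) (sigma No) (sigma O0) (sigma E2)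
      (sigma O2) (sigma E3) (sigma O3) (x0 ^+ 2).
    by rewrite -sq_x0_x0; exact: (rmorph_odd_trace sq_x0).
  rewrite (mulmx1 (map_mx (mderiv (xv v0)) N)).
  rewrite n0 (ny v0) (ny v1).
  apply: etrans (square_trace _ _ _ _ _ _ _ _) _.
  by apply: esym; exact (congr2 (fun s t => s + x0 * t) e1 e2).
have com : N *m 1%:M = 1%:M *m N by rewrite mulmx1 mul1mx.
apply: (sqrt_equivalent com sq_N gr_N gr_J dN1 (d1 _) (d1 _) (d1 _) linA linW).
  by rewrite tr_N rmorphD rmorphM /= at_x0_xv mul0r addr0 at_x0_sq at_x0_tr_even.
(* The monomial U^(m+1) becomes x^(2m+2), which spans the socle for x^(2m+4) + z^2; the same
   constant c serves A and D. *)
have eq_e : at_y0 (sq_x0 sqrt_tr_even) = c%:MP * 'X_v0 ^+ (m + m).+2.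
  rewrite at_y0_sq eq_right rmorphM rmorphXn /= {1}/sq_X0 comp_mpolyC.
  rewrite [sq_X0 'X_v0]comp_mktupleX eqxx -exprM.
  by rewrite (_ : (2 * m.+1)%N = (m + m).+2) //; lia.
have eq_o : at_y0 (sq_x0 sqrt_tr_odd) = 0.
  rewrite at_y0_sq.
  rewrite odd_right.
  exact: comp_mpoly0.
have key s t : at_y0 s = c%:MP * 'X_v0 ^+ (m + m).+2 -> at_y0 t = 0 ->
    residue wA (fermat K (m + m).+4 2) (at_y0 (s + x0 * t)) != 0.
  move=> eq_s eq_t; rewrite rmorphD rmorphM /= eq_s eq_t mulr0 addr0.
  by have := linear_form_scale_neq0 linA nz_c nzA; rewrite expr0 mulr1.
rewrite tr_N; exact: (key _ _ eq_e eq_o).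
Qed.

End Families.
End SquareRoot.

(** * Algebraic numbers: coefficients of the rational curves *)

Section Constants.
Variable K : numClosedFieldType.

(** Numbers in the fields below are shown to be non-zero by a cofactor: the conjugate over the
    rationals for E6, an inverse or a multiple of it modulo the defining polynomial for E7 and
    E8. *)
Lemma neq0_of_mul (x y c : K) : x * y = c -> c != 0 -> x != 0.
Proof. by move=> <-; apply: contraNneq => ->; rewrite mul0r. Qed.

Lemma exists_unit_root n (k : K) : k != 0 -> exists2 r, r != 0 & r ^+ n.+1 * k = 1.
Proof.
move=> nzk; exists (n.+1.-root k^-1); last by rewrite rootCK // mulVf.
by rewrite rootC_eq0 // invr_eq0.
Qed.

(** The relations compare coefficients in p^3 + t^4 - x^12 = q^2 for p = a t x + b x^4, q = t^2 + d
    t x^3 + e x^6. With a = 2 the first three give d = 4 and b, e in the field of sqrt 3. The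
    scaling x -> r x multiplies a, b, d, e by r, r^4, r^3, r^6 and turns the value of b^3 - e^2 into
    1. Up to integer factors, [a] and [b (3ae - 2bd)] become the left and right traces. *)
Lemma E6_constants : exists a b d e : K,
  [/\ a ^+ 3 = 2 * d, 3 * a ^+ 2 * b = d ^+ 2 + 2 * e, 3 * a * b ^+ 2 = 2 * d * e
    & b ^+ 3 - e ^+ 2 = 1] /\ a != 0 /\ b * (3 * a * e - 2 * b * d) != 0.
Proof.
have r3 : sqrtC 3 ^+ 2 = 3 :> K by rewrite sqrtCK.
move: (sqrtC 3) r3 => s s2.
have [r nzr rk] : exists2 r, r != 0 & r ^+ 12 * (- 320 - (1664 / 9) * s) = 1 :> K.
  apply: exists_unit_root.
  apply: (@neq0_of_mul _ (- 320 + (1664 / 9) * s) (- (4096 / 27))).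
    by field : s2; rewrite ?pnatr_eq0.
  by rewrite oppr_eq0 mulf_neq0 ?invr_neq0 ?pnatr_eq0.
have nzb : 4 + 4 / 3 * s != 0 :> K.
  apply: (@neq0_of_mul _ (4 - 4 / 3 * s) (32 / 3)).
    by field : s2; rewrite ?pnatr_eq0.
  by rewrite mulf_neq0 ?invr_neq0 ?pnatr_eq0.
have nzg : 64 + 112 / 3 * s != 0 :> K.
  apply: (@neq0_of_mul _ (64 - 112 / 3 * s) (- (256 / 3))).
    by field : s2; rewrite ?pnatr_eq0.
  by rewrite oppr_eq0 mulf_neq0 ?invr_neq0 ?pnatr_eq0.
exists (2 * r), ((4 + 4 / 3 * s) * r ^+ 4), (4 * r ^+ 3), ((16 + 8 * s) * r ^+ 6).
split; [split|split].
- by ring.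
- by field; rewrite ?pnatr_eq0.
- by field : s2; rewrite ?pnatr_eq0.
- by apply: (etrans _ rk); field : s2; rewrite ?pnatr_eq0.
- by rewrite mulf_neq0 ?pnatr_eq0.
have -> : 3 * (2 * r) * ((16 + 8 * s) * r ^+ 6)
    - 2 * ((4 + 4 / 3 * s) * r ^+ 4) * (4 * r ^+ 3) = (64 + 112 / 3 * s) * r ^+ 7.
  by field; rewrite ?pnatr_eq0.
by rewrite !mulf_neq0 ?expf_neq0.
Qed.

(** The relations compare coefficients in p^3 + p t^3 - x^18 = q^2. With c = a = 1 the second gives
    b = 2d - 1, the third e = (6d - 3 - d^2)/2, and the fourth becomes the cubic for d. The powers
    of r come from x -> r x, with r chosen so that b^3 - e^2 becomes 1. *)
Lemma E7_constants : exists a b c d e : K,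
  [/\ a = c ^+ 2, a ^+ 3 + b = 2 * c * d, 3 * a ^+ 2 * b = d ^+ 2 + 2 * c * e,
      3 * a * b ^+ 2 = 2 * d * e & b ^+ 3 - e ^+ 2 = 1]
  /\ c != 0 /\ b * (3 * a * e - 2 * b * d) != 0.
Proof.
have [d d3] : exists d : K, d ^+ 3 = - 6 * d ^+ 2 + 9 * d - 3.
  have [d] := @solve_monicpoly K 3 (fun i => [:: - 3; 9; - 6]`_i) isT.
  by rewrite !big_ord_recr big_ord0 /= => eq_d; exists d; rewrite eq_d; ring.
pose k := (2 * d - 1) ^+ 3 - ((6 * d - 3 - d ^+ 2) / 2) ^+ 2.
have [r nzr rk] : exists2 r, r != 0 & r ^+ 18 * k = 1 :> K.
  apply: exists_unit_root.
  apply: (@neq0_of_mul _ ((172 * 1000 + 368) * d + (26 * 1000 + 220) * d ^+ 2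
    - (137 * 1000 + 56)) 1); last exact: oner_neq0.
  by rewrite /k; field : d3; rewrite ?pnatr_eq0.
have nzb : 2 * d - 1 != 0.
  apply: (@neq0_of_mul _ (23 - 26 * d - 4 * d ^+ 2) 1); last exact: oner_neq0.
  by ring : d3.
have nzg : 3 * ((6 * d - 3 - d ^+ 2) / 2) - 2 * (2 * d - 1) * d != 0.
  apply: (@neq0_of_mul _ (2608 - 3278 * d - 1496 / 3 * d ^+ 2) 1); last exact: oner_neq0.
  by field : d3; rewrite ?pnatr_eq0.
exists (r ^+ 2), ((2 * d - 1) * r ^+ 6), r, (d * r ^+ 5),
  ((6 * d - 3 - d ^+ 2) / 2 * r ^+ 9).
split; [split|split] => //.
- by ring.
- by field; rewrite ?pnatr_eq0.
- by field : d3; rewrite ?pnatr_eq0.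
- by apply: (etrans _ rk); rewrite /k; field; rewrite ?pnatr_eq0.
have -> : 3 * r ^+ 2 * ((6 * d - 3 - d ^+ 2) / 2 * r ^+ 9)
    - 2 * ((2 * d - 1) * r ^+ 6) * (d * r ^+ 5)
    = (3 * ((6 * d - 3 - d ^+ 2) / 2) - 2 * (2 * d - 1) * d) * r ^+ 11.
  by field; rewrite ?pnatr_eq0.
by rewrite !mulf_neq0 ?expf_neq0.
Qed.

(* With u = h t^2 + a t + b and v = h t^3 + c t^2 + d t + e, the first six
   equations say h v^2 = u^3 + t^5 - 1. *)
Lemma E8_constants : exists h a b c d e s : K,
  [/\ 3 * h ^+ 2 * a + 1 = 2 * h ^+ 2 * c,
      3 * h * a ^+ 2 + 3 * h ^+ 2 * b = h * c ^+ 2 + 2 * h ^+ 2 * d,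
      a ^+ 3 + 6 * h * a * b = 2 * h ^+ 2 * e + 2 * h * c * d &
      3 * a ^+ 2 * b + 3 * h * b ^+ 2 = h * d ^+ 2 + 2 * h * c * e]
  /\ [/\ 3 * a * b ^+ 2 = 2 * h * d * e, b ^+ 3 - h * e ^+ 2 = 1, s ^+ 2 * h = 1,
         b != 0 & d - 3 * b != 0].
Proof.
(* With the scale fixed by b = -(3/5) a, the first five relations have a solution in the field
   generated by a root of this quartic; there b^3 - h e^2 is the rational number 729/12500. *)
have [B B4] : exists B : K, B ^+ 4 = - 5 * B ^+ 3 + 10 * B + 5.
  have [B] := @solve_monicpoly K 4 (fun i => [:: 5; 10; 0; - 5]`_i) isT.
  by rewrite !big_ord_recr big_ord0 /= => eq_B; exists B; rewrite eq_B; ring.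
have nz k : k.+1%:R != 0 :> K by rewrite pnatr_eq0.
have [r nzr rk] : exists2 r, r != 0 & r ^+ 15 * (729 / (12 * 1000 + 500)) = 1 :> K.
  apply: exists_unit_root; rewrite mulf_neq0 ?invr_neq0 ?nz //.
  by rewrite -!natrM -natrD pnatr_eq0.
have nz12 : 12 * 1000 + 500 != 0 :> K by rewrite -natrM -natrD pnatr_eq0.
pose h := - (25 / 9) - 7 / 3 * B + 5 / 3 * B ^+ 2 + 4 / 9 * B ^+ 3.
pose i := - 2 - B + B ^+ 2 + B ^+ 3 / 5.
have hi : h * i = 1 by rewrite /h /i; field : B4; rewrite ?pnatr_eq0.
have nzh : h != 0 by apply: (neq0_of_mul hi); apply: oner_neq0.
pose c := 1 + 7 / 5 * B - 2 / 5 * B ^+ 2 - B ^+ 3 / 5.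
pose d := - (3 / 5) - 27 / 25 * B + 9 / 25 * B ^+ 2 + 6 / 25 * B ^+ 3.
pose e := 27 / 50 + 54 / 125 * B - 27 / 125 * B ^+ 2 - 27 / 250 * B ^+ 3.
pose a := 3 / 5 * B; pose b := - (9 / 25 * B).
have nzB : B != 0.
  apply: (@neq0_of_mul _ (B ^+ 3 + 5 * B ^+ 2 - 10) 5) => //.
  by ring : B4.
have e5 : 3 * h ^+ 2 * a + 1 = 2 * h ^+ 2 * c.
  by rewrite /h /a /c; field : B4; rewrite ?pnatr_eq0.
have e4 : 3 * h * a ^+ 2 + 3 * h ^+ 2 * b = h * c ^+ 2 + 2 * h ^+ 2 * d.
  by rewrite /h /a /b /c /d; field : B4; rewrite ?pnatr_eq0.
have e3 : a ^+ 3 + 6 * h * a * b = 2 * h ^+ 2 * e + 2 * h * c * d.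
  by rewrite /h /a /b /c /d /e; field : B4; rewrite ?pnatr_eq0.
have e2 : 3 * a ^+ 2 * b + 3 * h * b ^+ 2 = h * d ^+ 2 + 2 * h * c * e.
  by rewrite /h /a /b /c /d /e; field : B4; rewrite ?pnatr_eq0.
have e1 : 3 * a * b ^+ 2 = 2 * h * d * e.
  by rewrite /h /a /b /d /e; field : B4; rewrite ?pnatr_eq0.
have e0 : b ^+ 3 - h * e ^+ 2 = 729 / (12 * 1000 + 500).
  by rewrite /h /b /e; field : B4; rewrite ?pnatr_eq0 ?nz12.
have nzdb : d - 3 * b != 0.
  apply: (@neq0_of_mul _ (25 / 3 * (- (5 / 27) + B / 9 + B ^+ 2 / 15 + B ^+ 3 / 135)) 1).
    by rewrite /d /b; field : B4; rewrite ?pnatr_eq0.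
  exact: oner_neq0.
(* The exponents of r are the effect of U -> r U on the homogenised curve, whose leading coefficient
   h stands over U. As [i] is the inverse of [h], the root of [i r] is the required [s]. *)
exists (h / r), (a * r ^+ 2), (b * r ^+ 5), (c * r ^+ 2), (d * r ^+ 5), (e * r ^+ 8),
  (sqrtC (i * r)).
have rV : r * r^-1 = 1 by rewrite mulfV.
split; split.
- have -> : 3 * (h / r) ^+ 2 * (a * r ^+ 2) + 1 = 3 * h ^+ 2 * a + 1 by field.
  by rewrite e5; field.
- have -> : 3 * (h / r) * (a * r ^+ 2) ^+ 2 + 3 * (h / r) ^+ 2 * (b * r ^+ 5)
      = r ^+ 3 * (3 * h * a ^+ 2 + 3 * h ^+ 2 * b) by field.
  by rewrite e4; field.
- have -> : (a * r ^+ 2) ^+ 3 + 6 * (h / r) * (a * r ^+ 2) * (b * r ^+ 5)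
      = r ^+ 6 * (a ^+ 3 + 6 * h * a * b) by field.
  by rewrite e3; field.
- have -> : 3 * (a * r ^+ 2) ^+ 2 * (b * r ^+ 5) + 3 * (h / r) * (b * r ^+ 5) ^+ 2
      = r ^+ 9 * (3 * a ^+ 2 * b + 3 * h * b ^+ 2) by field.
  by rewrite e2; field.
- have -> : 3 * (a * r ^+ 2) * (b * r ^+ 5) ^+ 2 = r ^+ 12 * (3 * a * b ^+ 2) by ring.
  by rewrite e1; field.
- by apply: (etrans _ rk); rewrite -e0; field.
- by rewrite sqrtCK mulrACA [i * h]mulrC hi mul1r rV.
- by rewrite !mulf_neq0 ?oppr_eq0 ?mulf_neq0 ?invr_eq0 ?expf_neq0 ?pnatr_eq0.
have -> : d * r ^+ 5 - 3 * (b * r ^+ 5) = (d - 3 * b) * r ^+ 5 by ring.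
by rewrite mulf_neq0 ?expf_neq0.
Qed.

End Constants.

(** * First-order data of matrix entries at x = 0 and y = 0 *)

Section Jets.
Variable K : numClosedFieldType.
Local Notation R4 := {mpoly K[2 + 2]}.
Local Notation R2 := {mpoly K[2]}.

(** The value and the derivatives in x0, y0, y1; the matrices [Ne] and [No] are free of x1. *)
Definition jet (ev : R4 -> R2) (p : R4) (v d0 d2 d3 : R2) : Prop :=
  [/\ ev p = v, ev p^`M(xv v0) = d0, ev p^`M(yv v0) = d2 & ev p^`M(yv v1) = d3].

Lemma jet_eq ev p v d0 d2 d3 v' d0' d2' d3' : jet ev p v d0 d2 d3 ->
  v = v' -> d0 = d0' -> d2 = d2' -> d3 = d3' -> jet ev p v' d0' d2' d3'.
Proof. by move=> h <- <- <- <-. Qed.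

Section Rules.
Variable ev : {rmorphism R4 -> R2}.

Lemma jetD p q v d0 d2 d3 v' d0' d2' d3' :
  jet ev p v d0 d2 d3 -> jet ev q v' d0' d2' d3' ->
  jet ev (p + q) (v + v') (d0 + d0') (d2 + d2') (d3 + d3').
Proof.
by move=> [<- <- <- <-] [<- <- <- <-]; split; rewrite ?mderivD rmorphD.
Qed.

Lemma jetN p v d0 d2 d3 :
  jet ev p v d0 d2 d3 -> jet ev (- p) (- v) (- d0) (- d2) (- d3).
Proof. by move=> [<- <- <- <-]; split; rewrite ?mderivN rmorphN. Qed.

Lemma jetM p q v d0 d2 d3 v' d0' d2' d3' :
  jet ev p v d0 d2 d3 -> jet ev q v' d0' d2' d3' ->
  jet ev (p * q) (v * v') (d0 * v' + v * d0') (d2 * v' + v * d2') (d3 * v' + v * d3').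
Proof.
by move=> [<- <- <- <-] [<- <- <- <-]; split; rewrite ?mderivM ?rmorphD !rmorphM.
Qed.

Lemma jetX p e v d0 d2 d3 : jet ev p v d0 d2 d3 ->
  jet ev (p ^+ e) (v ^+ e) (e%:R * v ^+ e.-1 * d0) (e%:R * v ^+ e.-1 * d2)
    (e%:R * v ^+ e.-1 * d3).
Proof.
by move=> [<- <- <- <-]; split; rewrite ?mderiv_exp ?rmorphM rmorphXn ?rmorph_nat.
Qed.

End Rules.

(** The rules are repeated for the two concrete evaluations as plain functions, the form in which
    goals mention them; [jet_rec] selects a rule by the syntax of the polynomial. *)
Lemma jet_x0D p q v d0 d2 d3 v' d0' d2' d3' :
  jet (@at_x0 K) p v d0 d2 d3 -> jet (@at_x0 K) q v' d0' d2' d3' ->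
  jet (@at_x0 K) (p + q) (v + v') (d0 + d0') (d2 + d2') (d3 + d3').
Proof. exact: jetD. Qed.

Lemma jet_x0N p v d0 d2 d3 :
  jet (@at_x0 K) p v d0 d2 d3 -> jet (@at_x0 K) (- p) (- v) (- d0) (- d2) (- d3).
Proof. exact: jetN. Qed.

Lemma jet_x0M p q v d0 d2 d3 v' d0' d2' d3' :
  jet (@at_x0 K) p v d0 d2 d3 -> jet (@at_x0 K) q v' d0' d2' d3' ->
  jet (@at_x0 K) (p * q) (v * v') (d0 * v' + v * d0') (d2 * v' + v * d2')
    (d3 * v' + v * d3').
Proof. exact: jetM. Qed.

Lemma jet_x0X p e v d0 d2 d3 : jet (@at_x0 K) p v d0 d2 d3 ->
  jet (@at_x0 K) (p ^+ e) (v ^+ e) (e%:R * v ^+ e.-1 * d0) (e%:R * v ^+ e.-1 * d2)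
    (e%:R * v ^+ e.-1 * d3).
Proof. exact: jetX. Qed.

Lemma jet_y0D p q v d0 d2 d3 v' d0' d2' d3' :
  jet (@at_y0 K) p v d0 d2 d3 -> jet (@at_y0 K) q v' d0' d2' d3' ->
  jet (@at_y0 K) (p + q) (v + v') (d0 + d0') (d2 + d2') (d3 + d3').
Proof. exact: jetD. Qed.

Lemma jet_y0N p v d0 d2 d3 :
  jet (@at_y0 K) p v d0 d2 d3 -> jet (@at_y0 K) (- p) (- v) (- d0) (- d2) (- d3).
Proof. exact: jetN. Qed.

Lemma jet_y0M p q v d0 d2 d3 v' d0' d2' d3' :
  jet (@at_y0 K) p v d0 d2 d3 -> jet (@at_y0 K) q v' d0' d2' d3' ->
  jet (@at_y0 K) (p * q) (v * v') (d0 * v' + v * d0') (d2 * v' + v * d2')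
    (d3 * v' + v * d3').
Proof. exact: jetM. Qed.

Lemma jet_y0X p e v d0 d2 d3 : jet (@at_y0 K) p v d0 d2 d3 ->
  jet (@at_y0 K) (p ^+ e) (v ^+ e) (e%:R * v ^+ e.-1 * d0) (e%:R * v ^+ e.-1 * d2)
    (e%:R * v ^+ e.-1 * d3).
Proof. exact: jetX. Qed.

Lemma jet_y0C c : jet (@at_y0 K) c%:MP c%:MP 0 0 0.
Proof. by split; rewrite ?mderivC ?at_y0C ?rmorph0. Qed.

Lemma jet_x0C c : jet (@at_x0 K) c%:MP c%:MP 0 0 0.
Proof. by split; rewrite ?mderivC ?at_x0C ?rmorph0. Qed.

Lemma jet_y0_nat k : jet (@at_y0 K) k%:R k%:R 0 0 0.
Proof. by have := jet_y0C k%:R; rewrite !mpolyC_nat. Qed.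

Lemma jet_x0_nat k : jet (@at_x0 K) k%:R k%:R 0 0 0.
Proof. by have := jet_x0C k%:R; rewrite !mpolyC_nat. Qed.

Lemma jet_y0_0 : jet (@at_y0 K) 0 0 0 0 0.
Proof. exact: (jet_y0_nat 0). Qed.

Lemma jet_x0_0 : jet (@at_x0 K) 0 0 0 0 0.
Proof. exact: (jet_x0_nat 0). Qed.

Lemma jet_y0_xv : jet (@at_y0 K) 'X_(xv v0) 'X_v0 1 0 0.
Proof. by split; rewrite ?dvarE ?at_y0_xv ?rmorph0 ?rmorph_nat. Qed.

Lemma jet_x0_xv : jet (@at_x0 K) 'X_(xv v0) 0 1 0 0.
Proof. by split; rewrite ?dvarE ?at_x0_xv ?rmorph0 ?rmorph_nat. Qed.

Lemma jet_y0_yv0 : jet (@at_y0 K) 'X_(yv v0) 0 0 1 0.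
Proof. by split; rewrite ?dvarE ?at_y0_yv ?rmorph0 ?rmorph_nat. Qed.

Lemma jet_y0_yv1 : jet (@at_y0 K) 'X_(yv v1) 0 0 0 1.
Proof. by split; rewrite ?dvarE ?at_y0_yv ?rmorph0 ?rmorph_nat. Qed.

Lemma jet_x0_yv0 : jet (@at_x0 K) 'X_(yv v0) 'X_v0 0 1 0.
Proof. by split; rewrite ?dvarE ?at_x0_yv ?rmorph0 ?rmorph_nat. Qed.

Lemma jet_x0_yv1 : jet (@at_x0 K) 'X_(yv v1) 'X_v1 0 0 1.
Proof. by split; rewrite ?dvarE ?at_x0_yv ?rmorph0 ?rmorph_nat. Qed.

End Jets.

Ltac jet_rec :=
  lazymatch goal with
  | H : jet ?ev ?p _ _ _ _ |- jet ?ev ?p _ _ _ _ => exact: H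
  | |- jet (@at_x0 _) (?p + ?q) _ _ _ _ => eapply (@jet_x0D _ p q); [jet_rec | jet_rec]
  | |- jet (@at_x0 _) (- ?p) _ _ _ _ => eapply (@jet_x0N _ p); jet_rec
  | |- jet (@at_x0 _) (?p * ?q) _ _ _ _ => eapply (@jet_x0M _ p q); [jet_rec | jet_rec]
  | |- jet (@at_x0 _) (?p ^+ ?k) _ _ _ _ => eapply (@jet_x0X _ p k); jet_rec
  | |- jet (@at_y0 _) (?p + ?q) _ _ _ _ => eapply (@jet_y0D _ p q); [jet_rec | jet_rec]
  | |- jet (@at_y0 _) (- ?p) _ _ _ _ => eapply (@jet_y0N _ p); jet_rec
  | |- jet (@at_y0 _) (?p * ?q) _ _ _ _ => eapply (@jet_y0M _ p q); [jet_rec | jet_rec]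
  | |- jet (@at_y0 _) (?p ^+ ?k) _ _ _ _ => eapply (@jet_y0X _ p k); jet_rec
  | |- jet (@at_x0 _) 0 _ _ _ _ => exact: jet_x0_0
  | |- jet (@at_y0 _) 0 _ _ _ _ => exact: jet_y0_0
  | |- jet (@at_x0 _) (_ *+ _) _ _ _ _ => exact: jet_x0_nat
  | |- jet (@at_y0 _) (_ *+ _) _ _ _ _ => exact: jet_y0_nat
  | |- jet (@at_x0 _) (@mpolyC _ _ _) _ _ _ _ => exact: jet_x0C
  | |- jet (@at_y0 _) (@mpolyC _ _ _) _ _ _ _ => exact: jet_y0C
  | |- jet (@at_x0 _) (@mpolyX _ _ U_(xv _)%MM) _ _ _ _ => exact: jet_x0_xv
  | |- jet (@at_y0 _) (@mpolyX _ _ U_(xv _)%MM) _ _ _ _ => exact: jet_y0_xv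
  | |- jet (@at_x0 _) (@mpolyX _ _ U_(yv v0)%MM) _ _ _ _ => exact: jet_x0_yv0
  | |- jet (@at_y0 _) (@mpolyX _ _ U_(yv v0)%MM) _ _ _ _ => exact: jet_y0_yv0
  | |- jet (@at_x0 _) (@mpolyX _ _ U_(yv v1)%MM) _ _ _ _ => exact: jet_x0_yv1
  | |- jet (@at_y0 _) (@mpolyX _ _ U_(yv v1)%MM) _ _ _ _ => exact: jet_y0_yv1
  end.

(** * Syntactic proofs of homogeneity and of independence of x1 *)

Section Homogeneity.
Variable K : numClosedFieldType.
Local Notation R4 := {mpoly K[2 + 2]}.
Variables (wV wW : 'I_2 -> rat).
Implicit Types p q : R4.

Lemma hom_add p q r r' : whomog (wxy wV wW) r p -> whomog (wxy wV wW) r' q -> r = r' ->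
  whomog (wxy wV wW) r (p + q).
Proof. exact: whomogD. Qed.

Lemma hom_opp p r : whomog (wxy wV wW) r p -> whomog (wxy wV wW) r (- p).
Proof. exact: whomogN. Qed.

Lemma hom_mul p q r r' : whomog (wxy wV wW) r p -> whomog (wxy wV wW) r' q ->
  whomog (wxy wV wW) (r + r') (p * q).
Proof. exact: whomogM. Qed.

Lemma hom_exp p e r : whomog (wxy wV wW) r p -> whomog (wxy wV wW) (e%:R * r) (p ^+ e).
Proof. exact: whomogE. Qed.

Lemma hom_const c : whomog (wxy wV wW) 0 (c%:MP : R4).
Proof. exact: whomogC. Qed.

Lemma hom_nat k : whomog (wxy wV wW) 0 (k%:R : R4).
Proof. by rewrite -mpolyC_nat; apply: whomogC. Qed.

Definition free_x1 p := p^`M(xv v1) = 0.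

Lemma free_x1D p q : free_x1 p -> free_x1 q -> free_x1 (p + q).
Proof. by move=> hp hq; rewrite /free_x1 mderivD hp hq addr0. Qed.

Lemma free_x1N p : free_x1 p -> free_x1 (- p).
Proof. by move=> hp; rewrite /free_x1 mderivN hp oppr0. Qed.

Lemma free_x1M p q : free_x1 p -> free_x1 q -> free_x1 (p * q).
Proof. by move=> hp hq; rewrite /free_x1 mderivM hp hq mulr0 mul0r addr0. Qed.

Lemma free_x1E p e : free_x1 p -> free_x1 (p ^+ e).
Proof. by move=> hp; rewrite /free_x1 mderiv_exp hp mulr0. Qed.

Lemma free_x1C c : free_x1 c%:MP.
Proof. exact: mderivC. Qed.

Lemma free_x1_nat k : free_x1 k%:R.
Proof. by rewrite -mpolyC_nat; apply: free_x1C. Qed.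

Lemma free_x1_xv : free_x1 'X_(xv v0).
Proof. by rewrite /free_x1 dxx. Qed.

Lemma free_x1_yv i : free_x1 'X_(yv i).
Proof. exact: dyx. Qed.

End Homogeneity.

Ltac hom_rec :=
  lazymatch goal with
  | H : whomog _ _ ?p |- whomog _ _ ?p => exact: H
  | |- whomog _ _ (?p + ?q) => eapply (@hom_add _ _ _ p q); [hom_rec | hom_rec | ]
  | |- whomog _ _ (- ?p) => eapply (@hom_opp _ _ _ p); hom_rec
  | |- whomog _ _ (?p * ?q) => eapply (@hom_mul _ _ _ p q); [hom_rec | hom_rec]
  | |- whomog _ _ (?p ^+ ?e) => eapply (@hom_exp _ _ _ p e); hom_rec
  | |- whomog _ _ 0 => eapply whomog0
  | |- whomog _ _ (_ *+ _) => eapply hom_nat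
  | |- whomog _ _ (@mpolyC _ _ _) => eapply hom_const
  | |- whomog _ _ (@mpolyX _ _ U_(xv _)%MM) => eapply whomog_xv
  | |- whomog _ _ (@mpolyX _ _ U_(yv _)%MM) => eapply whomog_yv
  end.

Ltac free_rec :=
  lazymatch goal with
  | |- free_x1 (?p + ?q) => apply (@free_x1D _ p q); free_rec
  | |- free_x1 (- ?p) => apply (@free_x1N _ p); free_rec
  | |- free_x1 (?p * ?q) => apply (@free_x1M _ p q); free_rec
  | |- free_x1 (?p ^+ ?e) => apply (@free_x1E _ p e); free_rec
  | |- free_x1 0 => apply (free_x1_nat _ 0)
  | |- free_x1 (_ *+ _) => apply free_x1_nat
  | |- free_x1 (@mpolyC _ _ _) => apply free_x1C
  | |- free_x1 (@mpolyX _ _ U_(xv _)%MM) => apply free_x1_xv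
  | |- free_x1 (@mpolyX _ _ U_(yv _)%MM) => apply free_x1_yv
  end.

Ltac weights := rewrite ?eqxx ?v10; repeat match goal with
  | H : _ v0 = _ |- _ => rewrite !H | H : _ v1 = _ |- _ => rewrite !H end.

Ltac atoms := repeat match goal with
  | |- context [@mpolyC ?n ?F ?c] => move: (@mpolyC n F c) => ?
  | |- context [@mpolyX ?n ?F ?m] => move: (@mpolyX n F m) => ? end.

Ltac hom := lazymatch goal with
  | |- whomog _ _ 0 => exact: whomog0
  | |- whomog _ ?r ?p =>
  eapply (@whomog_eq _ _ _ _ r p); [hom_rec | ] end.

(** * E6 and E7: square roots of rank 2 *)

Section SquareRootsRankTwo.
Variables (R : comNzRingType) (U y t : R).

(* The curve  y = p, z = q  on the surface  y^3 + t^4 - x^12 = z^2,  with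
   p = a t x + b x^4  and  q = t^2 + d t x^3 + e x^6,  gives the square root
   [[q, y - p], [y^2 + p y + p^2, - q]]  of  y^3 + t^4 - x^12;  its parts that are
   even and odd in x are written in U = x^2. *)
Definition E6_even (a b e : R) : 'M[R]_2 :=
  mx2 (t ^+ 2 + e * U ^+ 3) (y - b * U ^+ 2)
      (y ^+ 2 + b * U ^+ 2 * y + b ^+ 2 * U ^+ 4 + a ^+ 2 * U * t ^+ 2)
      (- (t ^+ 2 + e * U ^+ 3)).

Definition E6_odd (a b d : R) : 'M[R]_2 :=
  mx2 (d * t * U) (- (a * t)) (a * t * y + 2 * (a * b * t * U ^+ 2)) (- (d * t * U)).

Lemma E6_square a b d e : a ^+ 3 = 2 * d -> 3 * a ^+ 2 * b = d ^+ 2 + 2 * e ->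
  3 * a * b ^+ 2 = 2 * d * e -> b ^+ 3 - e ^+ 2 = 1 ->
  E6_even a b e *m E6_even a b e + U *: (E6_odd a b d *m E6_odd a b d)
    = (y ^+ 3 + t ^+ 4 - U ^+ 6)%:M
  /\ E6_even a b e *m E6_odd a b d + E6_odd a b d *m E6_even a b e = 0.
Proof.
move=> r1 r2 r3 r4; rewrite !mul_mx2 scale_mx2 !add_mx2 scalar_mx2.
(* The square of the whole matrix is y^3 - p^3 + q^2. Its terms of even degree in x give this
   diagonal identity, those of odd degree the anticommutator [off], so each uses two of the four
   relations. *)
have diag : (t ^+ 2 + e * U ^+ 3) ^+ 2 + (y - b * U ^+ 2) * (y ^+ 2 + b * U ^+ 2 * y
    + b ^+ 2 * U ^+ 4 + a ^+ 2 * U * t ^+ 2)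
    + U * ((d * t * U) ^+ 2 - a * t * (a * t * y + 2 * (a * b * t * U ^+ 2)))
    = y ^+ 3 + t ^+ 4 - U ^+ 6.
  transitivity (y ^+ 3 + t ^+ 4 - (b ^+ 3 - e ^+ 2) * U ^+ 6
    - (3 * a ^+ 2 * b - (d ^+ 2 + 2 * e)) * (t ^+ 2 * U ^+ 3)); first by ring.
  by rewrite r4 r2 subrr mul1r mul0r subr0.
have off : 2 * (t ^+ 2 + e * U ^+ 3) * (d * t * U) + (y - b * U ^+ 2)
    * (a * t * y + 2 * (a * b * t * U ^+ 2)) - a * t * (y ^+ 2 + b * U ^+ 2 * y
    + b ^+ 2 * U ^+ 4 + a ^+ 2 * U * t ^+ 2) = 0.
  transitivity (- (a ^+ 3 - 2 * d) * (t ^+ 3 * U)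
    - (3 * a * b ^+ 2 - 2 * d * e) * (t * U ^+ 4)); first by ring.
  by rewrite r1 r3 !subrr oppr0 !mul0r subr0.
split; first by congr mx2; first [ring | rewrite -diag; ring].
have -> : 0 = mx2 0 0 0 0 :> 'M[R]_2 by rewrite -scalar_mx2 raddf0.
by congr mx2; first [ring | rewrite -[RHS]off; ring].
Qed.

(* Same construction from  y = p, z = q  on  y^3 + y t^3 - x^18 = z^2,  with
   p = a t x^2 + b x^6  and  q = c t^2 x + d t x^5 + e x^9. *)
Definition E7_even (a b : R) : 'M[R]_2 :=
  mx2 0 (y - (a * U * t + b * U ^+ 3))
      (y ^+ 2 + (a * U * t + b * U ^+ 3) * y + (a * U * t + b * U ^+ 3) ^+ 2 + t ^+ 3) 0.

Definition E7_odd (c d e : R) : 'M[R]_2 :=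
  mx2 (c * t ^+ 2 + d * t * U ^+ 2 + e * U ^+ 4) 0 0
      (- (c * t ^+ 2 + d * t * U ^+ 2 + e * U ^+ 4)).

(** Here p is even and q odd in x, so the even part is off-diagonal and the odd part is diagonal
    with opposite entries. They anticommute identically, and all five relations go into the
    square. *)
Lemma E7_square a b c d e : a = c ^+ 2 -> a ^+ 3 + b = 2 * c * d ->
  3 * a ^+ 2 * b = d ^+ 2 + 2 * c * e -> 3 * a * b ^+ 2 = 2 * d * e ->
  b ^+ 3 - e ^+ 2 = 1 ->
  E7_even a b *m E7_even a b + U *: (E7_odd c d e *m E7_odd c d e)
    = (y ^+ 3 + y * t ^+ 3 - U ^+ 9)%:M
  /\ E7_even a b *m E7_odd c d e + E7_odd c d e *m E7_even a b = 0.
Proof.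
move=> r1 r2 r3 r4 r5; rewrite !mul_mx2 scale_mx2 !add_mx2 scalar_mx2.
have diag : (y - (a * U * t + b * U ^+ 3)) * (y ^+ 2 + (a * U * t + b * U ^+ 3) * y
    + (a * U * t + b * U ^+ 3) ^+ 2 + t ^+ 3)
    + U * (c * t ^+ 2 + d * t * U ^+ 2 + e * U ^+ 4) ^+ 2
    = y ^+ 3 + y * t ^+ 3 - U ^+ 9.
  transitivity (y ^+ 3 + y * t ^+ 3 - (b ^+ 3 - e ^+ 2) * U ^+ 9
    - (a - c ^+ 2) * (t ^+ 4 * U) - (a ^+ 3 + b - 2 * c * d) * (t ^+ 3 * U ^+ 3)
    - (3 * a ^+ 2 * b - (d ^+ 2 + 2 * c * e)) * (t ^+ 2 * U ^+ 5)
    - (3 * a * b ^+ 2 - 2 * d * e) * (t * U ^+ 7)); first by ring.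
  by rewrite r5 r4 r3 r2 {1}r1 !subrr mul1r !mul0r !subr0.
split; first by congr mx2; first [ring | rewrite -diag; ring].
have -> : 0 = mx2 0 0 0 0 :> 'M[R]_2 by rewrite -scalar_mx2 raddf0.
by congr mx2; ring.
Qed.

End SquareRootsRankTwo.

Section RankTwo.
Variable K : numClosedFieldType.
Local Notation R4 := {mpoly K[2 + 2]}.
Local Notation R2 := {mpoly K[2]}.
Local Notation X0 := ('X_v0 : R2).
Local Notation X1 := ('X_v1 : R2).
Local Notation U := ('X_(xv v0) : R4).
Local Notation y := ('X_(yv v0) : R4).
Local Notation t := ('X_(yv v1) : R4).

Lemma graded_mx2 w (q : 'I_2 -> rat) r (a b c d : R4) :
  whomog w r a -> whomog w (r + q v1 - q v0) b -> whomog w (r + q v0 - q v1) c ->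
  whomog w r d -> graded w q r (mx2 a b c d).
Proof.
move=> ha hb hc hd; apply: ord2P; apply: ord2P; rewrite mxE /= ?addrK //.
Qed.

Lemma dmx2_free (a b c d : R4) : free_x1 a -> free_x1 b -> free_x1 c -> free_x1 d ->
  map_mx (mderiv (xv v1)) (mx2 a b c d) = 0.
Proof. by move=> ha hb hc hd; rewrite map_mx2 ha hb hc hd -scalar_mx2 raddf0. Qed.

Definition mjet (ev : R4 -> R2) n (A : 'M[R4]_n) (V D0 D2 D3 : 'M[R2]_n) : Prop :=
  [/\ map_mx ev A = V, map_mx ev (map_mx (mderiv (xv v0)) A) = D0,
      map_mx ev (map_mx (mderiv (yv v0)) A) = D2
    & map_mx ev (map_mx (mderiv (yv v1)) A) = D3].

Lemma mjet_mx2 ev (a b c d : R4) va a0 a2 a3 vb b0 b2 b3 vc c0 c2 c3 vd d0 d2 d3 :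
  jet ev a va a0 a2 a3 -> jet ev b vb b0 b2 b3 ->
  jet ev c vc c0 c2 c3 -> jet ev d vd d0 d2 d3 ->
  mjet ev (mx2 a b c d) (mx2 va vb vc vd) (mx2 a0 b0 c0 d0) (mx2 a2 b2 c2 d2)
    (mx2 a3 b3 c3 d3).
Proof.
by move=> [<- <- <- <-] [<- <- <- <-] [<- <- <- <-] [<- <- <- <-]; split;
  rewrite !map_mx2.
Qed.

Section Evaluation.
Variables (n : nat) (Ne No : 'M[R4]_n) (VE E0 E2 E3 VO O0 O2 O3 : 'M[R2]_n).

Lemma sqrt_tr_even_y0 :
  mjet (@at_y0 K) Ne VE E0 E2 E3 -> mjet (@at_y0 K) No VO O0 O2 O3 ->
  at_y0 (sqrt_tr_even Ne No) = even_trace E0 VO O0 E2 O2 E3 O3 X0.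
Proof.
move=> [_ <- <- <-] [<- <- <- <-].
by apply: etrans (rmorph_even_trace (@at_y0 K) _ _ _ _ _ _ _ _) _; rewrite /= at_y0_xv.
Qed.

Lemma sqrt_tr_odd_y0 :
  mjet (@at_y0 K) Ne VE E0 E2 E3 -> mjet (@at_y0 K) No VO O0 O2 O3 ->
  at_y0 (sqrt_tr_odd Ne No) = odd_trace E0 VO O0 E2 O2 E3 O3 X0.
Proof.
move=> [_ <- <- <-] [<- <- <- <-].
by apply: etrans (rmorph_odd_trace (@at_y0 K) _ _ _ _ _ _ _ _) _; rewrite /= at_y0_xv.
Qed.

Lemma sqrt_tr_x0 :
  mjet (@at_x0 K) Ne VE E0 E2 E3 -> mjet (@at_x0 K) No VO O0 O2 O3 ->
  at_x0 (\tr (No *m (map_mx (mderiv (yv v0)) Ne *m map_mx (mderiv (yv v1)) Ne)))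
  = \tr (VO *m (E2 *m E3)).
Proof.
move=> [_ _ <- <-] [<- _ _ _].
by rewrite -!(map_mxM (@at_x0 K)) -(trace_map_mx (@at_x0 K)).
Qed.

End Evaluation.

Lemma neq0_ext (f : R2 -> K) g h : f h != 0 -> g = h -> f g != 0.
Proof. by move=> nz ->. Qed.

Let toP : {rmorphism K -> R4} := @mpolyC (2 + 2) K.

Lemma E6_equivalent (wD wA wW : 'I_2 -> rat) :
  wD v0 = 2 / 6%:R -> wD v1 = 1 - 1 / 6%:R -> wA v0 = 2 / 12%:R -> wA v1 = 1 ->
  wW v0 = 2 / 3%:R -> wW v1 = 2 / 4%:R ->
  strongly_equivalent wA (fermat K 12 2) wW (fermat K 3 4)
  /\ strongly_equivalent wD (chain K 6 2) wW (fermat K 3 4).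
Proof.
move=> wD0 wD1 wA0 wA1 wW0 wW1.
have [a [b [d [e [[r1 r2 r3 r4] [nza nzg]]]]]] := E6_constants K.
have resW := @residueP_fermat K 1 2 wW wW0 wW1; have [linW _ _ _] := resW.
(* The shift -1/3 is forced by the entry [y - p] of degree 2/3, which must equal 1 + q v1 - q v0. *)
pose q (i : 'I_2) : rat := if i == v0 then 0 else - (1 / 3).
pose qe : R4 := t ^+ 2 + e%:MP * U ^+ 3.
pose le : R4 := y - b%:MP * U ^+ 2.
pose re : R4 := y ^+ 2 + b%:MP * U ^+ 2 * y + b%:MP ^+ 2 * U ^+ 4 + a%:MP ^+ 2 * U * t ^+ 2.
pose qo : R4 := d%:MP * t * U.
pose po : R4 := - (a%:MP * t).
pose ro : R4 := a%:MP * t * y + 2 * (a%:MP * b%:MP * t * U ^+ 2).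
pose Ne := mx2 qe le re (- qe).
pose No := mx2 qo po ro (- qo).
have [sqN anti] : Ne *m Ne + U *: (No *m No) = (in_y (fermat K 3 4) - U ^+ 6)%:M
    /\ Ne *m No + No *m Ne = 0.
  (* The relations between constant polynomials are pulled back along the morphism [toP] to the
     relations in K. *)
  rewrite (in_yfermat K 3 4); apply: E6_square; rewrite -?(rmorph_nat toP) -?(rmorph1 toP);
    rewrite -!(rmorphXn toP) -?(rmorphM toP) -?(rmorphD toP) -?(rmorphB toP); congr (toP _);
    exact: r1 || exact: r2 || exact: r3 || exact: r4.
have grE : graded (wxy wD wW) q 1 Ne.
  by apply: graded_mx2; rewrite /qe /le /re; hom; rewrite /q ?eqxx ?v10; weights; field.
have grO : graded (wxy wD wW) q (1 - 1 / 6%:R) No.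
  by apply: graded_mx2; rewrite /qo /po /ro; hom; rewrite /q ?eqxx ?v10; weights; field.
have dNe : map_mx (mderiv (xv v1)) Ne = 0.
  by apply: dmx2_free; rewrite /qe /le /re; free_rec.
have dNo : map_mx (mderiv (xv v1)) No = 0.
  by apply: dmx2_free; rewrite /qo /po /ro; free_rec.
have left : residue wW (fermat K 3 4)
    (at_x0 (\tr (No *m (map_mx (mderiv (yv v0)) Ne *m map_mx (mderiv (yv v1)) Ne)))) != 0.
  (* At x = 0 the trace is [-6a X0 X1^2], a multiple of the socle monomial of E6. *)
  have nz : - (6 * a) != 0 by rewrite oppr_eq0 mulf_neq0 ?pnatr_eq0.
  apply: (neq0_ext (linear_form_scale_neq0 linW nz
    (@residue_fermat_neq0 K wW 1 2 _ resW))).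
  rewrite !(mpolyCN, mpolyCM, mpolyC_nat) /Ne /No /qe /le /re /qo /po /ro.
  eapply etrans; first by eapply sqrt_tr_x0; eapply mjet_mx2; jet_rec.
  rewrite !mul_mx2 trace_mx2.
  by atoms; rewrite [X in X = _]/=; ring.
pose c := 6 * (b * (3 * a * e - 2 * b * d)).
have nzc : c != 0 by rewrite mulf_neq0 ?pnatr_eq0.
have jE : mjet (@at_y0 K) Ne (mx2 (e%:MP * X0 ^+ 3) (- (b%:MP * X0 ^+ 2))
    (b%:MP ^+ 2 * X0 ^+ 4) (- (e%:MP * X0 ^+ 3)))
    (mx2 (3 * e%:MP * X0 ^+ 2) (- (2 * b%:MP * X0)) (4 * b%:MP ^+ 2 * X0 ^+ 3)
      (- (3 * e%:MP * X0 ^+ 2))) (mx2 0 1 (b%:MP * X0 ^+ 2) 0) (mx2 0 0 0 0).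
  rewrite /Ne /qe /le /re.
  apply: mjet_mx2; (eapply jet_eq; [jet_rec|..]);
    by atoms; rewrite /=; ring.
have jO : mjet (@at_y0 K) No (mx2 0 0 0 0) (mx2 0 0 0 0) (mx2 0 0 0 0)
    (mx2 (d%:MP * X0) (- a%:MP) (2 * a%:MP * b%:MP * X0 ^+ 2) (- (d%:MP * X0))).
  rewrite /No /qo /po /ro.
  apply: mjet_mx2; (eapply jet_eq; [jet_rec|..]);
    by atoms; rewrite /=; ring.
have right : at_y0 (sqrt_tr_even Ne No) = c%:MP * X0 ^+ 5.
  rewrite (sqrt_tr_even_y0 jE jO) /c !(mpolyCM, mpolyC_nat, mpolyCB) /even_trace.
  rewrite !(mul_mx2, scale_mx2, add_mx2) !trace_mx2.
  by atoms; ring.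
have odd : at_y0 (sqrt_tr_odd Ne No) = 0.
  rewrite (sqrt_tr_odd_y0 jE jO) /odd_trace.
  rewrite !(mul_mx2, scale_mx2, add_mx2) !trace_mx2.
  by atoms; ring.
split.
  exact: (@A_equivalent_sqrt K wW (fermat K 3 4) 2 q 4 Ne No wD wA c).
exact: (@D_equivalent_sqrt K wW (fermat K 3 4) 2 q 4 Ne No wD c).
Qed.
Lemma E7_equivalent (wD wA wW : 'I_2 -> rat) :
  wD v0 = 2 / 9%:R -> wD v1 = 1 - 1 / 9%:R -> wA v0 = 2 / 18%:R -> wA v1 = 1 ->
  wW v0 = 2 / 3%:R -> wW v1 = (2 - 2 / 3%:R) / 3%:R ->
  strongly_equivalent wA (fermat K 18 2) wW (chain K 3 3)
  /\ strongly_equivalent wD (chain K 9 2) wW (chain K 3 3).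
Proof.
move=> wD0 wD1 wA0 wA1 wW0 wW1.
have [a [b [c [d [e [[r1 r2 r3 r4 r5] [nzc nzg]]]]]]] := E7_constants K.
have resW := @residueP_chain K 1 1 wW wW0 wW1; have [linW _ _ _] := resW.
pose q (i : 'I_2) : rat := if i == v0 then 0 else - (1 / 3).
pose le : R4 := y - (a%:MP * U * t + b%:MP * U ^+ 3).
pose re : R4 := y ^+ 2 + (a%:MP * U * t + b%:MP * U ^+ 3) * y
  + (a%:MP * U * t + b%:MP * U ^+ 3) ^+ 2 + t ^+ 3.
pose qo : R4 := c%:MP * t ^+ 2 + d%:MP * t * U ^+ 2 + e%:MP * U ^+ 4.
pose Ne := mx2 0 le re 0.
pose No := mx2 qo 0 0 (- qo).
have [sqN anti] : Ne *m Ne + U *: (No *m No) = (in_y (chain K 3 3) - U ^+ 9)%:M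
    /\ Ne *m No + No *m Ne = 0.
  rewrite (in_ychain K 3 3); apply: E7_square; rewrite -?(rmorph_nat toP) -?(rmorph1 toP);
    rewrite -!(rmorphXn toP) -?(rmorphM toP) -?(rmorphD toP) -?(rmorphB toP); congr (toP _);
    exact: r1 || exact: r2 || exact: r3 || exact: r4 || exact: r5.
have grE : graded (wxy wD wW) q 1 Ne.
  by apply: graded_mx2; rewrite /le /re; hom; rewrite /q ?eqxx ?v10; weights; field.
have grO : graded (wxy wD wW) q (1 - 1 / 9%:R) No.
  by apply: graded_mx2; rewrite /qo; hom; rewrite /q ?eqxx ?v10; weights; field.
have dNe : map_mx (mderiv (xv v1)) Ne = 0.
  by apply: dmx2_free; rewrite /le /re; free_rec.
have dNo : map_mx (mderiv (xv v1)) No = 0.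
  by apply: dmx2_free; rewrite /qo; free_rec.
have left : residue wW (chain K 3 3)
    (at_x0 (\tr (No *m (map_mx (mderiv (yv v0)) Ne *m map_mx (mderiv (yv v1)) Ne)))) != 0.
  (* At x = 0 the trace is [3c X1^4], which is in the socle of E7 up to the Jacobian ideal. *)
  have nz : 3 * c != 0 by rewrite mulf_neq0 ?pnatr_eq0.
  apply: (neq0_ext (linear_form_scale_neq0 linW nz
    (@residue_chain_neq0' K wW 1 1 _ resW))).
  rewrite !(mpolyCN, mpolyCM, mpolyC_nat) /Ne /No /le /re /qo.
  eapply etrans; first by eapply sqrt_tr_x0; eapply mjet_mx2; jet_rec.
  rewrite !mul_mx2 trace_mx2.
  by atoms; rewrite [X in X = _]/=; ring.
pose g := 9 * (b * (3 * a * e - 2 * b * d)).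
have nzg' : g != 0 by rewrite mulf_neq0 ?pnatr_eq0.
have jE : mjet (@at_y0 K) Ne
    (mx2 0 (- (b%:MP * X0 ^+ 3)) (b%:MP ^+ 2 * X0 ^+ 6) 0)
    (mx2 0 (- (3 * b%:MP * X0 ^+ 2)) (6 * b%:MP ^+ 2 * X0 ^+ 5) 0)
    (mx2 0 1 (b%:MP * X0 ^+ 3) 0)
    (mx2 0 (- (a%:MP * X0)) (2 * a%:MP * b%:MP * X0 ^+ 4) 0).
  rewrite /Ne /le /re.
  apply: mjet_mx2; (eapply jet_eq; [jet_rec|..]);
    by atoms; rewrite /=; ring.
have jO : mjet (@at_y0 K) No (mx2 (e%:MP * X0 ^+ 4) 0 0 (- (e%:MP * X0 ^+ 4)))
    (mx2 (4 * e%:MP * X0 ^+ 3) 0 0 (- (4 * e%:MP * X0 ^+ 3)))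
    (mx2 0 0 0 0) (mx2 (d%:MP * X0 ^+ 2) 0 0 (- (d%:MP * X0 ^+ 2))).
  rewrite /No /qo.
  apply: mjet_mx2; (eapply jet_eq; [jet_rec|..]);
    by atoms; rewrite /=; ring.
have right : at_y0 (sqrt_tr_even Ne No) = g%:MP * X0 ^+ 8.
  rewrite (sqrt_tr_even_y0 jE jO) /g !(mpolyCM, mpolyC_nat, mpolyCB) /even_trace.
  rewrite !(mul_mx2, scale_mx2, add_mx2) !trace_mx2.
  by atoms; ring.
have odd : at_y0 (sqrt_tr_odd Ne No) = 0.
  rewrite (sqrt_tr_odd_y0 jE jO) /odd_trace.
  rewrite !(mul_mx2, scale_mx2, add_mx2) !trace_mx2.
  by atoms; ring.
split.
  exact: (@A_equivalent_sqrt K wW (chain K 3 3) 2 q 7 Ne No wD wA g).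
exact: (@D_equivalent_sqrt K wW (chain K 3 3) 2 q 7 Ne No wD g).
Qed.

End RankTwo.

(** * E8: a square root of rank 4 *)

Section OddEven.
Variables (R : comNzRingType) (n : nat).

(** Parity here refers to the two by two block structure and not to x: for E8 the part even in x is
    block-odd and the part odd in x is block-even. *)
Definition odd_mx (B C : 'M[R]_n) : 'M[R]_(n + n) := block_mx 0 B C 0.
Definition even_mx (A D : 'M[R]_n) : 'M[R]_(n + n) := block_mx A 0 0 D.

Lemma mul_odd_odd B C B' C' : odd_mx B C *m odd_mx B' C' = even_mx (B *m C') (C *m B').
Proof. by rewrite mulmx_block !mulmx0 !mul0mx !add0r !addr0. Qed.

Lemma mul_even_even A D A' D' : even_mx A D *m even_mx A' D' = even_mx (A *m A') (D *m D').
Proof. by rewrite mulmx_block !mulmx0 !mul0mx !add0r !addr0. Qed.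

Lemma mul_odd_even B C A D : odd_mx B C *m even_mx A D = odd_mx (B *m D) (C *m A).
Proof. by rewrite mulmx_block !mulmx0 !mul0mx !add0r !addr0. Qed.

Lemma mul_even_odd B C A D : even_mx A D *m odd_mx B C = odd_mx (A *m B) (D *m C).
Proof. by rewrite mulmx_block !mulmx0 !mul0mx !add0r !addr0. Qed.

Lemma add_odd B C B' C' : odd_mx B C + odd_mx B' C' = odd_mx (B + B') (C + C').
Proof. by rewrite /odd_mx add_block_mx !addr0. Qed.

Lemma add_even A D A' D' : even_mx A D + even_mx A' D' = even_mx (A + A') (D + D').
Proof. by rewrite /even_mx add_block_mx !addr0. Qed.

Lemma scale_even c A D : c *: even_mx A D = even_mx (c *: A) (c *: D).
Proof. by rewrite /even_mx scale_block_mx !scaler0. Qed.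

Lemma trace_odd B C : \tr (odd_mx B C) = 0.
Proof. by rewrite mxtrace_block mxtrace0 addr0. Qed.

Lemma trace_even A D : \tr (even_mx A D) = \tr A + \tr D.
Proof. by rewrite mxtrace_block. Qed.

(** Every product in [odd_trace] has an odd number of block-odd factors, so its trace is 0; no
    entries have to be computed. *)
Lemma odd_trace_odd_even B0 C0 A D A0 D0 B2 C2 A2 D2 B3 C3 A3 D3 x :
  odd_trace (odd_mx B0 C0) (even_mx A D) (even_mx A0 D0) (odd_mx B2 C2) (even_mx A2 D2)
    (odd_mx B3 C3) (even_mx A3 D3) x = 0.
Proof.
rewrite /odd_trace !(mul_odd_odd, mul_odd_even, mul_even_even, mul_even_odd, scale_even,
  add_even, add_odd) !trace_odd.
by rewrite mulr0 addr0.
Qed.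

End OddEven.

Lemma map_odd_mx (R S : comNzRingType) (f : {additive R -> S}) n (B C : 'M[R]_n) :
  map_mx f (odd_mx B C) = odd_mx (map_mx f B) (map_mx f C).
Proof. by rewrite /odd_mx map_block_mx !raddf0. Qed.

Lemma map_even_mx (R S : comNzRingType) (f : {additive R -> S}) n (A D : 'M[R]_n) :
  map_mx f (even_mx A D) = even_mx (map_mx f A) (map_mx f D).
Proof. by rewrite /even_mx map_block_mx !raddf0. Qed.

Section SquareRootRankFour.
Variables (R : comNzRingType) (U y t P Q T s : R).

(* The Koszul factorisation of  2 Q y t - T y^2 - P t^2 = X1 y + X2 t  with
   X1 = Q t - T y, X2 = Q y - P t,  anticommutes with s diag(A, D) where
   A^2 = D^2 = Q^2 - P T. *)
Definition kosB : 'M[R]_2 := mx2 (Q * t - T * y) (Q * y - P * t) (- t) y.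
Definition kosC : 'M[R]_2 := mx2 y (- (Q * y - P * t)) t (Q * t - T * y).
Definition kosA : 'M[R]_2 := mx2 0 (- (s * (P * T - Q ^+ 2))) s 0.
Definition kosD : 'M[R]_2 := mx2 (s * Q) (- (s * P)) (s * T) (- (s * Q)).

Lemma kos_square f :
  2 * Q * y * t - T * y ^+ 2 - P * t ^+ 2 - s ^+ 2 * U * (P * T - Q ^+ 2) = f ->
  odd_mx kosB kosC *m odd_mx kosB kosC + U *: (even_mx kosA kosD *m even_mx kosA kosD)
    = f%:M
  /\ odd_mx kosB kosC *m even_mx kosA kosD + even_mx kosA kosD *m odd_mx kosB kosC = 0.
Proof.
move=> <-; rewrite mul_odd_odd mul_even_even mul_odd_even mul_even_odd scale_even add_even.
rewrite add_odd !(mul_mx2, scale_mx2, add_mx2).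
have z2 : 0 = mx2 0 0 0 0 :> 'M[R]_2 by rewrite -scalar_mx2 raddf0.
split.
  by rewrite [RHS]scalar_mx_block scalar_mx2; congr block_mx; congr mx2; ring.
rewrite -[RHS]block_mx0; congr block_mx => //; rewrite z2; congr mx2; ring.
Qed.

End SquareRootRankFour.

(* The homogenised curve of E8_constants has  y = (h t^2 + a t U^3 + b U^6) / U.
   The pole at U = 0 rules out a square root of rank 2 as for E6 and E7. *)
Lemma E8_identity (R : comNzRingType) (U y t h a b c d e s : R) :
  3 * h ^+ 2 * a + 1 = 2 * h ^+ 2 * c ->
  3 * h * a ^+ 2 + 3 * h ^+ 2 * b = h * c ^+ 2 + 2 * h ^+ 2 * d ->
  a ^+ 3 + 6 * h * a * b = 2 * h ^+ 2 * e + 2 * h * c * d ->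
  3 * a ^+ 2 * b + 3 * h * b ^+ 2 = h * d ^+ 2 + 2 * h * c * e ->
  3 * a * b ^+ 2 = 2 * h * d * e -> b ^+ 3 - h * e ^+ 2 = 1 -> s ^+ 2 * h = 1 ->
  let T := - (y - a * t * U ^+ 2 - b * U ^+ 5) in
  let Q := h * U * ((c - a) * t ^+ 2 + (d - b) * t * U ^+ 3 + e * U ^+ 6) in
  let P := h * ((a * t + b * U ^+ 3) * (U * y + h * t ^+ 2 + a * t * U ^+ 3 + b * U ^+ 6)
     - 2 * h * t * ((c - a) * t ^+ 2 + (d - b) * t * U ^+ 3 + e * U ^+ 6)) in
  2 * Q * y * t - T * y ^+ 2 - P * t ^+ 2 - s ^+ 2 * U * (P * T - Q ^+ 2)
  = y ^+ 3 + t ^+ 5 - U ^+ 15.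
Proof.
move=> r1 r2 r3 r4 r5 r6 r7 T Q P.
pose Q' := U * ((c - a) * t ^+ 2 + (d - b) * t * U ^+ 3 + e * U ^+ 6).
pose P' := (a * t + b * U ^+ 3) * (U * y + h * t ^+ 2 + a * t * U ^+ 3 + b * U ^+ 6)
     - 2 * h * t * ((c - a) * t ^+ 2 + (d - b) * t * U ^+ 3 + e * U ^+ 6).
(* P and Q carry a common factor h. Pulling it out leaves s^2 h, which is 1, so the rest is a
   combination of the relations without s. *)
have -> : s ^+ 2 * U * (P * T - Q ^+ 2) = (s ^+ 2 * h) * (U * (P' * T - h * Q' ^+ 2)).
  by rewrite /P /Q /P' /Q'; ring.
rewrite r7 mul1r.
transitivity (y ^+ 3 - (b ^+ 3 - h * e ^+ 2) * U ^+ 15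
  - (3 * h ^+ 2 * a - 2 * h ^+ 2 * c) * t ^+ 5
  - (3 * h * a ^+ 2 + 3 * h ^+ 2 * b - (h * c ^+ 2 + 2 * h ^+ 2 * d)) * (t ^+ 4 * U ^+ 3)
  - (a ^+ 3 + 6 * h * a * b - (2 * h ^+ 2 * e + 2 * h * c * d)) * (t ^+ 3 * U ^+ 6)
  - (3 * a ^+ 2 * b + 3 * h * b ^+ 2 - (h * d ^+ 2 + 2 * h * c * e)) * (t ^+ 2 * U ^+ 9)
  - (3 * a * b ^+ 2 - 2 * h * d * e) * (t * U ^+ 12)).
  by rewrite /T /P /Q /P' /Q'; ring.
rewrite r6 -r1 r2 r3 r4 r5 !subrr mul1r !mul0r !subr0.
by ring.
Qed.

Section RankFour.
Variable K : numClosedFieldType.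
Local Notation R4 := {mpoly K[2 + 2]}.
Local Notation R2 := {mpoly K[2]}.
Local Notation X0 := ('X_v0 : R2).
Local Notation X1 := ('X_v1 : R2).
Local Notation U := ('X_(xv v0) : R4).
Local Notation y := ('X_(yv v0) : R4).
Local Notation t := ('X_(yv v1) : R4).

Section Blocks.
Variables (w : 'I_(2 + 2) -> rat) (qa qb : 'I_2 -> rat) (r : rat).

Definition sum_q (i : 'I_(2 + 2)) : rat :=
  match split i with inl j => qa j | inr j => qb j end.

Lemma graded_odd (B C : 'M[R4]_2) :
  (forall i j, whomog w (r + qb j - qa i) (B i j)) ->
  (forall i j, whomog w (r + qa j - qb i) (C i j)) ->
  graded w sum_q r (odd_mx B C).
Proof.
move=> hB hC a b; rewrite /odd_mx /sum_q.
case: (split_ordP a) => i ->; case: (split_ordP b) => j ->.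
- by rewrite block_mxEul mxE; apply: whomog0.
- by rewrite block_mxEur.
- by rewrite block_mxEdl.
by rewrite block_mxEdr mxE; apply: whomog0.
Qed.

Lemma graded_even (A D : 'M[R4]_2) :
  (forall i j, whomog w (r + qa j - qa i) (A i j)) ->
  (forall i j, whomog w (r + qb j - qb i) (D i j)) ->
  graded w sum_q r (even_mx A D).
Proof.
move=> hA hD a b; rewrite /even_mx /sum_q.
case: (split_ordP a) => i ->; case: (split_ordP b) => j ->.
- by rewrite block_mxEul.
- by rewrite block_mxEur mxE; apply: whomog0.
- by rewrite block_mxEdl mxE; apply: whomog0.
by rewrite block_mxEdr.
Qed.

Lemma whomog_mx2 (f : 'I_2 -> 'I_2 -> rat) (a b c d : R4) :
  whomog w (f v0 v0) a -> whomog w (f v0 v1) b -> whomog w (f v1 v0) c ->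
  whomog w (f v1 v1) d -> forall i j, whomog w (f i j) (mx2 a b c d i j).
Proof. by move=> ha hb hc hd; apply: ord2P; apply: ord2P; rewrite mxE. Qed.

End Blocks.

Lemma mjet_odd (ev : R4 -> R2) (B C : 'M[R4]_2) VB B0 B2 B3 VC C0 C2 C3 :
  ev 0 = 0 -> mjet ev B VB B0 B2 B3 -> mjet ev C VC C0 C2 C3 ->
  mjet ev (odd_mx B C) (odd_mx VB VC) (odd_mx B0 C0) (odd_mx B2 C2) (odd_mx B3 C3).
Proof.
move=> ev0 [<- <- <- <-] [<- <- <- <-].
have map0 : map_mx ev (0 : 'M_2) = 0 by apply/matrixP => i j; rewrite mxE mxE ev0 mxE.
by split; rewrite ?map_odd_mx /odd_mx map_block_mx map0.
Qed.

Lemma mjet_even (ev : R4 -> R2) (A D : 'M[R4]_2) VA A0 A2 A3 VD D0 D2 D3 :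
  ev 0 = 0 -> mjet ev A VA A0 A2 A3 -> mjet ev D VD D0 D2 D3 ->
  mjet ev (even_mx A D) (even_mx VA VD) (even_mx A0 D0) (even_mx A2 D2) (even_mx A3 D3).
Proof.
move=> ev0 [<- <- <- <-] [<- <- <- <-].
have map0 : map_mx ev (0 : 'M_2) = 0 by apply/matrixP => i j; rewrite mxE mxE ev0 mxE.
by split; rewrite ?map_even_mx /even_mx map_block_mx map0.
Qed.

Let toP : {rmorphism K -> R4} := @mpolyC (2 + 2) K.

Lemma E8_equivalent (wD wA wW : 'I_2 -> rat) :
  wD v0 = 2 / 15%:R -> wD v1 = 1 - 1 / 15%:R -> wA v0 = 2 / 30%:R -> wA v1 = 1 ->
  wW v0 = 2 / 3%:R -> wW v1 = 2 / 5%:R ->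
  strongly_equivalent wA (fermat K 30 2) wW (fermat K 3 5)
  /\ strongly_equivalent wD (chain K 15 2) wW (fermat K 3 5).
Proof.
move=> wD0 wD1 wA0 wA1 wW0 wW1.
have [h [a [b [c [d [e [s [[r1 r2 r3 r4] [r5 r6 r7 nzb nzdb]]]]]]]]] := E8_constants K.
have resW := @residueP_fermat K 1 3 wW wW0 wW1; have [linW _ _ _] := resW.
have nzs : s != 0 by apply/eqP => s0; move/eqP: r7; rewrite s0 expr0n mul0r eq_sym oner_eq0.
have nzh : h != 0 by apply/eqP => h0; move/eqP: r7; rewrite h0 mulr0 eq_sym oner_eq0.
pose qa (i : 'I_2) : rat := if i == v0 then 0 else 14 / 15.
pose qb (i : 'I_2) : rat := if i == v0 then 1 / 3 else 3 / 5.
(* [F] is v - t u for the curve of the constants, homogenised by powers of U^3; the cubic terms of v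
   and t u cancel. On the homogenised curve U T = -h t^2. *)
pose F : R4 := (c - a)%:MP * t ^+ 2 + (d - b)%:MP * t * U ^+ 3 + e%:MP * U ^+ 6.
pose T : R4 := - (y - a%:MP * t * U ^+ 2 - b%:MP * U ^+ 5).
pose Q : R4 := h%:MP * U * F.
pose P : R4 := h%:MP * ((a%:MP * t + b%:MP * U ^+ 3)
  * (U * y + h%:MP * t ^+ 2 + a%:MP * t * U ^+ 3 + b%:MP * U ^+ 6) - 2 * h%:MP * t * F).
pose B := mx2 (Q * t - T * y) (Q * y - P * t) (- t) y.
pose C := mx2 y (- (Q * y - P * t)) t (Q * t - T * y).
pose A := mx2 0 (- (s%:MP * (P * T - Q ^+ 2))) s%:MP 0.
pose D := mx2 (s%:MP * Q) (- (s%:MP * P)) (s%:MP * T) (- (s%:MP * Q)).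
pose Ne := odd_mx B C.
pose No := even_mx A D.
have [sqN anti] : Ne *m Ne + U *: (No *m No) = (in_y (fermat K 3 5) - U ^+ 15)%:M
    /\ Ne *m No + No *m Ne = 0.
  apply: kos_square; rewrite (in_yfermat K 3 5) /T /Q /P /F !mpolyCB.
  apply: E8_identity; rewrite -?(rmorph_nat toP) -?(rmorph1 toP);
    rewrite -!(rmorphXn toP) -?(rmorphM toP) -?(rmorphD toP) -?(rmorphB toP); congr (toP _);
    exact: r1 || exact: r2 || exact: r3 || exact: r4 || exact: r5 || exact: r6 || exact: r7.
have hT : whomog (wxy wD wW) (2 / 3) T by rewrite /T; hom; weights; field.
have hF : whomog (wxy wD wW) (4 / 5) F by rewrite /F; hom; weights; field.
have hQ : whomog (wxy wD wW) (14 / 15) Q by rewrite /Q; hom; weights; field.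
have hP : whomog (wxy wD wW) (6 / 5) P by rewrite /P; hom; weights; field.
have grE : graded (wxy wD wW) (sum_q qa qb) 1 Ne.
  apply: graded_odd.
    by apply: (whomog_mx2 (f := fun i j => 1 + qb j - qa i));
      hom; rewrite /qa /qb ?eqxx ?v10; weights; field.
  by apply: (whomog_mx2 (f := fun i j => 1 + qa j - qb i));
    hom; rewrite /qa /qb ?eqxx ?v10; weights; field.
have grO : graded (wxy wD wW) (sum_q qa qb) (1 - 1 / 15%:R) No.
  apply: graded_even.
    by apply: (whomog_mx2 (f := fun i j => 1 - 1 / 15%:R + qa j - qa i));
      hom; rewrite /qa ?eqxx ?v10; weights; field.
  by apply: (whomog_mx2 (f := fun i j => 1 - 1 / 15%:R + qb j - qb i));
    hom; rewrite /qb ?eqxx ?v10; weights; field.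
have dB : map_mx (mderiv (xv v1)) B = 0.
  by apply: dmx2_free; rewrite /Q /P /T /F; free_rec.
have dC : map_mx (mderiv (xv v1)) C = 0.
  by apply: dmx2_free; rewrite /Q /P /T /F; free_rec.
have dA : map_mx (mderiv (xv v1)) A = 0.
  by apply: dmx2_free; rewrite /Q /P /T /F; free_rec.
have dD : map_mx (mderiv (xv v1)) D = 0.
  by apply: dmx2_free; rewrite /Q /P /T /F; free_rec.
have dNe : map_mx (mderiv (xv v1)) Ne = 0.
  by rewrite /Ne (map_odd_mx (mderiv (xv v1))) dB dC /odd_mx block_mx0.
have dNo : map_mx (mderiv (xv v1)) No = 0.
  by rewrite /No (map_even_mx (mderiv (xv v1))) dA dD /even_mx block_mx0.
(* This is the coefficient of t^3 in [P] at x = 0; the first relation evaluates it to -1, so the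
   left trace is governed by s alone. *)
pose p : K := h * h * (3 * a - 2 * c).
have p_eq : p = - 1.
  by transitivity (3 * h ^+ 2 * a - 2 * h ^+ 2 * c); [rewrite /p|rewrite -r1]; ring.
have left : residue wW (fermat K 3 5)
    (at_x0 (\tr (No *m (map_mx (mderiv (yv v0)) Ne *m map_mx (mderiv (yv v1)) Ne)))) != 0.
  have nz : 15 * s * p != 0 by rewrite p_eq !mulf_neq0 ?oppr_eq0 ?oner_eq0 ?pnatr_eq0.
  apply: (neq0_ext (linear_form_scale_neq0 linW nz
    (@residue_fermat_neq0 K wW 1 3 _ resW))).
  have jT : jet (@at_x0 K) T (- X0) 0 (- 1) 0.
    by rewrite /T; eapply jet_eq; [jet_rec|..]; atoms; rewrite /=; ring.
  have jF : jet (@at_x0 K) F ((c - a)%:MP * X1 ^+ 2) 0 0 ((c - a)%:MP * 2 * X1).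
    by rewrite /F; eapply jet_eq; [jet_rec|..]; atoms; rewrite /=; ring.
  have jQ : jet (@at_x0 K) Q 0 (h%:MP * (c - a)%:MP * X1 ^+ 2) 0 0.
    by rewrite /Q; eapply jet_eq; [jet_rec|..]; atoms; rewrite /=; ring.
  have [u jP] : exists u, jet (@at_x0 K) P (p%:MP * X1 ^+ 3) u 0 (3 * p%:MP * X1 ^+ 2).
    eexists; rewrite /P /p !(mpolyCM, mpolyCB, mpolyC_nat).
    by eapply jet_eq; [jet_rec| |reflexivity| |];
      rewrite !(mpolyCM, mpolyCB, mpolyC_nat); atoms; rewrite /=; ring.
  clearbody p; have ev0 : @at_x0 K 0 = 0 by exact: raddf0.
  rewrite !(mpolyCM, mpolyC_nat) /Ne /No /B /C /A /D.
  eapply etrans.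
    by eapply sqrt_tr_x0; [eapply (mjet_odd ev0)|eapply (mjet_even ev0)]; eapply mjet_mx2; jet_rec.
  rewrite mul_odd_odd mul_even_even trace_even !mul_mx2 !trace_mx2.
  by atoms; rewrite [X in X = _]/=; ring.
pose g : K := s * (h * (30 * (b * b) * (d - b) - 45 * a * b * e + 30 * h * (e * e))
  - 60 * h * (b * b * b - h * (e * e))).
(* The coefficient g of the right trace is opaque, but b g reduces to 30 s h (d - 3b) by the last
   two coefficient relations. *)
have nzg : g != 0.
  have : b * g != 0.
    have -> : b * g = 30 * s * h * (d - 3 * b).
      transitivity (30 * s * h * (d - 3 * b) * (b ^+ 3 - h * e ^+ 2)
        - 15 * s * h * e * (3 * a * b ^+ 2 - 2 * h * d * e)).
        by rewrite /g; ring.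
      by rewrite r5 r6 subrr mulr0 subr0 mulr1.
    by rewrite !mulf_neq0 ?pnatr_eq0.
  by apply: contraNneq => ->; rewrite mulr0.
have [jE jO] : mjet (@at_y0 K) Ne (odd_mx (mx2 0 0 0 0) (mx2 0 0 0 0))
      (odd_mx (mx2 0 0 0 0) (mx2 0 0 0 0))
      (odd_mx (mx2 (- (b%:MP * X0 ^+ 5)) (h%:MP * e%:MP * X0 ^+ 7) 0 1)
        (mx2 1 (- (h%:MP * e%:MP * X0 ^+ 7)) 0 (- (b%:MP * X0 ^+ 5))))
      (odd_mx (mx2 (h%:MP * e%:MP * X0 ^+ 7) (- (h%:MP * b%:MP ^+ 2 * X0 ^+ 9)) (- 1) 0)
        (mx2 0 (h%:MP * b%:MP ^+ 2 * X0 ^+ 9) 1 (h%:MP * e%:MP * X0 ^+ 7)))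
  /\ mjet (@at_y0 K) No
      (even_mx (mx2 0 (- (s%:MP * (h%:MP * (b%:MP ^+ 3 - h%:MP * e%:MP ^+ 2) * X0 ^+ 14)))
          s%:MP 0)
        (mx2 (s%:MP * (h%:MP * e%:MP * X0 ^+ 7)) (- (s%:MP * (h%:MP * b%:MP ^+ 2 * X0 ^+ 9)))
          (s%:MP * (b%:MP * X0 ^+ 5)) (- (s%:MP * (h%:MP * e%:MP * X0 ^+ 7)))))
      (even_mx (mx2 0
          (- (s%:MP * (14 * h%:MP * (b%:MP ^+ 3 - h%:MP * e%:MP ^+ 2) * X0 ^+ 13))) 0 0)
        (mx2 (s%:MP * (7 * h%:MP * e%:MP * X0 ^+ 6))
          (- (s%:MP * (9 * h%:MP * b%:MP ^+ 2 * X0 ^+ 8)))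
          (s%:MP * (5 * b%:MP * X0 ^+ 4)) (- (s%:MP * (7 * h%:MP * e%:MP * X0 ^+ 6)))))
      (even_mx (mx2 0 0 0 0)
        (mx2 0 (- (s%:MP * (h%:MP * b%:MP * X0 ^+ 4))) (- s%:MP) 0))
      (even_mx (mx2 0 (- (s%:MP * (h%:MP * (3 * a%:MP * b%:MP ^+ 2 - 2 * h%:MP * d%:MP * e%:MP)
            * X0 ^+ 11))) 0 0)
        (mx2 (s%:MP * (h%:MP * (d%:MP - b%:MP) * X0 ^+ 4))
          (- (s%:MP * (2 * h%:MP * (a%:MP * b%:MP - h%:MP * e%:MP) * X0 ^+ 6)))
          (s%:MP * (a%:MP * X0 ^+ 2)) (- (s%:MP * (h%:MP * (d%:MP - b%:MP) * X0 ^+ 4))))).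
  have jT : jet (@at_y0 K) T (b%:MP * X0 ^+ 5) (5 * b%:MP * X0 ^+ 4) (- 1) (a%:MP * X0 ^+ 2).
    by rewrite /T; eapply jet_eq; [jet_rec|..]; atoms; rewrite /=; ring.
  have jF : jet (@at_y0 K) F (e%:MP * X0 ^+ 6) (6 * e%:MP * X0 ^+ 5) 0
      ((d%:MP - b%:MP) * X0 ^+ 3).
    by rewrite /F !mpolyCB; eapply jet_eq; [jet_rec|..]; atoms; rewrite /=; ring.
  have jQ : jet (@at_y0 K) Q (h%:MP * e%:MP * X0 ^+ 7) (7 * h%:MP * e%:MP * X0 ^+ 6) 0
      (h%:MP * (d%:MP - b%:MP) * X0 ^+ 4).
    by rewrite /Q; eapply jet_eq; [jet_rec|..]; atoms; rewrite /=; ring.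
  have jP : jet (@at_y0 K) P (h%:MP * b%:MP ^+ 2 * X0 ^+ 9) (9 * h%:MP * b%:MP ^+ 2 * X0 ^+ 8)
      (h%:MP * b%:MP * X0 ^+ 4) (2 * h%:MP * (a%:MP * b%:MP - h%:MP * e%:MP) * X0 ^+ 6).
    by rewrite /P; eapply jet_eq; [jet_rec|..]; atoms; rewrite /=; ring.
  have ev0 : @at_y0 K 0 = 0 by exact: raddf0.
  split; [apply: (mjet_odd ev0) | apply: (mjet_even ev0)]; apply: mjet_mx2;
    by eapply jet_eq; [jet_rec|..]; atoms; rewrite /=; ring.
have right : at_y0 (sqrt_tr_even Ne No) = g%:MP * X0 ^+ 14.
  rewrite (sqrt_tr_even_y0 jE jO) /g !(mpolyCM, mpolyC_nat, mpolyCB, mpolyCD) /even_trace.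
  rewrite !(mul_odd_odd, mul_even_even, mul_odd_even, mul_even_odd, scale_even, add_even,
    add_odd, trace_even).
  rewrite !(mul_mx2, scale_mx2, add_mx2) !trace_mx2.
  (* Products of three block-even factors are cubic in s; this relation brings them down to the
     linear form of g. *)
  have : s%:MP ^+ 2 * h%:MP = 1 :> R2 by rewrite expr2 -!mpolyCM -expr2 r7 mpolyC1.
  by atoms => sh; ring : sh.
have odd : at_y0 (sqrt_tr_odd Ne No) = 0.
  by rewrite (sqrt_tr_odd_y0 jE jO) odd_trace_odd_even.
split.
  exact: (@A_equivalent_sqrt K wW (fermat K 3 5) 4 (sum_q qa qb) 13 Ne No wD wA g).
exact: (@D_equivalent_sqrt K wW (fermat K 3 5) 4 (sum_q qa qb) 13 Ne No wD g).
Qed.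
End RankFour.

(** * Assembling the classes *)

Section Classes.
Variable K : numClosedFieldType.

Lemma wts_A0 d : wts (A d) v0 = 2 / d%:R. Proof. by []. Qed.
Lemma wts_A1 d : wts (A d) v1 = 1. Proof. by []. Qed.
Lemma wts_D0 d : wts (D d) v0 = 2 / d%:R. Proof. by []. Qed.
Lemma wts_D1 d : wts (D d) v1 = 1 - 1 / d%:R. Proof. by []. Qed.
Lemma wts_E61 : wts E6 v1 = 2 / 4%:R. Proof. exact/eqP. Qed.
Lemma wts_E71 : wts E7 v1 = (2 - 2 / 3%:R) / 3%:R. Proof. exact/eqP. Qed.
Lemma wts_E81 : wts E8 v1 = 2 / 5%:R. Proof. by []. Qed.
Lemma wts_E6 : wts E6 v0 = 2 / 3%:R. Proof. by []. Qed.
Lemma wts_E7 : wts E7 v0 = 2 / 3%:R. Proof. by []. Qed.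
Lemma wts_E8 : wts E8 v0 = 2 / 3%:R. Proof. by []. Qed.

Local Notation equiv a b := (strongly_equivalent (wts a) (pot K a) (wts b) (pot K b)).

Lemma A_A d : (2 <= d)%N -> equiv (A d) (A d).
Proof.
case: d => [|[|m]] // _.
by apply: (@fermat_self K m 0 (wts (A m.+2))); rewrite ?wts_A0 ?wts_A1 ?divff // pnatr_eq0.
Qed.

Lemma D_D d : (3 <= d)%N -> equiv (D d) (D d).
Proof.
case: d => [|[|m]] // _.
apply: (@chain_self K m 0 (wts (D m.+2))); first exact: wts_D0.
rewrite wts_D1; have : m.+2%:R != 0 :> rat by rewrite pnatr_eq0.
by move: m.+2%:R => k nzk; field.
Qed.

Lemma A_D d : (3 <= d)%N -> equiv (A (2 * d)) (D d).
Proof.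
case: d => [|[|m]] // _.
have -> : (2 * m.+2 = (m + m).+4)%N by lia.
exact: (@A_D_equivalent K m (wts (A _)) (wts (D _)) (wts_A0 _) (wts_A1 _) (wts_D0 _) (wts_D1 _)).
Qed.

Lemma AD_E6 : equiv (A 12) E6 /\ equiv (D 6) E6.
Proof.
exact: (@E6_equivalent K (wts (D 6)) (wts (A 12)) (wts E6) (wts_D0 6) (wts_D1 6)
  (wts_A0 12) (wts_A1 12) wts_E6 wts_E61).
Qed.

Lemma AD_E7 : equiv (A 18) E7 /\ equiv (D 9) E7.
Proof.
exact: (@E7_equivalent K (wts (D 9)) (wts (A 18)) (wts E7) (wts_D0 9) (wts_D1 9)
  (wts_A0 18) (wts_A1 18) wts_E7 wts_E71).
Qed.

Lemma AD_E8 : equiv (A 30) E8 /\ equiv (D 15) E8.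
Proof.
exact: (@E8_equivalent K (wts (D 15)) (wts (A 30)) (wts E8) (wts_D0 15) (wts_D1 15)
  (wts_A0 30) (wts_A1 30) wts_E8 wts_E81).
Qed.

Lemma E6_E6 : equiv E6 E6.
Proof. exact: (@fermat_self K 1 2 (wts E6) wts_E6 wts_E61). Qed.

Lemma E7_E7 : equiv E7 E7.
Proof. exact: (@chain_self K 1 1 (wts E7) wts_E7 wts_E71). Qed.

Lemma E8_E8 : equiv E8 E8.
Proof. exact: (@fermat_self K 1 3 (wts E8) wts_E8 wts_E81). Qed.

Lemma strongly_equivalent_of_class_key a b : ADE_valid a -> ADE_valid b ->
  class_key a = class_key b -> equiv a b.
Proof.
have [AE6 DE6] := AD_E6; have [AE7 DE7] := AD_E7; have [AE8 DE8] := AD_E8.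
(* Equality of keys excludes the six ordered pairs of distinct E potentials, which [lia] discards.
   Each of the other nineteen is a constructed pair, its mirror, or a potential against itself. *)
case: a => [k|k|||]; case: b => [l|l|||] hk hl; rewrite /class_key => eq_key; try lia.
- by subst l; apply: A_A.
- by subst k; apply: A_D.
- by subst k.
- by subst k.
- by subst k.
- by subst l; apply/strongly_equivalent_sym/A_D.
- by have -> : k = l by [lia]; apply: D_D.
- by have -> : k = 6%N by [lia].
- by have -> : k = 9%N by [lia].
- by have -> : k = 15%N by [lia].
- by subst l; apply: strongly_equivalent_sym.
- by have -> : l = 6%N by [lia]; apply: strongly_equivalent_sym.
- exact: E6_E6.
- by subst l; apply: strongly_equivalent_sym.
- by have -> : l = 9%N by [lia]; apply: strongly_equivalent_sym.
- exact: E7_E7.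
- by subst l; apply: strongly_equivalent_sym.
- by have -> : l = 15%N by [lia]; apply: strongly_equivalent_sym.
- exact: E8_E8.
Qed.

End Classes.

Unset Implicit Arguments.

(* Over C = R[i]: two potentials of the list are orbifold equivalent iff
   they lie in the same listed class. *)
Theorem theorem1p5 (R : realType) (a b : ADE) :
  ADE_valid a -> ADE_valid b ->
  (orbifold_equivalent (wts a) (pot R[i] a) (wts b) (pot R[i] b)
   <-> class_key a = class_key b).
Proof.
move=> va vb; split; first exact: orbifold_equivalent_class_key.
move=> eq_key; apply: strong_orbifold_equivalent; [exact: residueP_ADE.. | ].
exact: (@strongly_equivalent_of_class_key R[i]).
Qed.
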